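(* Let $\eta\in\mathbb N\cup\{\infty\}$ and $\kappa\in\mathbb Z_+$, let $X=X_{\eta,\kappa}$ and $\phi=\phi_{\eta,\kappa}$ be the set and self-map described in the context, and let $\mu$ be a discrete measure on $X$. Assume that $\{\mathsf h_{\phi^n}(x)\}_{n=0}^\infty$ is a Stieltjes moment sequence for every $x\in\{x_0\}\cup\{x_{i,1}:i\in J_\eta\}$. (Then $\{\mathsf h_{\phi^{n+\kappa+1}}(x_0)-\mathsf h_{\phi^n}(x_0)\}_{n=0}^\infty$ is a Stieltjes moment sequence.) If one of the following four conditions is satisfied: (i) $\{\mathsf h_{\phi^{n+\kappa+1}}(x_0)-\mathsf h_{\phi^n}(x_0)\}_{n=0}^\infty$ is S-determinate and there exists an S-representing measure $P(x_0,\cdot)$ of $\{\mathsf h_{\phi^n}(x_0)\}_{n=0}^\infty$ such that $P(x_0,[0,1))=0$, (ii) $\{\mathsf h_{\phi^{n+\kappa+1}}(x_0)-\mathsf h_{\phi^n}(x_0)\}_{n=0}^\infty$ and $\{\mathsf h_{\phi^{j(\kappa+1)}}(x_0)\}_{j=0}^\infty$ are S-determinate, (iii) $\{\mathsf h_{\phi^{j(\kappa+1)}}(x_0)\}_{j=0}^\infty$ satisfies the Carleman condition, (iv) $\{\mathsf h_{\phi^{(j+1)(\kappa+1)}}(x_0)-\mathsf h_{\phi^{j(\kappa+1)}}(x_0)\}_{j=0}^\infty$ satisfies the Carleman condition, then the composition operator $C_\phi$ in $L^2(\mu)$ is subnormal.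
   Context: Notation: $\mathbb N=\{1,2,\ldots\}$, $\mathbb Z_+=\{0,1,2,\ldots\}$, $\mathbb R_+=[0,\infty)$, $J_k=\{i\in\mathbb N:i\le k\}$ for $k\in\mathbb Z_+\cup\{\infty\}$ ($J_0=\emptyset$, $J_\infty=\mathbb N$); $0^0=1$. All measures are positive. The set and the symbol. $X=X_{\eta,\kappa}=\{x_0,\ldots,x_\kappa\}\cup\{x_{i,j}:i\in J_\eta,\ j\in\mathbb N\}$, all listed points being distinct, and $\phi=\phi_{\eta,\kappa}\colon X\to X$ is given by $\phi(x_{i,j})=x_{i,j-1}$ for $i\in J_\eta$, $j\ge2$; $\phi(x_{i,1})=x_\kappa$ for $i\in J_\eta$; $\phi(x_0)=x_\kappa$; $\phi(x_r)=x_{r-1}$ for $r\in J_\kappa$. Operators. A discrete measure on $X$ is a $\sigma$-finite measure $\mu$ on $2^X$ with $\mu(x):=\mu(\{x\})>0$ for all $x\in X$ (so $\mu(x)<\infty$ as well). The composition operator $C_\phi$ in $L^2(\mu)$ has domain $\{f\in L^2(\mu):f\circ\phi\in L^2(\mu)\}$ and $C_\phi f=f\circ\phi$. For $n\in\mathbb Z_+$, $\mathsf h_{\phi^n}(x)=\mu((\phi^n)^{-1}(\{x\}))/\mu(x)\in[0,\infty]$. An operator $A$ in a complex Hilbert space $\mathcal H$ is subnormal if it is densely defined and there is a (possibly unbounded) normal operator $N$ in a complex Hilbert space $\mathcal K\supseteq\mathcal H$ (isometric embedding) with $\mathcal D(A)\subseteq\mathcal D(N)$ and $Af=Nf$ for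 $f\in\mathcal D(A)$. Moments. A real sequence $\{\gamma_n\}_{n=0}^\infty$ is a Stieltjes moment sequence if there is a Borel measure $\nu$ on $\mathbb R_+$ (an S-representing measure) with all moments finite and $\gamma_n=\int_{[0,\infty)}t^n\,d\nu(t)$ for all $n\in\mathbb Z_+$; it is S-determinate if it has exactly one S-representing measure. A sequence $\{\gamma_n\}_{n=0}^\infty\subseteq\mathbb R_+$ satisfies the Carleman condition if $\sum_{n=1}^\infty\gamma_n^{-1/(2n)}=\infty$, with the convention $\frac10=\infty$. *)

(* Defs.v *)
From HB Require Import structures.
From mathcomp Require Import all_boot all_order all_algebra.
From mathcomp Require Import sesquilinear complex.
From mathcomp Require Import all_classical all_reals all_analysis.
From mathcomp Require Import ring lra.

Set Implicit Arguments.
Unset Strict Implicit.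
Unset Printing Implicit Defensive.

Import Order.TTheory GRing.Theory Num.Theory.
Import numFieldNormedType.Exports.

Local Open Scope classical_set_scope.
Local Open Scope complex_scope.
Local Open Scope ring_scope.

(* The inner product is linear in its first argument and conjugate-linear in
   its second one; the norm takes its values in [R[i]]. *)
HB.mixin Record isHilbert (R : realType) H & CompleteNormedModule R[i] H := {
  inner : {dot H for Num.conj};
  norm_inner : forall f : H, `|f| = sqrtC (inner f f)
}.

#[short(type="hilbertType")]
HB.structure Definition Hilbert (R : realType) :=
  {H of isHilbert R H & CompleteNormedModule R[i] H}.

Section operators.
Context (R : realType) (H : hilbertType R).
Implicit Types A B N : set (H * H).

(* An operator in [H] is a linear subspace of [H * H] that is the graph of a
   function. *)
Definition is_operator A :=
  [/\ A (0, 0),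
      forall (a : R[i]) (p q : H * H), A p -> A q ->
        A (a *: p.1 + q.1, a *: p.2 + q.2) &
      forall f g g', A (f, g) -> A (f, g') -> g = g'].

Definition op_dom A : set H := [set f | exists g, A (f, g)].

Definition densely_defined A := dense (op_dom A).

Definition op_closed A := closed A.

(* For densely defined [A], the graph of the adjoint of [A]. *)
Definition adjoint A : set (H * H) :=
  [set p | forall f g, A (f, g) -> inner g p.1 = inner f p.2].

Definition op_comp B A : set (H * H) :=
  [set p | exists2 h, A (p.1, h) & B (h, p.2)].

(* Equality of graphs includes equality of domains, so the last clause is the
   equality N* N = N N* of unbounded operators. *)
Definition op_normal N :=
  [/\ is_operator N, densely_defined N, op_closed N &
      op_comp (adjoint N) N = op_comp N (adjoint N)].

End operators.

(* [V] is the isometric embedding of [H] into [K]. *)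
Definition op_subnormal (R : realType) (H : hilbertType R) (A : set (H * H)) :=
  [/\ is_operator A, densely_defined A &
      exists (K : hilbertType R) (V : {linear H -> K}) (N : set (K * K)),
        [/\ forall f g, inner (V f) (V g) = inner f g, op_normal N &
            forall f g, A (f, g) -> N (V f, V g)]].

Section dot_norm.
Context (C : numClosedFieldType) (U : lmodType C) (form : {dot U for Num.conj}).

Lemma dot_ge0 u : 0 <= form u u.
Proof.
have [->|u0] := eqVneq u 0; first by rewrite linear0r.
exact/ltW/neq0_dnorm_gt0.
Qed.

Lemma dotC u v : form u v = (form v u)^*.
Proof. by rewrite (@hermC C false Num.conj U form) expr0 mul1r. Qed.

Lemma dotZ a u : form (a *: u) (a *: u) = `|a| ^+ 2 * form u u.
Proof. by rewrite linearZl_LR linearZr_LR/= mulrA normCK. Qed.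

Lemma dot_CauchySchwarz u v : `|form u v| <= sqrtC (form u u) * sqrtC (form v v).
Proof.
have [->|v0] := eqVneq v 0.
  by rewrite !linear0r normr0 sqrtC0 mulr0.
have vv : 0 < form v v by exact: neq0_dnorm_gt0.
rewrite -sqrtCM ?nnegrE ?dot_ge0// -[leLHS]sqrCK// ler_sqrtC ?nnegrE//.
- set a := form u v / form v v.
  have ou : form (u - a *: v) v = 0.
    by rewrite linearBl/= linearZl_LR/= divfK ?subrr// gt_eqF.
  have := dot_ge0 (u - a *: v).
  rewrite linearBr/= linearZr_LR/= ou mulr0 subr0 linearBl/= linearZl_LR/=.
  rewrite subr_ge0 /a mulrAC ler_pdivrMr// => /(le_trans _); apply.
  by rewrite normCK (dotC v u).
- by rewrite mulr_ge0 ?dot_ge0.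
Qed.

Lemma dot_normD u v :
  sqrtC (form (u + v) (u + v)) <= sqrtC (form u u) + sqrtC (form v v).
Proof.
rewrite -ler_sqr ?nnegrE ?addr_ge0 ?sqrtC_ge0 ?dot_ge0// sqrrD !sqrtCK.
rewrite linearDl/= !linearDr/= (dotC v u).
rewrite (_ : _ + _ = form u u + (form u v + (form u v)^*) + form v v); last first.
  by rewrite !addrA.
rewrite lerD2r lerD2l.
have -> : form u v + (form u v)^* = 'Re (form u v) *+ 2.
  by rewrite ReE -mulr_natr divfK// pnatr_eq0.
rewrite lerMn2r/=; apply: le_trans (dot_CauchySchwarz u v).
by case: (leif_Re_Creal (form u v)).
Qed.

End dot_norm.

(* [None] encodes the value oo. *)
Definition in_J (k : option nat) : pred nat :=
  fun i => (0 < i)%N && (if k is Some m then (i <= m)%N else true).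

Definition J (eta : option nat) : Type := {i : nat | in_J eta i}.
HB.instance Definition _ eta := Countable.on (J eta).

(* [circuit r] is x_r and [branch i j] is x_{i,j+1}. *)
Inductive digraph (eta : option nat) (kappa : nat) : Type :=
| circuit of 'I_kappa.+1
| branch of J eta & nat.
Arguments circuit {eta kappa}.
Arguments branch {eta kappa}.

Section digraph_instances.
Context (eta : option nat) (kappa : nat).
Local Notation X := (digraph eta kappa).

Let code (x : X) : 'I_kappa.+1 + J eta * nat :=
  match x with circuit r => inl r | branch i j => inr (i, j) end.
Let decode (x : 'I_kappa.+1 + J eta * nat) : X :=
  match x with inl r => circuit r | inr (i, j) => branch i j end.
Let codeK : cancel code decode. Proof. by case. Qed.

HB.instance Definition _ := Countable.copy X (can_type codeK).
HB.instance Definition _ := isPointed.Build X (circuit ord0).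
HB.instance Definition _ := @isMeasurable.Build default_measure_display X
  discrete_measurable discrete_measurable0
  discrete_measurableC discrete_measurableU.

End digraph_instances.

Definition phi (eta : option nat) (kappa : nat) (x : digraph eta kappa) :
    digraph eta kappa :=
  match x with
  | branch i j.+1 => branch i j
  | branch i 0 => circuit ord_max
  | circuit r => if val r is r'.+1 then circuit (inord r') else circuit ord_max
  end.

Record discrete_measure (R : realType) (eta : option nat) (kappa : nat) :=
  DiscreteMeasure {
    dmeas :> {measure set (digraph eta kappa) -> \bar R};
    dmeas_sigma_finite : sigma_finite [set: digraph eta kappa] dmeas;
    dmeas_gt0 : forall x, (0 < dmeas [set x])%E }.

Section L2.
Context (R : realType) (eta : option nat) (kappa : nat).
Local Notation X := (digraph eta kappa).
Local Notation normc := Normc.normc.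

Lemma measurable_discrete (A : set X) : measurable A.
Proof. by []. Qed.

Lemma measurable_fun_discrete d (Y : sigmaRingType d) (D : set X) (f : X -> Y) :
  measurable_fun D f.
Proof. by move=> ? ? ?; exact: measurable_discrete. Qed.
#[local] Hint Resolve measurable_discrete measurable_fun_discrete : core.

Variable mu : discrete_measure R eta kappa.

Definition sqint : {pred (X -> R[i])} :=
  [pred f : X -> R[i] | (\int[mu]_x ((normc (f x)) ^+ 2)%:E < +oo)%E].

Lemma normcE2 (z : R[i]) : normc z ^+ 2 = complex.Re z ^+ 2 + complex.Im z ^+ 2.
Proof. by case: z => a b /=; rewrite sqr_sqrtr// addr_ge0 ?sqr_ge0. Qed.

Lemma normc_addsq (u v : R[i]) :
  normc (u + v) ^+ 2 <= 2 * normc u ^+ 2 + 2 * normc v ^+ 2.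
Proof.
rewrite !normcE2; case: u v => [a b] [c d] /=; rewrite -subr_ge0.
rewrite (_ : _ - _ = (a - c) ^+ 2 + (b - d) ^+ 2); last by ring.
by rewrite addr_ge0 ?sqr_ge0.
Qed.

Lemma dominated (f : X -> R) (g : X -> R) : (forall x, `|f x| <= g x) ->
  (\int[mu]_x (g x)%:E < +oo)%E -> mu.-integrable [set: X] (EFin \o f).
Proof.
move=> fg goo; apply/integrableP; split => //.
apply: le_lt_trans goo; apply: ge0_le_integral => //= x _; rewrite ?lee_fin//.
Qed.

Lemma integral_add_lty (f g : X -> R) :
  (forall x, 0 <= f x) -> (forall x, 0 <= g x) ->
  (\int[mu]_x (f x)%:E < +oo)%E -> (\int[mu]_x (g x)%:E < +oo)%E ->
  (\int[mu]_x (f x + g x)%:E < +oo)%E.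
Proof.
move=> f0 g0 foo goo.
under eq_integral do rewrite EFinD.
rewrite ge0_integralD//.
- exact: lte_add_pinfty.
- by move=> x _; rewrite lee_fin.
- by move=> x _; rewrite lee_fin.
Qed.

Lemma integral_scale_lty (k : R) (f : X -> R) : 0 <= k ->
  (forall x, 0 <= f x) ->
  (\int[mu]_x (f x)%:E < +oo)%E -> (\int[mu]_x (k * f x)%:E < +oo)%E.
Proof.
move=> k0 f0 foo; under eq_integral do rewrite EFinM.
rewrite ge0_integralZl_EFin//.
- exact: lte_mul_pinfty.
- by move=> x _; rewrite lee_fin.
Qed.

Lemma sqint_le (f : X -> R[i]) (g : X -> R) :
  (forall x, normc (f x) ^+ 2 <= g x) ->
  (\int[mu]_x (g x)%:E < +oo)%E -> f \in sqint.
Proof.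
move=> fg; apply: le_lt_trans; apply: ge0_le_integral => //= x _.
- by rewrite lee_fin sqr_ge0.
- by rewrite lee_fin.
Qed.

Lemma sqint_submod_closed : submod_closed sqint.
Proof.
split.
  rewrite inE /=; under eq_integral do rewrite /= expr0n/= addr0 sqrtr0 expr0n/=.
  by rewrite integral0 ltry.
move=> a f g fI gI.
apply: (@sqint_le _ (fun x => (2 * normc a ^+ 2) * normc (f x) ^+ 2
                              + 2 * normc (g x) ^+ 2)) => [x|].
- by rewrite -mulrA -exprMn -Normc.normcM; exact: normc_addsq.
- apply: integral_add_lty => [x|x||].
  + by apply: mulr_ge0; [apply: mulr_ge0|]; rewrite ?sqr_ge0.
  + by apply: mulr_ge0; rewrite ?sqr_ge0.
  + apply: (@integral_scale_lty (2 * normc a ^+ 2) (fun x => normc (f x) ^+ 2)).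
    * by apply: mulr_ge0; rewrite ?sqr_ge0.
    * by move=> x; rewrite sqr_ge0.
    * exact: fI.
  + apply: (@integral_scale_lty 2 (fun x => normc (g x) ^+ 2)).
    * by [].
    * by move=> x; rewrite sqr_ge0.
    * exact: gI.
Qed.
HB.instance Definition _ := GRing.isSubmodClosed.Build _ _ sqint sqint_submod_closed.

(* As [mu] charges every point, almost everywhere equality is equality and no
   quotient is needed. *)
Record L2 := MkL2 { L2fun :> X -> R[i]; L2_sqint : L2fun \in sqint }.

HB.instance Definition _ := [isSub for L2fun].
HB.instance Definition _ := [Choice of L2 by <:].
HB.instance Definition _ := [SubChoice_isSubLmodule of L2 by <:].


Definition L2_inner (f g : L2) : R[i] :=
  (\int[mu]_x complex.Re (f x * (g x)^*)) +i*
  (\int[mu]_x complex.Im (f x * (g x)^*)).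

Definition L2_sqnorm (f : L2) : R := \int[mu]_x (normc (f x) ^+ 2).

Lemma L2_fin (f : L2) : (\int[mu]_x ((normc (f x)) ^+ 2)%:E < +oo)%E.
Proof. exact: (L2_sqint f). Qed.

Lemma ReIm_mul_conj_le (u v : R[i]) :
  `|complex.Re (u * v^*)| <= normc u ^+ 2 + normc v ^+ 2 /\
  `|complex.Im (u * v^*)| <= normc u ^+ 2 + normc v ^+ 2.
Proof.
rewrite !normcE2; case: u v => [a b] [c d] /=.
have sq x y : `|x| <= y <-> - y <= x /\ x <= y :> R.
  by rewrite ler_norml; split=> [/andP|[-> ->]].
split; apply/sq; split; rewrite -subr_ge0.
- rewrite (_ : _ - _ = 2^-1 * ((a + c) ^+ 2 + (b + d) ^+ 2
     + (a ^+ 2 + b ^+ 2 + c ^+ 2 + d ^+ 2))); last by field.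
  by rewrite mulr_ge0// !addr_ge0 ?sqr_ge0.
- rewrite (_ : _ - _ = 2^-1 * ((a - c) ^+ 2 + (b - d) ^+ 2
     + (a ^+ 2 + b ^+ 2 + c ^+ 2 + d ^+ 2))); last by field.
  by rewrite mulr_ge0// !addr_ge0 ?sqr_ge0.
- rewrite (_ : _ - _ = 2^-1 * ((a - d) ^+ 2 + (b + c) ^+ 2
     + (a ^+ 2 + b ^+ 2 + c ^+ 2 + d ^+ 2))); last by field.
  by rewrite mulr_ge0// !addr_ge0 ?sqr_ge0.
- rewrite (_ : _ - _ = 2^-1 * ((a + d) ^+ 2 + (b - c) ^+ 2
     + (a ^+ 2 + b ^+ 2 + c ^+ 2 + d ^+ 2))); last by field.
  by rewrite mulr_ge0// !addr_ge0 ?sqr_ge0.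
Qed.

Lemma L2_integrable_Re (f g : L2) :
  mu.-integrable [set: X] (EFin \o (fun x => complex.Re (f x * (g x)^*))).
Proof.
apply: (@dominated _ (fun x => normc (f x) ^+ 2 + normc (g x) ^+ 2)) => [x|].
  by case: (ReIm_mul_conj_le (f x) (g x)).
by apply: integral_add_lty => [x|x||]; rewrite ?sqr_ge0//; exact: L2_fin.
Qed.

Lemma L2_integrable_Im (f g : L2) :
  mu.-integrable [set: X] (EFin \o (fun x => complex.Im (f x * (g x)^*))).
Proof.
apply: (@dominated _ (fun x => normc (f x) ^+ 2 + normc (g x) ^+ 2)) => [x|].
  by case: (ReIm_mul_conj_le (f x) (g x)).
by apply: integral_add_lty => [x|x||]; rewrite ?sqr_ge0//; exact: L2_fin.
Qed.

Lemma L2_inner_hermitian f g : L2_inner f g = (L2_inner g f)^*.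
Proof.
rewrite /L2_inner /=; congr (_ +i* _).
  by apply: eq_Rintegral => x _; case: (f x) (g x) => [a b] [c d] /=; ring.
rewrite -mulN1r -RintegralZl//; last exact: L2_integrable_Im.
by apply: eq_Rintegral => x _; case: (f x) (g x) => [a b] [c d] /=; ring.
Qed.

Lemma L2_inner_linear g : linear_for *%R (L2_inner^~ g).
Proof.
move=> a f h; rewrite /L2_inner.
have Rf := L2_integrable_Re f g; have If := L2_integrable_Im f g.
have Rh := L2_integrable_Re h g; have Ih := L2_integrable_Im h g.
have int_lin (p q : R) (u v w : X -> R) :
    mu.-integrable [set: X] (EFin \o u) -> mu.-integrable [set: X] (EFin \o v) ->
    mu.-integrable [set: X] (EFin \o w) ->
    \int[mu]_x (p * u x + q * v x + w x) =
    p * \int[mu]_x u x + q * \int[mu]_x v x + \int[mu]_x w x.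
  move=> iu iv iw.
  have Z r (k : X -> R) : mu.-integrable [set: X] (EFin \o k) ->
      mu.-integrable [set: X] (EFin \o (fun x => r * k x)).
    by move=> ik; exact: (@integrableZl _ _ _ mu _ measurableT r _ ik).
  have ZZ : mu.-integrable [set: X] (EFin \o (fun x => p * u x + q * v x)).
    exact: (integrableD measurableT (Z p _ iu) (Z q _ iv)).
  by rewrite RintegralD// RintegralD ?Z// !RintegralZl.
case: a => p q.
transitivity ((p * \int[mu]_x complex.Re (f x * (g x)^*)
  + (- q) * \int[mu]_x complex.Im (f x * (g x)^*)
  + \int[mu]_x complex.Re (h x * (g x)^*)) +i*
  (q * \int[mu]_x complex.Re (f x * (g x)^*)
  + p * \int[mu]_x complex.Im (f x * (g x)^*)
  + \int[mu]_x complex.Im (h x * (g x)^*))).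
  congr (_ +i* _); rewrite -int_lin//; apply: eq_Rintegral => x _.
    rewrite (_ : ((p +i* q) *: f + h) x = (p +i* q) * f x + h x)//.
    by case: (f x) (h x) (g x) => [a b] [c d] [e k] /=; ring.
  rewrite (_ : ((p +i* q) *: f + h) x = (p +i* q) * f x + h x)//.
  by case: (f x) (h x) (g x) => [a b] [c d] [e k] /=; ring.
by rewrite mulNr [in RHS]/GRing.add/= [q * _ + _]addrC.
Qed.

Lemma L2_inner_linearr f :
  linear_for (Num.conj \; *%R) (L2_inner f).
Proof.
move=> a g h; rewrite L2_inner_hermitian L2_inner_linear.
by rewrite rmorphD rmorphM/= -!L2_inner_hermitian.
Qed.

HB.instance Definition _ := bilinear_isBilinear.Build R[i] L2 L2 R[i]
  *%R (Num.conj \; *%R) L2_inner (L2_inner_linear, L2_inner_linearr).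

Lemma L2_inner_sym f g : L2_inner f g = (-1) ^+ false * Num.conj (L2_inner g f).
Proof. by rewrite expr0 mul1r; exact: L2_inner_hermitian. Qed.

HB.instance Definition _ := @isHermitianSesquilinear.Build R[i] L2 false Num.conj
  L2_inner L2_inner_sym.

Lemma L2_integrable_sq (f : L2) :
  mu.-integrable [set: X] (EFin \o (fun x => normc (f x) ^+ 2)).
Proof.
apply: (@dominated _ (fun x => normc (f x) ^+ 2)); last exact: L2_fin.
by move=> x; rewrite ger0_norm; [exact: lexx|exact: sqr_ge0].
Qed.

Lemma L2_sqnormE (f : L2) :
  (\int[mu]_x (normc (f x) ^+ 2)%:E = (L2_sqnorm f)%:E)%E.
Proof.
rewrite /L2_sqnorm /Rintegral fineK//.
exact: (integrable_fin_num measurableT (L2_integrable_sq f)).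
Qed.

Lemma L2_sqnorm_ge0 f : 0 <= L2_sqnorm f.
Proof. by apply: Rintegral_ge0 => x _; exact: sqr_ge0. Qed.

Lemma L2_inner_sqnorm f : L2_inner f f = (L2_sqnorm f)%:C.
Proof.
rewrite /L2_inner /L2_sqnorm; congr (_ +i* _).
  by apply: eq_Rintegral => x _; rewrite normcE2; case: (f x) => a b /=; ring.
transitivity (\int[mu]_x (0 * normc (f x) ^+ 2)).
  by apply: eq_Rintegral => x _; case: (f x) => a b /=; ring.
by rewrite RintegralZl ?mul0r//; exact: L2_integrable_sq.
Qed.

Lemma dmeas_fin_num x : mu [set x] \is a fin_num.
Proof.
have [F UF muF] := dmeas_sigma_finite mu.
have : [set: X] x by []. rewrite UF => -[i _ Fix].
rewrite ge0_fin_numE//; apply: le_lt_trans (muF i).2.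
by apply: le_measure; rewrite ?inE// => _ ->.
Qed.

Lemma L2_point_le (f : L2) x :
  normc (f x) ^+ 2 * fine (mu [set x]) <= L2_sqnorm f.
Proof.
rewrite -lee_fin -L2_sqnormE EFinM.
apply: (@le_trans _ _ (\int[mu]_(y in [set x]) (normc (f y) ^+ 2)%:E)%E).
  rewrite (eq_integral (cst (normc (f x) ^+ 2)%:E)); last first.
    by move=> y; rewrite inE => ->.
  by rewrite integral_cst// fineK// dmeas_fin_num.
by apply: ge0_subset_integral => // y _; rewrite lee_fin sqr_ge0.
Qed.

Lemma L2_inner_gt0 f : f != 0 -> 0 < L2_inner f f.
Proof.
move=> f0; rewrite L2_inner_sqnorm ltcR lt_neqAle L2_sqnorm_ge0 andbT.
apply: contra f0 => /eqP s0; apply/eqP/val_inj/funext => x.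
have := L2_point_le f x; rewrite -s0 => le0.
have mux : 0 < fine (mu [set x]).
  by apply: fine_gt0; rewrite dmeas_gt0 ltey_eq dmeas_fin_num.
apply: Normc.eq0_normc; apply/eqP; rewrite -sqrf_eq0 eq_le; apply/andP; split.
  by rewrite -(pmulr_lle0 _ mux).
exact: sqr_ge0.
Qed.

HB.instance Definition _ := @isDotProduct.Build R[i] L2 L2_inner L2_inner_gt0.

Definition L2_norm (f : L2) : R[i] := sqrtC (L2_inner f f).

Lemma L2_normD f g : L2_norm (f + g) <= L2_norm f + L2_norm g.
Proof. exact: (dot_normD L2_inner). Qed.

Lemma L2_normZ a f : L2_norm (a *: f) = `|a| * L2_norm f.
Proof.
by rewrite /L2_norm (dotZ L2_inner) sqrtCM ?nnegrE ?exprn_ge0 ?(dot_ge0 L2_inner)//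
  sqrCK.
Qed.

Lemma L2_norm_eq0 f : L2_norm f = 0 -> f = 0.
Proof.
move/eqP; rewrite /L2_norm sqrtC_eq0 => ff0; apply/eqP.
by apply: contraTT ff0 => /L2_inner_gt0; rewrite lt0r => /andP[].
Qed.

HB.instance Definition _ := @Lmodule_isNormed.Build R[i] L2
  L2_norm L2_normD L2_normZ L2_norm_eq0.

Lemma L2_normE (f : L2) : `|f| = (Num.sqrt (L2_sqnorm f))%:C.
Proof.
rewrite (_ : `|f| = L2_norm f)// /L2_norm L2_inner_sqnorm.
rewrite -[in LHS](sqr_sqrtr (L2_sqnorm_ge0 f)) rmorphXn/= sqrCK//.
by rewrite lecR sqrtr_ge0.
Qed.

Lemma L2_norm_le (f : L2) (e : R) : 0 <= e ->
  (`|f| <= e%:C) = (L2_sqnorm f <= e ^+ 2).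
Proof.
move=> e0; rewrite L2_normE lecR -ler_sqr ?nnegrE ?sqrtr_ge0//.
by rewrite sqr_sqrtr// L2_sqnorm_ge0.
Qed.

Lemma L2_point_sub (x : X) : exists2 c : R, 0 <= c &
  forall (f g : L2) (e : R), 0 <= e -> `|f - g| <= e%:C ->
  normc (f x - g x) <= c * e.
Proof.
have mux : 0 < fine (mu [set x]).
  by apply: fine_gt0; rewrite dmeas_gt0 ltey_eq dmeas_fin_num.
exists (Num.sqrt (fine (mu [set x]))^-1); first exact: sqrtr_ge0.
move=> f g e e0; rewrite L2_norm_le// => fge.
rewrite -ler_sqr ?nnegrE ?mulr_ge0 ?sqrtr_ge0//; last first.
  by case: (f x - g x) => a b; exact: sqrtr_ge0.
rewrite exprMn sqr_sqrtr ?invr_ge0 ?(ltW mux)// ler_pdivlMl// mulrC.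
exact: le_trans (L2_point_le (f - g) x) fge.
Qed.


Lemma L2_complete (F : set_system L2) : ProperFilter F -> cauchy F -> cvg F.
Proof.
move=> FF /cauchyP Fc.
pose eps (n : nat) : R := n.+1%:R^-1.
have eps0 n : 0 < eps n by rewrite invr_gt0.
have epsm n m : (n <= m)%N -> eps m <= eps n.
  by move=> nm; rewrite lef_pV2 ?posrE// ler_nat.
have /choice[u Fu] n : exists f : L2, F (ball f (eps n)%:C).
  by apply: Fc; rewrite ltcR.
have uB n m : `|u n - u m| <= (eps n + eps m)%:C.
  have [f [/= unf umf]] := filter_ex (filterI (Fu n) (Fu m)).
  rewrite rmorphD/= (le_trans (ler_distD f _ _))// lerD//.
    by move: unf; rewrite -ball_normE/= => /ltW.
  by rewrite distrC; move: umf; rewrite -ball_normE/= => /ltW.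
have cvg_eps : eps @ \oo --> (0 : R) by exact: cvg_harmonic.
have cvg_seq (a : nat -> R) (c : R) : 0 <= c ->
    (forall n m, `|a n - a m| <= c * (eps n + eps m)) -> cvgn a.
  move=> c0 ac; apply: cauchy_cvg; apply/cauchyP => e e0.
  have : \forall n \near \oo, c * (eps n + eps n) < e.
    have : (fun n => c * (eps n + eps n)) @ \oo --> c * (0 + 0).
      by apply: cvgMl_tmp; exact: cvgD.
    by rewrite addr0 mulr0 => /cvgr_lt; exact.
  move=> [N _ NP]; exists (a N); exists N => // m /= Nm.
  rewrite -ball_normE/=; apply: le_lt_trans (ac N m) _.
  apply: le_lt_trans (NP N (leqnn N)).
  by rewrite ler_wpM2l// lerD2l epsm.
have cvg_sq (a : nat -> R) (l : R) : a @ \oo --> l ->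
    (fun n => a n ^+ 2) @ \oo --> l ^+ 2.
  move=> al; rewrite (_ : (fun n => _) = a \* a) ?expr2; first exact: cvgM.
  by apply/funext => n; rewrite expr2.
have le_Re (z : R[i]) : `|complex.Re z| <= normc z.
  rewrite -ler_sqr ?nnegrE//; last by case: z => a b; exact: sqrtr_ge0.
  by rewrite normcE2 real_normK ?num_real// lerDl sqr_ge0.
have le_Im (z : R[i]) : `|complex.Im z| <= normc z.
  rewrite -ler_sqr ?nnegrE//; last by case: z => a b; exact: sqrtr_ge0.
  by rewrite normcE2 real_normK ?num_real// lerDr sqr_ge0.
have cvgRe x : cvgn (fun n => complex.Re (u n x)).
  have [c c0 cP] := L2_point_sub x; apply: (cvg_seq _ c c0) => n m.
  apply: le_trans (cP _ _ _ _ (uB n m)); last by rewrite addr_ge0// ltW.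
  by apply: le_trans (le_Re _); rewrite raddfB.
have cvgIm x : cvgn (fun n => complex.Im (u n x)).
  have [c c0 cP] := L2_point_sub x; apply: (cvg_seq _ c c0) => n m.
  apply: le_trans (cP _ _ _ _ (uB n m)); last by rewrite addr_ge0// ltW.
  by apply: le_trans (le_Im _); rewrite raddfB.
pose g x : R[i] := limn (fun n => complex.Re (u n x)) +i*
                   limn (fun n => complex.Im (u n x)).
have gB n : (\int[mu]_x (normc (u n x - g x) ^+ 2)%:E <=
             ((2 * eps n) ^+ 2)%:E)%E.
  pose h m x := (normc (u n x - u (m + n)%N x) ^+ 2)%:E.
  have hcvg x : h ^~ x @ \oo --> (normc (u n x - g x) ^+ 2)%:E.
    apply: cvg_EFin; first by near=> m.
    rewrite (_ : _ \o _ = fun m =>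
       (complex.Re (u n x) - complex.Re (u (m + n)%N x)) ^+ 2 +
       (complex.Im (u n x) - complex.Im (u (m + n)%N x)) ^+ 2); last first.
      by apply/funext => m /=; rewrite normcE2 !raddfB.
    rewrite normcE2 !raddfB /=; apply: cvgD.
      apply: cvg_sq; apply: cvgB; first exact: cvg_cst.
      by rewrite (cvg_shiftn n (fun m => complex.Re (u m x))); exact: cvgRe.
    apply: cvg_sq; apply: cvgB; first exact: cvg_cst.
    by rewrite (cvg_shiftn n (fun m => complex.Im (u m x))); exact: cvgIm.
  rewrite [leLHS](_ : _ = \int[mu]_x limn_einf (h ^~ x))%E; last first.
    apply: eq_integral => x _; rewrite is_cvg_limn_einfE; last first.
      by apply/cvg_ex; eexists; exact: hcvg.
    by apply/esym/cvg_lim => //; exact: hcvg.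
  apply: le_trans (fatou _ _ _ _) _ => //.
    by move=> m x _; rewrite lee_fin sqr_ge0.
  rewrite limn_einf_lim; apply: lime_le; first exact: is_cvg_einfs.
  near=> m; apply: (@le_trans _ _ (\int[mu]_x h m x)%E).
    by apply: ereal_inf_lbound; exists m => //=.
  rewrite (L2_sqnormE (u n - u (m + n)%N)) lee_fin -L2_norm_le//.
    apply: le_trans (uB _ _) _.
    by rewrite lecR mulr_natl mulr2n lerD2l epsm// leq_addl.
  by rewrite mulr_ge0// ltW.
have dI n : (fun x => u n x - g x) \in sqint.
  by apply: le_lt_trans (gB n) _; rewrite ltry.
pose G : L2 := u 0%N - MkL2 (dI 0%N).
have GE x : G x = g x
  by rewrite (_ : G x = u 0%N x - (u 0%N x - g x))// opprB addrC subrK.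
have uG n : `|u n - G| <= (2 * eps n)%:C.
  rewrite L2_norm_le ?mulr_ge0 ?(ltW (eps0 n))// -lee_fin -L2_sqnormE.
  apply: le_trans (gB n); rewrite le_eqVlt; apply/orP; left; apply/eqP.
  by apply: eq_integral => x _; rewrite -GE.
apply/cvg_ex; exists G; apply/cvgrPdist_lt => e.
case: e => e e'; rewrite ltcE/= => /andP[/eqP -> e0].
have : \forall n \near \oo, 3 * eps n < e.
  have : (fun n => 3 * eps n) @ \oo --> (3 * 0 : R) by exact: cvgMl_tmp.
  by rewrite mulr0 => /cvgr_lt; exact.
move=> [N _ /(_ N (leqnn N)) /= NP].
near=> f; apply: le_lt_trans (ler_distD (u N) _ _) _.
apply: (@lt_le_trans _ _ ((2 * eps N)%:C + (eps N)%:C)); last first.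
  by rewrite -rmorphD/= lecR; apply: le_trans (ltW NP); lra.
rewrite ler_ltD//; first by rewrite distrC.
by near: f; have := Fu N; rewrite -ball_normE.
Unshelve. all: by end_near. Qed.

HB.instance Definition _ := Uniform_isComplete.Build L2 L2_complete.

Lemma L2_norm_inner (f : L2) : `|f| = sqrtC (L2_inner f f).
Proof. by []. Qed.

HB.instance Definition _ := @isHilbert.Build R L2 L2_inner L2_norm_inner.

(* The graph of C_phi; [comp_op_dom] identifies its domain. *)
Definition comp_op : set (L2 * L2) :=
  [set p : L2 * L2 | forall x, p.2 x = p.1 (phi x)].

Lemma comp_op_dom (f : L2) : op_dom comp_op f <-> (f \o @phi eta kappa) \in sqint.
Proof.
split=> [[g /= fg]|fI].
  by rewrite (_ : f \o _ = g) ?L2_sqint//; apply/funext => x /=; rewrite -fg.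
by exists (MkL2 fI).
Qed.

Lemma comp_op_is_operator : is_operator comp_op.
Proof.
split=> [x //|a [f g] [f' g'] /= fg fg' x|f g g' /= fg fg'].
  rewrite (_ : (a *: g + g') x = a * g x + g' x)//.
  by rewrite fg fg'.
by apply/val_inj/funext => x; rewrite /= fg fg'.
Qed.

(* [hphi n x] takes its values in [0, +oo], hence the extended reals. *)
Definition hphi (n : nat) (x : X) : \bar R :=
  (mu (iter n (@phi eta kappa) @^-1` [set x]) / mu [set x])%E.

End L2.
Arguments comp_op {R eta kappa} mu p.

(* Sequences are extended-real-valued so that the definitions apply to [hphi];
   having an S-representing measure forces all the terms to be finite.  A Borel
   measure on [0, +oo[ is encoded as a Borel measure on the line that vanishes
   on ]-oo, 0[. *)
Section moments.
Context (R : realType).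
Local Notation borel_measure := {measure set (measurableTypeR R) -> \bar R}.
Local Open Scope ereal_scope.

Definition S_representing (g : nat -> \bar R) (nu : borel_measure) : Prop :=
  nu `]-oo, (0 : R)%R[%classic = 0 /\
  forall n, g n \is a fin_num /\ g n = \int[nu]_(t in `[(0 : R)%R, +oo[%classic) ((t : R) ^+ n)%:E.

Definition stieltjes (g : nat -> \bar R) : Prop := exists nu, S_representing g nu.

Definition S_determinate (g : nat -> \bar R) : Prop :=
  stieltjes g /\
  forall nu nu', S_representing g nu -> S_representing g nu' ->
    forall A : set (measurableTypeR R), measurable A -> nu A = nu' A.

(* For sequences in [0, +oo[; note that [0^-1 = +oo] in the extended reals. *)
Definition carleman (g : nat -> \bar R) : Prop :=
  \sum_(1 <= n <oo) (g n `^ ((2 * n)%N%:R)^-1)^-1 = +oo.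

End moments.

(* Main.v *)
From HB Require Import structures.
Require Import Defs.
From mathcomp Require Import all_boot all_order all_algebra.
From mathcomp Require Import sesquilinear complex ring_quotient generic_quotient.
From mathcomp Require Import all_classical all_reals all_analysis.
From mathcomp Require Import measurable_realfun ring lra zify.

(** Let [P] represent the sequence [hphi mu n x0], let [Q i] represent the
    sequence [hphi mu n (branch i 0)], and put
    [nu = \sum_i (mu x_{i,1} / mu x_0) Q i].  A point lies in the preimage of
    [x0] under the iterate of order [n + kappa + 1] exactly when it lies in the
    one of order [n] or is a point [branch i n] ([hphi_loop]); hence [nu]
    represents the sequence of differences ([branch_represents]).  So the
    measures [t ^ (kappa + 1) P] and [P + nu] have the same moments.  Call [P]
    and [Q] balanced when these two measures are equal.  The proof has two
    halves: balanced measures give a normal extension, and each of the four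
    hypotheses provides balanced measures.

    Normal extension ([subnormal_of_balanced]).  The branches all run into the
    circuit, so the map is not injective; undo this by letting each branch wind
    for ever around a copy of the circuit of its own.  On this unrolled graph the
    map becomes a bijection.  Attach to each vertex of the
    line through branch [i] a half line with the measure [mu x_{i,1} Q i], and
    consider composition with the bijection followed by multiplication by the
    square root of the half line coordinate [t].  That coordinate is constant
    along the motion, so the operator and its adjoint commute ([wcomp_normal]).
    A function [f] on the graph is lifted to [f] times a power of [sqrt t]; the
    powers are chosen so that the lift intertwines the two operators, and it is
    isometric because the masses of all windings over a circuit point add up to
    the mass of that point.  This is the balance equation
    divided by [t ^ (kappa + 1)] and iterated infinitely often
    ([circuit_mass]); what remains of [P] in the limit is its mass at [1], on
    which the operator just rotates the circuit.

    Carleman conditions.  Both measures in the balance equation are determined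
    by their moments of the powers of [t ^ (kappa + 1)] ([half_line_uniqueness]).
    The difference of their cosine transforms, in the variable
    [t ^ ((kappa + 1) / 2)], is a smooth function whose derivatives at [0] are
    differences of moments, so they vanish; under a Carleman condition Bang's
    argument ([bang]) makes the difference itself vanish, and the cosine
    transform determines the measure.

    Determinate sequences.  If [P] has no mass below [1], the measure
    [(t ^ (kappa + 1) - 1) P] is positive and represents the differences, so it
    equals [nu] ([balanced_of_no_mass_below_one]).  If instead the sequence
    along the multiples of [kappa + 1] is determinate, then [P] cannot have mass
    below [1] ([no_mass_of_determinate]): the functional that integrates
    [q (t ^ (kappa + 1))] against [P] is nonnegative on polynomials nonnegative
    on [1, +oo[, because such a polynomial is [A + ('X - 1) * B] with [A] and
    [B] nonnegative on [0, +oo[, and ['X - 1] turns [P] into [nu].  By the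
    M. Riesz extension theorem it is represented by a measure on [1, +oo[, which
    by determinacy is the image of [P]. *)

Set Implicit Arguments.
Unset Strict Implicit.
Unset Printing Implicit Defensive.

Import Order.TTheory GRing.Theory Num.Theory.
Import numFieldNormedType.Exports.

Local Open Scope classical_set_scope.
Local Open Scope complex_scope.
Local Open Scope ring_scope.

(** * Square integrable complex functions *)

Section square_integrable.
Context d (T : measurableType d) (R : realType).
Variable m : {measure set T -> \bar R}.
Local Notation normc := Normc.normc.
Implicit Types f g : T -> R[i].

Definition cmeasurable f :=
  measurable_fun [set: T] (fun x => complex.Re (f x)) /\
  measurable_fun [set: T] (fun x => complex.Im (f x)).

Lemma measurable_normc2 f : cmeasurable f ->
  measurable_fun [set: T] (fun x => normc (f x) ^+ 2).
Proof.
move=> [mr mi]; under eq_fun do rewrite normcE2.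
by apply: measurable_funD; apply: measurable_funX.
Qed.

Lemma cmeasurableM f g : cmeasurable f -> cmeasurable g ->
  cmeasurable (fun x => f x * g x).
Proof.
move=> [fr fi] [gr gi]; split.
  rewrite (_ : (fun x => _) = fun x => complex.Re (f x) * complex.Re (g x)
     - complex.Im (f x) * complex.Im (g x)).
    by apply: measurable_funB; apply: measurable_funM.
  by apply/funext => x; case: (f x) (g x) => [a b] [c e].
rewrite (_ : (fun x => _) = fun x => complex.Re (f x) * complex.Im (g x)
     + complex.Im (f x) * complex.Re (g x)).
  by apply: measurable_funD; apply: measurable_funM.
by apply/funext => x; case: (f x) (g x) => [a b] [c e].
Qed.

Lemma cmeasurableD f g : cmeasurable f -> cmeasurable g ->
  cmeasurable (fun x => f x + g x).
Proof.
move=> [fr fi] [gr gi]; split.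
  under eq_fun do rewrite raddfD.
  exact: measurable_funD.
under eq_fun do rewrite raddfD.
exact: measurable_funD.
Qed.

Lemma cmeasurable_cst (c : R[i]) : cmeasurable (fun=> c).
Proof. by split; exact: measurable_cst. Qed.

Lemma cmeasurable_real (w : T -> R) : measurable_fun setT w ->
  cmeasurable (fun x => (w x)%:C).
Proof. by move=> mw; split. Qed.

Lemma cmeasurable_conj f : cmeasurable f -> cmeasurable (fun x => (f x)^*).
Proof.
move=> [fr fi]; split.
  rewrite (_ : (fun x => _) = fun x => complex.Re (f x)) //.
  by apply/funext => x; case: (f x).
rewrite (_ : (fun x => _) = fun x => - complex.Im (f x)).
  exact: (measurableT_comp (@oppr_measurable R setT)).
by apply/funext => x; case: (f x).
Qed.

Definition sqintegrable f := cmeasurable f /\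
  (\int[m]_x ((normc (f x)) ^+ 2)%:E < +oo)%E.

Lemma sqintegrable_le f (g : T -> R) : cmeasurable f ->
  measurable_fun [set: T] g -> (forall x, normc (f x) ^+ 2 <= g x) ->
  (\int[m]_x (g x)%:E < +oo)%E -> sqintegrable f.
Proof.
move=> mf mg fg goo; split => //; apply: le_lt_trans goo.
apply: ge0_le_integral => //=.
- by move=> x _; rewrite lee_fin sqr_ge0.
- by apply/measurable_EFinP; exact: measurable_normc2.
- exact/measurable_EFinP.
- by move=> x _; rewrite lee_fin fg.
Qed.

Lemma integral_lincomb_lty (k l : R) (f g : T -> R) : 0 <= k -> 0 <= l ->
  measurable_fun setT f -> measurable_fun setT g ->
  (forall x, 0 <= f x) -> (forall x, 0 <= g x) ->
  (\int[m]_x (f x)%:E < +oo)%E -> (\int[m]_x (g x)%:E < +oo)%E ->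
  (\int[m]_x (k * f x + l * g x)%:E < +oo)%E.
Proof.
move=> k0 l0 mf mg f0 g0 foo goo.
under eq_integral do rewrite EFinD 2!EFinM.
rewrite ge0_integralD//=.
- rewrite !ge0_integralZl_EFin//=; try exact/measurable_EFinP.
  + by rewrite lte_add_pinfty// lte_mul_pinfty.
  + by move=> x _; rewrite lee_fin.
  + by move=> x _; rewrite lee_fin.
- by move=> x _; rewrite -EFinM lee_fin mulr_ge0.
- by apply/measurable_EFinP; exact: measurable_funM.
- by move=> x _; rewrite -EFinM lee_fin mulr_ge0.
- by apply/measurable_EFinP; exact: measurable_funM.
Qed.

Definition sqmem : {pred (T -> R[i])} := fun f => `[< sqintegrable f >].

Lemma sqmem_submod_closed : submod_closed sqmem.
Proof.
split.
  apply/asboolP; split; first exact: (cmeasurable_cst 0).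
  under eq_integral do rewrite /= expr0n/= addr0 sqrtr0 expr0n/=.
  by rewrite integral0 ltry.
move=> a f g /asboolP[mf fI] /asboolP[mg gI]; apply/asboolP.
have mn f' := @measurable_normc2 f'.
apply: (@sqintegrable_le _ (fun x => (2 * normc a ^+ 2) * normc (f x) ^+ 2
                              + 2 * normc (g x) ^+ 2)) => [||x|].
- apply: cmeasurableD => //; apply: (@cmeasurableM (fun=> a)) => //.
- by apply: measurable_funD; apply: measurable_funM => //; exact: mn.
- by rewrite -mulrA -exprMn -Normc.normcM; exact: normc_addsq.
- apply: integral_lincomb_lty => //.
  + by rewrite mulr_ge0 ?sqr_ge0.
  + exact: mn.
  + exact: mn.
  + by move=> x; exact: sqr_ge0.
  + by move=> x; exact: sqr_ge0.
Qed.
HB.instance Definition _ := GRing.isSubmodClosed.Build _ _ sqmem sqmem_submod_closed.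

(** The functions themselves form a vector space; the Hilbert space is its
    quotient by the null functions. *)
Record sqfun := SqFun { sqf :> T -> R[i]; sqfP : sqf \in sqmem }.

HB.instance Definition _ := [isSub for sqf].
HB.instance Definition _ := [Choice of sqfun by <:].
HB.instance Definition _ := [SubChoice_isSubLmodule of sqfun by <:].

Lemma sqf_sqintegrable (f : sqfun) : sqintegrable f.
Proof. exact/asboolP/sqfP. Qed.

Lemma sqfD (f g : sqfun) x : (f + g) x = f x + g x. Proof. by []. Qed.
Lemma sqfZ a (f : sqfun) x : (a *: f) x = a * f x. Proof. by []. Qed.
Lemma sqfB (f g : sqfun) x : (f - g) x = f x - g x. Proof. by []. Qed.

Definition mksq f (fI : sqintegrable f) : sqfun := SqFun (asboolT fI).

Definition sqnorm (f : T -> R[i]) : R := \int[m]_x (normc (f x) ^+ 2).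

(** The integral of [f * g^*], taken on real and imaginary parts. *)
Definition sqinner f g : R[i] :=
  (\int[m]_x complex.Re (f x * (g x)^*)) +i*
  (\int[m]_x complex.Im (f x * (g x)^*)).

Lemma sqintegrable_integrable f : sqintegrable f ->
  m.-integrable [set: T] (EFin \o (fun x => normc (f x) ^+ 2)).
Proof.
move=> [mf foo]; apply/integrableP; split.
  by apply/measurable_EFinP; exact: measurable_normc2.
by under eq_integral do rewrite /= ger0_norm ?sqr_ge0//.
Qed.

Lemma sqnormE f : sqintegrable f ->
  (\int[m]_x (normc (f x) ^+ 2)%:E = (sqnorm f)%:E)%E.
Proof.
move=> fI; rewrite /sqnorm /Rintegral fineK//.
exact: (integrable_fin_num measurableT (sqintegrable_integrable fI)).
Qed.

Lemma sqnorm_ge0 f : 0 <= sqnorm f.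
Proof. by apply: Rintegral_ge0 => x _; exact: sqr_ge0. Qed.

Lemma sqinner_integrable f g : sqintegrable f -> sqintegrable g ->
  m.-integrable [set: T] (EFin \o (fun x => complex.Re (f x * (g x)^*))) /\
  m.-integrable [set: T] (EFin \o (fun x => complex.Im (f x * (g x)^*))).
Proof.
move=> fI gI.
have [mr mi] : cmeasurable (fun x => f x * (g x)^*).
  by apply: cmeasurableM; [exact: fI.1 | apply: cmeasurable_conj; exact: gI.1].
have intS := integrableD measurableT (sqintegrable_integrable fI)
                                     (sqintegrable_integrable gI).
have nS x : `|normc (f x) ^+ 2 + normc (g x) ^+ 2| =
            normc (f x) ^+ 2 + normc (g x) ^+ 2.
  by rewrite ger0_norm// addr_ge0// sqr_ge0.
split; apply: (le_integrable measurableT _ _ intS) => /=.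
- exact/measurable_EFinP.
- by move=> x _; rewrite lee_fin nS; case: (ReIm_mul_conj_le (f x) (g x)).
- exact/measurable_EFinP.
- by move=> x _; rewrite lee_fin nS; case: (ReIm_mul_conj_le (f x) (g x)).
Qed.

Lemma sqinner_hermitian f g : sqintegrable f -> sqintegrable g ->
  sqinner f g = (sqinner g f)^*.
Proof.
move=> fI gI; rewrite /sqinner /=; congr (_ +i* _).
  by apply: eq_Rintegral => x _; case: (f x) (g x) => [a b] [c e] /=; ring.
rewrite -mulN1r -RintegralZl//; last exact: (sqinner_integrable gI fI).2.
by apply: eq_Rintegral => x _; case: (f x) (g x) => [a b] [c e] /=; ring.
Qed.

Lemma sqinner_linear (a : R[i]) f h g : sqintegrable f -> sqintegrable h ->
  sqintegrable g ->
  sqinner (fun x => a * f x + h x) g = a * sqinner f g + sqinner h g.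
Proof.
move=> fI hI gI; rewrite /sqinner.
have [Rf If] := sqinner_integrable fI gI; have [Rh Ih] := sqinner_integrable hI gI.
have int_lin (p q : R) (u v w : T -> R) :
    m.-integrable [set: T] (EFin \o u) -> m.-integrable [set: T] (EFin \o v) ->
    m.-integrable [set: T] (EFin \o w) ->
    \int[m]_x (p * u x + q * v x + w x) =
    p * \int[m]_x u x + q * \int[m]_x v x + \int[m]_x w x.
  move=> iu iv iw.
  have Z r (k : T -> R) : m.-integrable [set: T] (EFin \o k) ->
      m.-integrable [set: T] (EFin \o (fun x => r * k x)).
    by move=> ik; exact: (@integrableZl _ _ _ m _ measurableT r _ ik).
  have ZZ : m.-integrable [set: T] (EFin \o (fun x => p * u x + q * v x)).
    exact: (integrableD measurableT (Z p _ iu) (Z q _ iv)).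
  by rewrite RintegralD// RintegralD ?Z// !RintegralZl.
case: a => p q.
transitivity ((p * \int[m]_x complex.Re (f x * (g x)^*)
  + (- q) * \int[m]_x complex.Im (f x * (g x)^*)
  + \int[m]_x complex.Re (h x * (g x)^*)) +i*
  (q * \int[m]_x complex.Re (f x * (g x)^*)
  + p * \int[m]_x complex.Im (f x * (g x)^*)
  + \int[m]_x complex.Im (h x * (g x)^*))).
  congr (_ +i* _); rewrite -int_lin//; apply: eq_Rintegral => x _;
    by case: (f x) (h x) (g x) => [a b] [c e] [e' k] /=; ring.
by rewrite mulNr [in RHS]/GRing.add/= [q * _ + _]addrC.
Qed.

Lemma sqinner_sqnorm f : sqintegrable f -> sqinner f f = (sqnorm f)%:C.
Proof.
move=> fI; rewrite /sqinner /sqnorm; congr (_ +i* _).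
  by apply: eq_Rintegral => x _; rewrite normcE2; case: (f x) => a b /=; ring.
transitivity (\int[m]_x (0 * normc (f x) ^+ 2)).
  by apply: eq_Rintegral => x _; case: (f x) => a b /=; ring.
by rewrite RintegralZl ?mul0r//; exact: sqintegrable_integrable.
Qed.

(** Definiteness holds only up to a null set, which is why the quotient is
    needed. *)
Lemma sqnorm0_ae f : sqintegrable f -> sqnorm f = 0 -> {ae m, forall x, f x = 0}.
Proof.
move=> fI f0.
have mf : measurable_fun setT (fun x => (normc (f x) ^+ 2)%:E).
  by apply/measurable_EFinP; exact: measurable_normc2 fI.1.
have : (\int[m]_x `|(normc (f x) ^+ 2)%:E| = 0)%E.
  under eq_integral do rewrite /= ger0_norm ?sqr_ge0//.
  by rewrite sqnormE// f0.
move/(ae_eq_integral_abs m measurableT mf); apply: filterS => x /=.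
move=> /(_ I) /eqP; rewrite eqe sqrf_eq0 => /eqP; exact: Normc.eq0_normc.
Qed.

Lemma ae_sqinner0 f g : sqintegrable f -> sqintegrable g ->
  {ae m, forall x, f x = 0} -> sqinner f g = 0.
Proof.
move=> fI gI f0.
have [mr mi] : cmeasurable (fun x => f x * (g x)^*).
  by apply: cmeasurableM; [exact: fI.1 | apply: cmeasurable_conj; exact: gI.1].
have R0 (h : T -> R) : measurable_fun setT h -> {ae m, forall x, h x = 0} ->
    \int[m]_x h x = 0.
  move=> mh h0; rewrite /Rintegral (@ae_eq_integral _ _ _ m setT (cst 0%E))//.
  - by rewrite integral0.
  - exact/measurable_EFinP.
  - by apply: filterS h0 => x /= -> _.
by rewrite /sqinner; congr (_ +i* _); apply: R0 => //;
   apply: filterS f0 => x ->; rewrite mul0r.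
Qed.

Lemma sqintegrable_lincomb (a : R[i]) f g : sqintegrable f -> sqintegrable g ->
  sqintegrable (fun x => a * f x + g x).
Proof.
move=> fI gI; exact: (sqf_sqintegrable (a *: mksq fI + mksq gI)).
Qed.

End square_integrable.

(** * The quotient by almost everywhere equality *)

Section Lsq_space.
Local Open Scope quotient_scope.
Context d (T : measurableType d) (R : realType).
Variable m : {measure set T -> \bar R}.
Local Notation normc := Normc.normc.
Local Notation sqfun := (sqfun m).
Implicit Types f g h : sqfun.
Hint Resolve sqf_sqintegrable : core.

(** The quotient is taken for the additive group structure; scaling and the
    inner product are transported along representatives. *)
Definition sqnull : {pred sqfun} := fun f => `[< {ae m, forall x, f x = 0} >].

Lemma sqnull_zmod_closed : zmod_closed sqnull.
Proof.
split; first by apply/asboolP; exact: aeW.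
move=> f g /asboolP f0 /asboolP g0; apply/asboolP.
by apply: filterS2 f0 g0 => x fx gx; rewrite sqfB fx gx subrr.
Qed.
HB.instance Definition _ := GRing.isZmodClosed.Build _ sqnull sqnull_zmod_closed.

Definition Lsq := Quotient.quot sqnull.
HB.instance Definition _ := GRing.Zmodule.on Lsq.
HB.instance Definition _ := EqQuotient.on Lsq.

Implicit Types x y z : Lsq.

Definition cls (f : sqfun) : Lsq := \pi_Lsq f.

Lemma clsK x : cls (repr x) = x. Proof. exact: reprK. Qed.

Lemma Lsq_eqP f g : cls f = cls g <-> {ae m, forall t, f t = g t}.
Proof.
split=> [/eqP|fg].
  rewrite /cls -Quotient.idealrBE => /asboolP; apply: filterS => t.
  by rewrite sqfB => /eqP; rewrite subr_eq0 => /eqP.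
apply/eqP; rewrite /cls -Quotient.idealrBE; apply/asboolP; apply: filterS fg => t.
by rewrite sqfB => ->; rewrite subrr.
Qed.

Lemma repr_ae f : {ae m, forall t, repr (cls f) t = f t}.
Proof. by apply/Lsq_eqP; rewrite clsK. Qed.

Definition Lsq_scale (a : R[i]) x : Lsq := cls (a *: repr x).

Lemma Lsq_scale_pi a f : Lsq_scale a (cls f) = cls (a *: f).
Proof.
by apply/Lsq_eqP; apply: filterS (repr_ae f) => t; rewrite !sqfZ => ->.
Qed.

Lemma Lsq_pi_add f g : cls (f + g) = cls f + cls g.
Proof. exact: Quotient.pi_add. Qed.

Lemma Lsq_scaleA a b x : Lsq_scale a (Lsq_scale b x) = Lsq_scale (a * b) x.
Proof. by rewrite -[x]clsK !Lsq_scale_pi scalerA. Qed.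

Lemma Lsq_scale1 : left_id 1 Lsq_scale.
Proof. by move=> x; rewrite -[x]clsK Lsq_scale_pi scale1r. Qed.

Lemma Lsq_scaleDr : right_distributive Lsq_scale +%R.
Proof.
move=> a x y; rewrite -[x]clsK -[y]clsK -Lsq_pi_add !Lsq_scale_pi.
by rewrite -Lsq_pi_add scalerDr.
Qed.

Lemma Lsq_scaleDl x : {morph Lsq_scale^~ x : a b / a + b}.
Proof.
move=> a b; rewrite -[x]clsK !Lsq_scale_pi -Lsq_pi_add.
by rewrite scalerDl.
Qed.

HB.instance Definition _ := GRing.Zmodule_isLmodule.Build R[i] Lsq
  Lsq_scaleA Lsq_scale1 Lsq_scaleDr Lsq_scaleDl.

Lemma cls_lincomb a f g : a *: cls f + cls g = cls (a *: f + g).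
Proof. by rewrite Lsq_pi_add -Lsq_scale_pi. Qed.

Lemma repr_lincomb a x y : {ae m, forall t, repr (a *: x + y) t = a * repr x t + repr y t}.
Proof.
apply/(Lsq_eqP (repr (a *: x + y)) (a *: repr x + repr y)).
by rewrite clsK -cls_lincomb !clsK.
Qed.

Definition Lsq_inner x y : R[i] := sqinner m (repr x) (repr y).

Lemma ae_eq_sqinner f f' g : {ae m, forall t, f t = f' t} ->
  sqinner m f g = sqinner m f' g.
Proof.
move=> ff'; apply/eqP; rewrite -subr_eq0 -(@ae_sqinner0 _ _ _ m (f - f') g)//.
  rewrite (_ : (f - f' : T -> _) = fun t => -1 * f' t + f t).
    by rewrite sqinner_linear// mulN1r addrC.
  by apply/funext => t; rewrite sqfB mulN1r addrC.
by apply: filterS ff' => t; rewrite sqfB => ->; rewrite subrr.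
Qed.

Lemma Lsq_inner_hermitian x y : Lsq_inner x y = (Lsq_inner y x)^*.
Proof. by rewrite /Lsq_inner sqinner_hermitian. Qed.

Lemma Lsq_inner_pi f g : Lsq_inner (cls f) (cls g) = sqinner m f g.
Proof.
rewrite /Lsq_inner (ae_eq_sqinner _ (repr_ae f)).
by rewrite sqinner_hermitian// (ae_eq_sqinner _ (repr_ae g)) -sqinner_hermitian.
Qed.

Lemma Lsq_inner_linear z : linear_for *%R (Lsq_inner^~ z).
Proof.
move=> a x y; rewrite -[x]clsK -[y]clsK -[z]clsK.
by rewrite cls_lincomb !Lsq_inner_pi -sqinner_linear.
Qed.

Lemma Lsq_inner_linearr z : linear_for (Num.conj \; *%R) (Lsq_inner z).
Proof.
move=> a x y; rewrite Lsq_inner_hermitian Lsq_inner_linear.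
by rewrite rmorphD rmorphM/= -!Lsq_inner_hermitian.
Qed.

HB.instance Definition _ := bilinear_isBilinear.Build R[i] Lsq Lsq R[i]
  *%R (Num.conj \; *%R) Lsq_inner (Lsq_inner_linear, Lsq_inner_linearr).

Lemma Lsq_inner_sym x y : Lsq_inner x y = (-1) ^+ false * Num.conj (Lsq_inner y x).
Proof. by rewrite expr0 mul1r; exact: Lsq_inner_hermitian. Qed.

HB.instance Definition _ := @isHermitianSesquilinear.Build R[i] Lsq false Num.conj
  Lsq_inner Lsq_inner_sym.

Lemma Lsq_inner_sqnorm x : Lsq_inner x x = (sqnorm m (repr x))%:C.
Proof. exact: sqinner_sqnorm. Qed.

Lemma Lsq_inner_gt0 x : x != 0 -> 0 < Lsq_inner x x.
Proof.
move=> x0; rewrite Lsq_inner_sqnorm ltcR lt_neqAle sqnorm_ge0 andbT.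
apply: contra x0 => /eqP/esym/(sqnorm0_ae (sqf_sqintegrable _)) x0.
rewrite -[x]clsK -[0]clsK; apply/eqP/Lsq_eqP.
have := repr_ae 0; rewrite (_ : cls 0 = 0); last first.
  by rewrite -(addrK (cls 0) (cls 0)) -Lsq_pi_add addr0 subrr.
by move=> z0; apply: filterS2 x0 z0 => t -> ->.
Qed.

HB.instance Definition _ := @isDotProduct.Build R[i] Lsq Lsq_inner Lsq_inner_gt0.

Definition Lsq_norm x : R[i] := sqrtC (Lsq_inner x x).

Lemma Lsq_normD x y : Lsq_norm (x + y) <= Lsq_norm x + Lsq_norm y.
Proof. exact: (dot_normD Lsq_inner). Qed.

Lemma Lsq_normZ a x : Lsq_norm (a *: x) = `|a| * Lsq_norm x.
Proof.
by rewrite /Lsq_norm (dotZ Lsq_inner) sqrtCM ?nnegrE ?exprn_ge0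
  ?(dot_ge0 Lsq_inner)// sqrCK.
Qed.

Lemma Lsq_norm_eq0 x : Lsq_norm x = 0 -> x = 0.
Proof.
move/eqP; rewrite /Lsq_norm sqrtC_eq0 => xx0; apply/eqP.
by apply: contraTT xx0 => /Lsq_inner_gt0; rewrite lt0r => /andP[].
Qed.

HB.instance Definition _ := @Lmodule_isNormed.Build R[i] Lsq
  Lsq_norm Lsq_normD Lsq_normZ Lsq_norm_eq0.

Lemma Lsq_normE x : `|x| = (Num.sqrt (sqnorm m (repr x)))%:C.
Proof.
rewrite (_ : `|x| = Lsq_norm x)// /Lsq_norm Lsq_inner_sqnorm.
rewrite -[in LHS](sqr_sqrtr (sqnorm_ge0 m (repr x))) rmorphXn/= sqrCK//.
by rewrite lecR sqrtr_ge0.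
Qed.

Lemma Lsq_norm_le x (e : R) : 0 <= e ->
  (`|x| <= e%:C) = (sqnorm m (repr x) <= e ^+ 2).
Proof.
move=> e0; rewrite Lsq_normE lecR -ler_sqr ?nnegrE ?sqrtr_ge0//.
by rewrite sqr_sqrtr// sqnorm_ge0.
Qed.

Lemma ae_eq_sqnorm f g : {ae m, forall t, f t = g t} -> sqnorm m f = sqnorm m g.
Proof.
move=> fg; apply: complexI; rewrite -!sqinner_sqnorm//.
rewrite (ae_eq_sqinner _ fg) sqinner_hermitian// (ae_eq_sqinner _ fg).
by rewrite -sqinner_hermitian.
Qed.

(** Distances computed on representatives: the form in which Fatou's lemma and
    dominated convergence apply. *)
Lemma Lsq_normB_le x y (e : R) : 0 <= e ->
  (`|x - y| <= e%:C) = (\int[m]_t (normc (repr x t - repr y t) ^+ 2)%:E <= (e ^+ 2)%:E)%E.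
Proof.
move=> e0; rewrite Lsq_norm_le// (@ae_eq_sqnorm _ (repr x - repr y)).
  by rewrite -lee_fin -(sqnormE (sqf_sqintegrable _)).
have := repr_lincomb (-1) y x.
rewrite scaleN1r addrC; apply: filterS => t ->.
by rewrite mulN1r addrC sqfB.
Qed.

End Lsq_space.

(** * Completeness of the quotient *)

Lemma cvg_telescope_geometric (R : realType) (a : R^nat) (C : R) :
  (forall n, `|a n.+1 - a n| <= C * 2^-1 ^+ n) -> cvgn a.
Proof.
move=> aC.
have : cvgn (series (telescope a)).
  apply: normed_cvg; apply: (@series_le_cvg _ _ (geometric C 2^-1)).
  - by move=> n; exact: normr_ge0.
  - by move=> n; exact: le_trans (aC n).
  - by move=> n; exact: aC.
  - by apply: is_cvg_geometric_series; rewrite ger0_norm ?invr_ge0// invf_lt1// ltr1n.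
move=> sc; rewrite (_ : a = (fun n => a 0%N + series (telescope a) n)); last first.
  by apply/funext => n; exact: eq_sum_telescope.
by apply: is_cvgD => //; exact: is_cvg_cst.
Qed.

Section Lsq_complete.
Context d (T : measurableType d) (R : realType).
Variable m : {measure set T -> \bar R}.
Local Notation normc := Normc.normc.
Local Notation Lsq := (Lsq m).
Hint Resolve sqf_sqintegrable : core.

(* The gap between the rate [4 ^- n] of the norms and the rate [2 ^- n] asked
   of the values makes the series [S] below summable. *)
Let eps (n : nat) : R := 4^-1 ^+ n.
Let eps_gt0 n : 0 < eps n. Proof. by rewrite exprn_gt0. Qed.
Let eps_le n k : (n <= k)%N -> eps k <= eps n.
Proof.
by move=> nk; rewrite /eps ler_wiXn2l// ?invr_ge0// invf_le1// ler1n.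
Qed.

Section limit.
Variable u : nat -> Lsq.
Hypothesis uB : forall n k, `|u n - u k| <= (eps n + eps k)%:C.

Let a n t := repr (u n) t.

Let ma n : cmeasurable (a n).
Proof. exact: (sqf_sqintegrable (repr (u n))).1. Qed.

Let mdiff n k : measurable_fun [set: T] (fun t => (normc (a n t - a k t) ^+ 2)%:E).
Proof.
apply/measurable_EFinP/measurable_normc2.
exact: (sqf_sqintegrable (repr (u n) - repr (u k))).1.
Qed.

Let integral_diff n k :
  (\int[m]_t (normc (a n t - a k t) ^+ 2)%:E <= ((eps n + eps k) ^+ 2)%:E)%E.
Proof. by have := uB n k; rewrite Lsq_normB_le// addr_ge0// ltW. Qed.

(* The weight [4 ^+ n] compensates half of the decay of the squared norms: [S]
   still has a finite integral, and where it is finite the increments decay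
   geometrically. *)
Let S t : \bar R := (\sum_(n <oo) (4 ^+ n * normc (a n.+1 t - a n t) ^+ 2)%:E)%E.

Let S_ge0 t n : (0 <= (4 ^+ n * normc (a n.+1 t - a n t) ^+ 2)%:E)%E.
Proof. by rewrite lee_fin mulr_ge0 ?sqr_ge0// exprn_ge0. Qed.

Let mS n : measurable_fun [set: T]
  (fun t => (4 ^+ n * normc (a n.+1 t - a n t) ^+ 2)%:E).
Proof.
apply/measurable_EFinP; apply: measurable_funM => //.
by apply/measurable_EFinP; exact: mdiff.
Qed.

Let S_fin : {ae m, forall t, S t \is a fin_num}.
Proof.
have intS : (\int[m]_t S t < +oo)%E.
  rewrite integral_nneseries//.
  apply: (@le_lt_trans _ _ (\sum_(n <oo) (4 * 4^-1 ^+ n : R)%:E)%E).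
    apply: lee_nneseries => [n _ _|n _].
      by apply: integral_ge0 => t _; exact: S_ge0.
    under eq_integral do rewrite EFinM.
    rewrite ge0_integralZl_EFin//; last by move=> t _; rewrite lee_fin sqr_ge0.
    apply: (@le_trans _ _ ((4 ^+ n)%:E * ((eps n.+1 + eps n) ^+ 2)%:E)%E).
      by apply: lee_wpmul2l; rewrite ?lee_fin ?exprn_ge0// integral_diff.
    rewrite -EFinM lee_fin.
    apply: (@le_trans _ _ (4 ^+ n * ((2 * eps n) ^+ 2))).
      rewrite ler_wpM2l// ?exprn_ge0// ler_sqr ?nnegrE ?addr_ge0 ?mulr_ge0 ?(ltW (eps_gt0 _))//.
      by rewrite mulr_natl mulr2n lerD2r eps_le.
    rewrite exprMn mulrCA (_ : 4 ^+ n * eps n ^+ 2 = eps n).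
      by rewrite -(natrX _ 2 2).
    by rewrite /eps expr2 mulrA -exprMn divff// expr1n mul1r.
  have cg : (series (geometric (4 : R) 4^-1) @ \oo --> (4 * (1 - 4^-1)^-1 : R)).
    by apply: cvg_geometric_series; rewrite ger0_norm ?invr_ge0// invf_lt1// ltr1n.
  rewrite (_ : limn _ = (4 * (1 - 4^-1)^-1)%:E) ?ltry//.
  apply/cvg_lim => //; rewrite (_ : (fun _ => _) = EFin \o series (geometric 4 4^-1)).
    by apply/cvg_EFin => //; exact: nearW.
  by apply/funext => n; rewrite /= /series/= -sumEFin.
have : m.-integrable setT S.
  apply/integrableP; split.
    by apply: ge0_emeasurable_sum => // n t _ _; exact: S_ge0.
  by under eq_integral do rewrite gee0_abs ?nneseries_ge0//.
by move/(integrable_ae measurableT); apply: filterS => t; exact.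
Qed.

Let a_cvg : {ae m, forall t, cvgn (fun n => complex.Re (a n t)) /\
                            cvgn (fun n => complex.Im (a n t))}.
Proof.
apply: filterS S_fin => t; set C := fine (S t) => St.
have nC n : normc (a n.+1 t - a n t) <= (1 + C) * 2^-1 ^+ n.
  have C0 : 0 <= C by apply: fine_ge0; exact: nneseries_ge0.
  have : 4 ^+ n * normc (a n.+1 t - a n t) ^+ 2 <= C.
    rewrite -lee_fin fineK//.
    by rewrite /S (@nneseriesD1 _ _ n)// leeDl// nneseries_ge0.
  rewrite -ler_pdivlMl ?exprn_gt0// => h.
  rewrite -ler_sqr ?nnegrE; last 2 first.
  - by case: (a n.+1 t - a n t) => p q; exact: sqrtr_ge0.
  - by rewrite mulr_ge0 ?addr_ge0// exprn_ge0// invr_ge0.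
  apply: (le_trans h); rewrite exprMn -exprM mulnC exprM mulrC.
  rewrite (_ : 2^-1 ^+ 2 = 4^-1 :> R); last by rewrite exprVn -natrX.
  rewrite exprVn ler_wpM2r// ?invr_ge0 ?exprn_ge0//.
  by rewrite sqrrD expr1n mul1r; have := sqr_ge0 C; lra.
have le_ReIm (z : R[i]) : `|complex.Re z| <= normc z /\ `|complex.Im z| <= normc z.
  have nz : 0 <= normc z by case: z => p q; exact: sqrtr_ge0.
  by split; rewrite -ler_sqr ?nnegrE// normcE2 real_normK ?num_real//
    ?lerDl ?lerDr sqr_ge0.
split; apply: (@cvg_telescope_geometric _ _ (1 + C)) => n.
  by apply: le_trans (nC n); apply: le_trans (le_ReIm _).1; rewrite raddfB.
by apply: le_trans (nC n); apply: le_trans (le_ReIm _).2; rewrite raddfB.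
Qed.

(* The upper limit is measurable everywhere and agrees with the limit almost
   everywhere. *)
Let lr t := fine (limn_esup (fun n => (complex.Re (a n t))%:E)).
Let li t := fine (limn_esup (fun n => (complex.Im (a n t))%:E)).
Let g t : R[i] := lr t +i* li t.

Let cvg_fine_esup (v : R^nat) : cvgn v ->
  v @ \oo --> fine (limn_esup (fun n => (v n)%:E)).
Proof.
move=> vc; have vE : (fun n => (v n)%:E) @ \oo --> (limn v)%:E.
  by apply/cvg_EFin => //; exact: nearW.
rewrite is_cvg_limn_esupE; last by apply/cvg_ex; eexists; exact: vE.
by rewrite (cvg_lim _ vE).
Qed.

Let mg : cmeasurable g.
Proof.
split; apply: (measurableT_comp (fine_measurable measurableT));
  apply: measurable_fun_limn_esup => n; apply/measurable_EFinP.
  exact: (ma n).1.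
exact: (ma n).2.
Qed.

Let integral_limit n :
  (\int[m]_t (normc (a n t - g t) ^+ 2)%:E <= ((2 * eps n) ^+ 2)%:E)%E.
Proof.
pose h k t := (normc (a n t - a (k + n)%N t) ^+ 2)%:E.
have mh k : measurable_fun setT (h k) by exact: mdiff.
have mng : measurable_fun setT (fun t => (normc (a n t - g t) ^+ 2)%:E).
  apply/measurable_EFinP/measurable_normc2.
  have := cmeasurableD (ma n) (cmeasurableM (cmeasurable_cst _ (-1)) mg).
  by under eq_fun do rewrite mulN1r.
have h0 k t : setT t -> (0 <= h k t)%E by rewrite lee_fin sqr_ge0.
have hcvg : {ae m, forall t, h ^~ t @ \oo --> (normc (a n t - g t) ^+ 2)%:E}.
  apply: filterS a_cvg => t [cr ci].
  have cvg_sq (v : nat -> R) (l : R) : v @ \oo --> l ->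
      (fun n => v n ^+ 2) @ \oo --> l ^+ 2.
    move=> al; rewrite (_ : (fun n => _) = v \* v) ?expr2; first exact: cvgM.
    by apply/funext => k; rewrite expr2.
  apply: cvg_EFin; first exact: nearW.
  rewrite (_ : _ \o _ = fun k =>
     (complex.Re (a n t) - complex.Re (a (k + n)%N t)) ^+ 2 +
     (complex.Im (a n t) - complex.Im (a (k + n)%N t)) ^+ 2); last first.
    by apply/funext => k /=; rewrite normcE2 !raddfB.
  rewrite normcE2 !raddfB /=; apply: cvgD.
    apply: cvg_sq; apply: cvgB; first exact: cvg_cst.
    by rewrite (cvg_shiftn n (fun k => complex.Re (a k t))); exact: cvg_fine_esup.
  apply: cvg_sq; apply: cvgB; first exact: cvg_cst.
  by rewrite (cvg_shiftn n (fun k => complex.Im (a k t))); exact: cvg_fine_esup.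
rewrite [leLHS](_ : _ = \int[m]_t limn_einf (h ^~ t))%E; last first.
  apply: ae_eq_integral => //.
    rewrite (_ : (fun t => _) = fun t => - limn_esup (fun k => - h k t))%E.
      apply: measurableT_comp => //; apply: measurable_fun_limn_esup => k.
      exact: measurableT_comp.
    apply/funext => t; rewrite -limn_einfN; congr limn_einf; apply/funext => k.
    by rewrite /comp oppeK.
  apply: filterS hcvg => t hc _; rewrite is_cvg_limn_einfE; last first.
    by apply/cvg_ex; eexists; exact: hc.
  by apply/esym/cvg_lim => //; exact: hc.
apply: le_trans (fatou _ _ _ _) _ => //.
rewrite limn_einf_lim; apply: lime_le; first exact: is_cvg_einfs.
near=> k; apply: (@le_trans _ _ (\int[m]_t h k t)%E).
  by apply: ereal_inf_lbound; exists k => //=.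
apply: (le_trans (integral_diff _ _)).
rewrite lee_fin ler_sqr ?nnegrE ?addr_ge0 ?mulr_ge0 ?(ltW (eps_gt0 _))//.
by rewrite mulr_natl mulr2n lerD2l eps_le// leq_addl.
Unshelve. all: by end_near. Qed.

(** The Riesz--Fischer theorem for sequences that are Cauchy at a fixed rate. *)
Lemma Lsq_limit : exists G : Lsq, forall n, `|u n - G| <= (2 * eps n)%:C.
Proof.
have gI : sqintegrable m g.
  have dI : sqintegrable m (fun t => a 0%N t - g t).
    split; last by apply: le_lt_trans (integral_limit _) _; rewrite ltry.
    have := cmeasurableD (ma 0) (cmeasurableM (cmeasurable_cst _ (-1)) mg).
    by under eq_fun do rewrite mulN1r.
  have := sqintegrable_lincomb (-1) dI (sqf_sqintegrable (repr (u 0%N))).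
  by under eq_fun do rewrite mulN1r opprB subrK.
exists (cls (mksq gI)) => n.
rewrite Lsq_normB_le ?mulr_ge0 ?(ltW (eps_gt0 _))//.
apply: le_trans (integral_limit n); rewrite le_eqVlt; apply/orP; left; apply/eqP.
apply: ae_eq_integral => //.
- apply/measurable_EFinP/measurable_normc2.
  exact: (sqf_sqintegrable (repr (u n) - repr (cls (mksq gI)))).1.
- apply/measurable_EFinP/measurable_normc2.
  exact: (sqf_sqintegrable (repr (u n) - mksq gI)).1.
- by apply: filterS (repr_ae (mksq gI)) => t /= -> _.
Qed.

End limit.

(** From a Cauchy filter one extracts a sequence with the prescribed rate, and
    the filter converges to the limit of that sequence. *)
Lemma Lsq_complete (F : set_system Lsq) : ProperFilter F -> cauchy F -> cvg F.
Proof.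
move=> FF /cauchyP Fc.
have /choice[u Fu] n : exists f : Lsq, F (ball f (eps n)%:C).
  by apply: Fc; rewrite ltcR.
have uB n k : `|u n - u k| <= (eps n + eps k)%:C.
  have [f [/= unf ukf]] := filter_ex (filterI (Fu n) (Fu k)).
  rewrite rmorphD/= (le_trans (ler_distD f _ _))// lerD//.
    by move: unf; rewrite -ball_normE/= => /ltW.
  by rewrite distrC; move: ukf; rewrite -ball_normE/= => /ltW.
have [G uG] := Lsq_limit uB.
apply/cvg_ex; exists G; apply/cvgrPdist_lt => e.
case: e => e e'; rewrite ltcE/= => /andP[/eqP -> e0].
have : \forall n \near \oo, 3 * eps n < e.
  have : (fun n => 3 * eps n) @ \oo --> (3 * 0 : R).
    apply: cvgMl_tmp; apply: cvg_expr.
    by rewrite ger0_norm ?invr_ge0// invf_lt1// ltr1n.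
  by rewrite mulr0 => /cvgr_lt; exact.
move=> [N _ /(_ N (leqnn N)) /= NP].
near=> f; apply: le_lt_trans (ler_distD (u N) _ _) _.
apply: (@lt_le_trans _ _ ((2 * eps N)%:C + (eps N)%:C)); last first.
  by rewrite -rmorphD/= lecR; apply: le_trans (ltW NP); lra.
rewrite ler_ltD//; first by rewrite distrC.
by near: f; have := Fu N; rewrite -ball_normE.
Unshelve. all: by end_near. Qed.

HB.instance Definition _ := Uniform_isComplete.Build Lsq Lsq_complete.

Lemma Lsq_norm_inner (x : Lsq) : `|x| = sqrtC (Lsq_inner x x).
Proof. by []. Qed.

HB.instance Definition _ := @isHilbert.Build R Lsq (@Lsq_inner _ _ _ m) Lsq_norm_inner.

End Lsq_complete.

(** * Graphs and isometries in Hilbert spaces *)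

Section hilbert_generalities.
Context (R : realType) (H : hilbertType R).

Lemma inner_CauchySchwarz (f g : H) : `|inner f g| <= `|f| * `|g|.
Proof. by rewrite !norm_inner; exact: dot_CauchySchwarz. Qed.

(** The adjoint is cut out by equations between continuous functions. *)
Lemma adjoint_closed (A : set (H * H)) : closed (adjoint A).
Proof.
move=> p clp f g Afg; apply/eqP; rewrite -subr_eq0; apply/negPn/negP => z0.
set z := _ - _ in z0.
pose c : R[i] := `|g| + `|f| + 1.
have c0 : 0 < c by rewrite ltr_wpDl// addr_ge0.
pose e : R[i] := `|z| / c.
have e0 : 0 < e by rewrite divr_gt0// normr_gt0.
have [q [/(_ _ _ Afg) Aq [/= pq1 pq2]]] := clp _ (nbhsx_ballx p e e0).
have : `|z| <= (`|g| + `|f|) * e.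
  have -> : z = inner g (p.1 - q.1) - inner f (p.2 - q.2).
    by rewrite /z !linearBr/= Aq opprB addrA addrNK.
  rewrite mulrDl (le_trans (ler_normB _ _))// lerD//.
    apply: (le_trans (inner_CauchySchwarz _ _)); rewrite ler_wpM2l//.
    by move: pq1; rewrite -ball_normE => /ltW.
  apply: (le_trans (inner_CauchySchwarz _ _)); rewrite ler_wpM2l//.
  by move: pq2; rewrite -ball_normE => /ltW.
move=> /le_lt_trans lez; suff /lez : (`|g| + `|f|) * e < `|z| by rewrite ltxx.
rewrite /e mulrCA gtr_pMr ?normr_gt0// ltr_pdivrMr// mul1r.
by rewrite /c ltrDl.
Qed.

Lemma dense_approx (S : set H) :
  (forall x (e : R), 0 < e -> exists2 y, S y & `|x - y| < e%:C) -> dense S.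
Proof.
move=> SP O [x Ox] oO.
have [e /= e0 eO] : exists2 e : R[i], 0 < e & ball x e `<=` O.
  by have /nbhs_ballP[e /= e0 eO] := open_nbhs_nbhs (conj oO Ox); exists e.
move: e e0 eO => [e e']; rewrite ltcE/= => /andP[/eqP -> e0] eO.
have [y Sy xy] := SP x e e0.
by exists y; split => //; apply: eO; rewrite -ball_normE.
Qed.

End hilbert_generalities.

(** Polarization. *)
Lemma isometry_inner (R : realType) (H K : hilbertType R) (V : {linear H -> K}) :
  (forall f, inner (V f) (V f) = inner f f) ->
  forall f g, inner (V f) (V g) = inner f g.
Proof.
move=> Viso f g.
have D (a : R[i]) : a^* * inner (V f) (V g) + a * inner (V g) (V f) =
    a^* * inner f g + a * inner g f.
  have := Viso (f + a *: g).
  rewrite linearD/= linearZ/= !linearDl/= !linearDr/=.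
  rewrite !linearZl_LR/= !linearZr_LR/= !Viso.
  rewrite -!addrA => /addrI; rewrite addrA [RHS]addrA => /addIr.
  by [].
have D1 := D 1; have Di := D 'i%C.
move: D1 Di; rewrite conjC1 !mul1r.
move: (inner (V f) (V g)) (inner (V g) (V f)) (inner f g) (inner g f).
move=> [a b] [c d] [p q] [s t] [e1 e2] [e3 e4].
by congr (_ +i* _); lra.
Qed.

(** * Weighted composition along a measure preserving map *)

Definition measure_preserving d (T : measurableType d) (R : realType)
    (m : {measure set T -> \bar R}) (Psi : T -> T) :=
  measurable_fun [set: T] Psi /\
  forall A, measurable A -> m (Psi @^-1` A) = m A.

Section wcomp.
Context d (T : measurableType d) (R : realType).
Variable m : {measure set T -> \bar R}.
Local Notation normc := Normc.normc.
Local Notation Lsq := (Lsq m).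
Hint Resolve sqf_sqintegrable : core.
Variable w : T -> R.
Hypothesis mw : measurable_fun [set: T] w.
Hypothesis w0 : forall t, 0 <= w t.

(** The graph of [f |-> w * (f \o Psi)]; pairs of classes are related through
    representatives, up to a null set. *)
Definition wcomp (Psi : T -> T) : set (Lsq * Lsq) :=
  [set p : Lsq * Lsq | {ae m, forall t,
     (repr p.2 : sqfun m) t = (w t)%:C * (repr p.1 : sqfun m) (Psi t)}].

Lemma mp_integral Psi (f : T -> \bar R) : measure_preserving m Psi ->
  measurable_fun setT f -> (forall t, 0 <= f t)%E ->
  (\int[m]_t f (Psi t) = \int[m]_t f t)%E.
Proof.
move=> [mP Pm] mf f0.
transitivity (\int[pushforward m Psi]_t f t)%E.
  by rewrite (ge0_integral_pushforward mP)// preimage_setT.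
apply: eq_measure_integral => A mA _; exact: Pm.
Qed.

Lemma mp_Rintegral Psi (f : T -> R) : measure_preserving m Psi ->
  measurable_fun setT f ->
  m.-integrable setT (fun t => (f (Psi t))%:E) ->
  \int[m]_t f (Psi t) = \int[m]_t f t.
Proof.
move=> [mP Pm] mf fI; rewrite /Rintegral; congr fine.
transitivity (\int[pushforward m Psi]_t (f t)%:E)%E.
  rewrite (integral_pushforward mP)// ?preimage_setT//.
  exact/measurable_EFinP.
by apply: eq_measure_integral => A mA _; exact: Pm.
Qed.

Lemma mp_ae Psi (P : T -> Prop) : measure_preserving m Psi ->
  {ae m, forall t, P t} -> {ae m, forall t, P (Psi t)}.
Proof.
move=> [mP Pm] [A [mA A0 PA]]; exists (Psi @^-1` A); split.
- by rewrite -[X in measurable X]setTI; exact: mP.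
- by rewrite Pm.
- by move=> t nP; exact: PA.
Qed.

Lemma cmeasurable_comp (Psi : T -> T) (f : T -> R[i]) : measurable_fun setT Psi ->
  cmeasurable f -> cmeasurable (f \o Psi).
Proof.
by move=> mP [mr mi]; split; [exact: (measurableT_comp mr mP) |
  exact: (measurableT_comp mi mP)].
Qed.

Lemma normc_real (a : R) : normc a%:C ^+ 2 = a ^+ 2.
Proof. by rewrite normcE2/= expr0n/= addr0. Qed.

Lemma mp_sqintegrable Psi (f : T -> R[i]) : measure_preserving m Psi ->
  (forall t, w (Psi t) = w t) -> cmeasurable f ->
  (\int[m]_t (w t ^+ 2 * normc (f t) ^+ 2)%:E < +oo)%E ->
  sqintegrable m (fun t => (w t)%:C * f (Psi t)).
Proof.
move=> PP wP mf foo; split.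
  by apply: cmeasurableM; [exact: cmeasurable_real |
     exact: (cmeasurable_comp PP.1 mf)].
apply: le_lt_trans foo.
rewrite -(@mp_integral _ (fun t => (w t ^+ 2 * normc (f t) ^+ 2)%:E) PP)
  ?le_eqVlt; last 2 first.
- apply/measurable_EFinP; apply: measurable_funM; first exact: measurable_funX.
  exact: measurable_normc2.
- by move=> t; rewrite lee_fin mulr_ge0 ?sqr_ge0.
apply/orP; left; apply/eqP; apply: eq_integral => t _.
by rewrite Normc.normcM exprMn normc_real wP.
Qed.

Lemma wcomp_operator Psi : measure_preserving m Psi -> is_operator (wcomp Psi).
Proof.
move=> PP; split.
- have z0 : {ae m, forall t, repr (0 : Lsq) t = 0}.
    apply: filterS (repr_lincomb (-1) (0 : Lsq) 0) => t.
    by rewrite mulN1r addNr scaler0 addr0.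
  by apply: filterS2 z0 (mp_ae PP z0) => t /= -> ->; rewrite mulr0.
- move=> a p q Np Nq.
  have e1 := repr_lincomb a p.2 q.2.
  have e2 := mp_ae PP (repr_lincomb a p.1 q.1).
  apply: filterS2 (filterI e1 e2) (filterI Np Nq) => t /= [-> ->] [-> ->].
  by rewrite mulrDr mulrCA.
- move=> f g g' /= fg fg'; rewrite -[g]clsK -[g']clsK; apply/Lsq_eqP.
  by apply: filterS2 fg fg' => t /= -> ->.
Qed.

(** Truncation where the weight is large: the weight being invariant, truncated
    functions belong to the domain of the operator and of its powers. *)
Definition cutoff (x : Lsq) (n : nat) (t : T) : R[i] :=
  if w t <= n%:R then repr x t else 0.

Lemma normc_cutoff x n t : normc (cutoff x n t) <= normc (repr x t).
Proof.
rewrite /cutoff; case: ifP => // _; rewrite Normc.normc0.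
by case: (repr x t) => a b; exact: sqrtr_ge0.
Qed.

Lemma cutoff_cmeasurable (f : T -> R[i]) n : cmeasurable f ->
  cmeasurable (fun t => if w t <= n%:R then f t else 0).
Proof.
move=> [mr mi]; split.
  rewrite (_ : (fun t => _) = fun t => if w t <= n%:R then complex.Re (f t) else 0).
    apply: measurable_fun_ifT => //; exact: measurable_fun_ler.
  by apply/funext => t; case: ifP.
rewrite (_ : (fun t => _) = fun t => if w t <= n%:R then complex.Im (f t) else 0).
  apply: measurable_fun_ifT => //; exact: measurable_fun_ler.
by apply/funext => t; case: ifP.
Qed.

Lemma cutoff_sqintegrable x n : sqintegrable m (cutoff x n).
Proof.
apply: (@sqintegrable_le _ _ _ _ _ (fun t => normc (repr x t) ^+ 2)).
- by apply: cutoff_cmeasurable; exact: (sqf_sqintegrable (repr x)).1.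
- exact: measurable_normc2 (sqf_sqintegrable (repr x)).1.
- move=> t; rewrite ler_sqr ?nnegrE ?normc_cutoff//.
    by case: (cutoff x n t) => a b; exact: sqrtr_ge0.
  by case: (repr x t) => a b; exact: sqrtr_ge0.
- exact: (sqf_sqintegrable (repr x)).2.
Qed.

Lemma cutoff_dom Psi x n : measure_preserving m Psi ->
  (forall t, w (Psi t) = w t) ->
  op_dom (wcomp Psi) (cls (mksq (cutoff_sqintegrable x n))).
Proof.
move=> PP wP.
pose cI := cutoff_sqintegrable x n.
have yI : sqintegrable m (fun t => (w t)%:C * cutoff x n (Psi t)).
  apply: mp_sqintegrable => //; first exact: cI.1.
  have : (\int[m]_t (n%:R ^+ 2 * normc (cutoff x n t) ^+ 2)%:E < +oo)%E.
    under eq_integral do rewrite EFinM.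
    rewrite ge0_integralZl_EFin// ?sqr_ge0//.
    - by apply: lte_mul_pinfty; rewrite ?lee_fin ?sqr_ge0//; exact: cI.2.
    - by move=> t _; rewrite lee_fin sqr_ge0.
    - by apply/measurable_EFinP; exact: measurable_normc2 cI.1.
  apply: le_lt_trans; apply: ge0_le_integral => //.
  - by move=> t _; rewrite lee_fin mulr_ge0 ?sqr_ge0.
  - apply/measurable_EFinP; apply: measurable_funM; first exact: measurable_funX.
    exact: measurable_normc2 cI.1.
  - apply/measurable_EFinP; apply: measurable_funM => //.
    exact: measurable_normc2 cI.1.
  - move=> t _; rewrite lee_fin /cutoff; case: ifP => wn.
      by rewrite ler_wpM2r ?sqr_ge0// ler_sqr ?nnegrE.
    by rewrite Normc.normc0 expr0n/= !mulr0.
exists (cls (mksq yI)) => /=.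
apply: filterS2 (repr_ae (mksq yI)) (mp_ae PP (repr_ae (mksq cI))) => t /= -> ->.
by [].
Qed.

Lemma cutoff_cvg x (e : R) : 0 < e ->
  exists n, `|x - cls (mksq (cutoff_sqintegrable x n))| < e%:C.
Proof.
move=> e0.
pose h n t := (normc (repr x t - cutoff x n t) ^+ 2)%:E.
have mh n : measurable_fun setT (h n).
  apply/measurable_EFinP/measurable_normc2.
  exact: (sqf_sqintegrable (repr x - mksq (cutoff_sqintegrable x n))).1.
have hx n t : (h n t <= (normc (repr x t) ^+ 2)%:E)%E.
  rewrite lee_fin /cutoff; case: ifP => _; last by rewrite subr0.
  by rewrite subrr Normc.normc0 expr0n/= sqr_ge0.
have : (\int[m]_t h n t)%E @[n --> \oo] --> (\int[m]_t (cst 0 t))%E.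
  apply: (@dominated_cvg _ _ _ m setT measurableT h (cst 0%E)
    (fun t => (normc (repr x t) ^+ 2)%:E)) => //.
  - move=> t _; apply/cvg_EFin; first exact: nearW.
    have [N wN] : exists N : nat, w t <= N%:R.
      by exists (Num.truncn (w t)).+1; rewrite ltW// truncnS_gt.
    apply: cvg_near_cst; near=> n.
    rewrite /= /h /cutoff ifT ?subrr ?Normc.normc0 ?expr0n//.
    by apply: (le_trans wN); rewrite ler_nat; near: n; exists N.
  - apply: sqintegrable_integrable; exact: sqf_sqintegrable.
  - by move=> n t _; rewrite gee0_abs ?hx// lee_fin sqr_ge0.
rewrite integral0 => h0.
have : \forall n \near \oo, (\int[m]_t h n t < ((e / 2) ^+ 2)%:E)%E.
  have [hfin h00] := (fine_cvgP _ _).1 h0.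
  have /= h1 := @cvgr_lt _ _ _ _ _ _ h00 ((e / 2) ^+ 2) _.
  near=> n; rewrite -[X in (X < _)%E]fineK; first by rewrite lte_fin; near: n; apply: h1;
    rewrite exprn_gt0// divr_gt0.
  by near: n.
move=> [n _ /(_ n (leqnn n)) hn]; exists n.
apply: (@le_lt_trans _ _ (e / 2)%:C); last by rewrite ltcR; lra.
rewrite Lsq_normB_le ?divr_ge0 ?(ltW e0)//; apply: le_trans (ltW hn).
rewrite le_eqVlt; apply/orP; left; apply/eqP; apply: ae_eq_integral => //.
  apply/measurable_EFinP/measurable_normc2.
  exact: (sqf_sqintegrable (repr x -
    repr (cls (mksq (cutoff_sqintegrable x n))))).1.
by apply: filterS (repr_ae (mksq (cutoff_sqintegrable x n))) => t /= -> _.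
Unshelve. all: by end_near. Qed.

Lemma wcomp_dense Psi : measure_preserving m Psi ->
  (forall t, w (Psi t) = w t) -> densely_defined (wcomp Psi).
Proof.
move=> PP wP; apply: dense_approx => x e e0.
have [n xn] := cutoff_cvg x e0.
by exists (cls (mksq (cutoff_sqintegrable x n))) => //; exact: cutoff_dom.
Qed.

End wcomp.

(** * Normality of weighted composition *)

Section wcomp_normal.
Context d (T : measurableType d) (R : realType).
Variable m : {measure set T -> \bar R}.
Local Notation normc := Normc.normc.
Local Notation Lsq := (Lsq m).
Local Notation sqfun := (sqfun m).
Hint Resolve sqf_sqintegrable : core.
Variable w : T -> R.
Hypothesis mw : measurable_fun [set: T] w.
Hypothesis w0 : forall t, 0 <= w t.
Implicit Types Psi : T -> T.

Lemma mp_sqinner Psi (f g : T -> R[i]) : measure_preserving m Psi ->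
  cmeasurable f -> cmeasurable g ->
  sqintegrable m (f \o Psi) -> sqintegrable m (g \o Psi) ->
  sqinner m (f \o Psi) (g \o Psi) = sqinner m f g.
Proof.
move=> PP mf mg fI gI; rewrite /sqinner.
have [mr mi] : cmeasurable (fun t => f t * (g t)^*).
  by apply: cmeasurableM => //; exact: cmeasurable_conj.
have [rI iI] := sqinner_integrable fI gI.
congr (_ +i* _).
  exact: (@mp_Rintegral _ _ _ _ _ (fun t => complex.Re (f t * (g t)^*)) PP).
exact: (@mp_Rintegral _ _ _ _ _ (fun t => complex.Im (f t * (g t)^*)) PP).
Qed.

Lemma repr_cmeasurable (x : Lsq) : cmeasurable (repr x : sqfun).
Proof. exact: (sqf_sqintegrable (repr x : sqfun)).1. Qed.

Lemma mp_sqintegrable_comp Psi (f : T -> R[i]) : measure_preserving m Psi ->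
  sqintegrable m f -> sqintegrable m (f \o Psi).
Proof.
move=> PP fI; split; first exact: (cmeasurable_comp PP.1 fI.1).
rewrite (@mp_integral _ _ _ m Psi (fun t => (normc (f t) ^+ 2)%:E) PP).
- exact: fI.2.
- exact/measurable_EFinP/measurable_normc2/fI.1.
- by move=> t; rewrite lee_fin sqr_ge0.
Qed.

Section adjoint.
Variables Psi Psi' : T -> T.
Hypothesis PP : measure_preserving m Psi.
Hypothesis PP' : measure_preserving m Psi'.
Hypothesis PK : cancel Psi Psi'.
Hypothesis PK' : cancel Psi' Psi.
Hypothesis wP : forall t, w (Psi t) = w t.

Let wP' t : w (Psi' t) = w t.
Proof. by rewrite -[in RHS](PK' t) wP. Qed.

(** Change of variables: moving [Psi] from one factor of the inner product to
    the other turns it into its inverse. *)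
Lemma wcomp_sub_adjoint (p : Lsq * Lsq) :
  wcomp w Psi' p -> adjoint (wcomp w Psi) p.
Proof.
move=> Np f g Nfg; case: p Np => u v Np.
rewrite /inner/= /Lsq_inner.
pose F t := (repr f : sqfun) t.
have wuI : sqintegrable m (fun t => (w t)%:C * (repr u : sqfun) (Psi' t)).
  have vI := sqf_sqintegrable (repr v : sqfun).
  split.
    apply: cmeasurableM; first exact: cmeasurable_real.
    exact: (cmeasurable_comp PP'.1 (repr_cmeasurable u)).
  move: vI.2; congr (_ < _)%E; apply: ae_eq_integral => //.
  - exact/measurable_EFinP/measurable_normc2/vI.1.
  - apply/measurable_EFinP/measurable_normc2.
    apply: cmeasurableM; first exact: cmeasurable_real.
    exact: (cmeasurable_comp PP'.1 (repr_cmeasurable u)).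
  - by apply: filterS Np => t /= -> _.
have wfI : sqintegrable m (fun t => (w t)%:C * (repr f : sqfun) (Psi t)).
  have vI := sqf_sqintegrable (repr g : sqfun).
  split.
    apply: cmeasurableM; first exact: cmeasurable_real.
    exact: (cmeasurable_comp PP.1 (repr_cmeasurable f)).
  move: vI.2; congr (_ < _)%E; apply: ae_eq_integral => //.
  - exact/measurable_EFinP/measurable_normc2/vI.1.
  - apply/measurable_EFinP/measurable_normc2.
    apply: cmeasurableM; first exact: cmeasurable_real.
    exact: (cmeasurable_comp PP.1 (repr_cmeasurable f)).
  - by apply: filterS Nfg => t /= -> _.
transitivity (sqinner m (mksq wfI) (repr u : sqfun)).
  exact: (@ae_eq_sqinner _ _ _ m (repr g) (mksq wfI) (repr u) Nfg).
transitivity (sqinner m (repr f : sqfun) (mksq wuI)); last first.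
  rewrite [LHS]sqinner_hermitian// [RHS]sqinner_hermitian//; congr (_ ^*)%C.
  by apply/esym; exact: (@ae_eq_sqinner _ _ _ m (repr v) (mksq wuI) (repr f) Np).
rewrite -(mp_sqinner PP _ wuI.1).
- rewrite /sqinner; congr (_ +i* _); apply: eq_Rintegral => t _ /=;
  rewrite PK wP; case: ((repr f : sqfun) _) ((repr u : sqfun) _) => a b [c e] /=; ring.
- exact: repr_cmeasurable.
- exact: mp_sqintegrable_comp.
- exact: mp_sqintegrable_comp.
Qed.

(** To identify [v] with [w * (u \o Psi')], test the adjoint relation on their
    difference [D n], truncated where the weight is at most [n] so that it lies
    in the domain; the outcome is that the norm of [D n] is [0]. *)
Lemma adjoint_sub_wcomp (p : Lsq * Lsq) :
  adjoint (wcomp w Psi) p -> wcomp w Psi' p.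
Proof.
case: p => u v Np.
pose U t := (w t)%:C * (repr u : sqfun) (Psi' t).
pose D n t := if w t <= n%:R then U t - (repr v : sqfun) t else 0.
have mU : cmeasurable U.
  apply: cmeasurableM; first exact: cmeasurable_real.
  exact: (cmeasurable_comp PP'.1 (repr_cmeasurable u)).
have UnI n : sqintegrable m (fun t => if w t <= n%:R then U t else 0).
  apply: (@sqintegrable_le _ _ _ _ _
    (fun t => n%:R ^+ 2 * normc ((repr u : sqfun) (Psi' t)) ^+ 2)).
  - exact: cutoff_cmeasurable.
  - apply: measurable_funM => //; apply: measurable_normc2.
    exact: (cmeasurable_comp PP'.1 (repr_cmeasurable u)).
  - move=> t; case: ifP => wn.
      by rewrite Normc.normcM exprMn normc_real ler_wpM2r ?sqr_ge0// ler_sqr ?nnegrE.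
    by rewrite Normc.normc0 expr0n/= mulr_ge0 ?sqr_ge0.
  - under eq_integral do rewrite EFinM.
    have uI := mp_sqintegrable_comp PP' (sqf_sqintegrable (repr u : sqfun)).
    rewrite ge0_integralZl_EFin// ?sqr_ge0//.
    + by apply: lte_mul_pinfty; rewrite ?lee_fin ?sqr_ge0//; exact: uI.2.
    + by move=> t _; rewrite lee_fin sqr_ge0.
    + exact/measurable_EFinP/measurable_normc2/uI.1.
have DI n : sqintegrable m (D n).
  have := sqintegrable_lincomb (-1) (cutoff_sqintegrable mw v n) (UnI n).
  rewrite (_ : (fun t => _) = D n)//; apply/funext => t.
  by rewrite /D /cutoff; case: ifP => _; rewrite ?mulr0 ?addr0// mulN1r addrC.
have D0 n : {ae m, forall t, D n t = 0}.
  apply: (sqnorm0_ae (DI n)); apply: complexI; rewrite -sqinner_sqnorm//.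
  have wDI : sqintegrable m (fun t => (w t)%:C * D n (Psi t)).
    apply: mp_sqintegrable => //; first exact: (DI n).1.
    have : (\int[m]_t (n%:R ^+ 2 * normc (D n t) ^+ 2)%:E < +oo)%E.
      under eq_integral do rewrite EFinM.
      rewrite ge0_integralZl_EFin// ?sqr_ge0//.
      - by apply: lte_mul_pinfty; rewrite ?lee_fin ?sqr_ge0//; exact: (DI n).2.
      - by move=> t _; rewrite lee_fin sqr_ge0.
      - by apply/measurable_EFinP; exact: measurable_normc2 (DI n).1.
    apply: le_lt_trans; apply: ge0_le_integral => //.
    - by move=> t _; rewrite lee_fin mulr_ge0 ?sqr_ge0.
    - apply/measurable_EFinP; apply: measurable_funM; first exact: measurable_funX.
      exact: measurable_normc2 (DI n).1.
    - apply/measurable_EFinP; apply: measurable_funM => //.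
      exact: measurable_normc2 (DI n).1.
    - move=> t _; rewrite lee_fin /D; case: ifP => wn.
        by rewrite ler_wpM2r ?sqr_ge0// ler_sqr ?nnegrE.
      by rewrite Normc.normc0 expr0n/= !mulr0.
  have ND : wcomp w Psi (cls (mksq (DI n)), cls (mksq wDI)).
    apply: filterS2 (repr_ae (mksq wDI)) (mp_ae PP (repr_ae (mksq (DI n)))).
    by move=> t /= -> ->.
  have := Np _ _ ND; rewrite -[u]clsK -[v]clsK /inner/= !Lsq_inner_pi => E.
  have uPI := mp_sqintegrable_comp PP' (sqf_sqintegrable (repr u : sqfun)).
  have E1 : sqinner m (mksq wDI) (repr u : sqfun) = sqinner m (D n) (mksq (UnI n)).
    rewrite -(mp_sqinner PP (DI n).1 (UnI n).1).
    + rewrite /sqinner; congr (_ +i* _); apply: eq_Rintegral => t _ /=;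
      rewrite /U PK wP; (case: ifP => wn;
        last by rewrite (_ : D n (Psi t) = 0) ?mulr0 ?mul0r// /D wP wn);
      by case: (D n (Psi t)) ((repr u : sqfun) t) => a b [c e] /=; ring.
    + exact: mp_sqintegrable_comp.
    + exact: mp_sqintegrable_comp.
  have E2 : sqinner m (D n) (repr v : sqfun) =
            sqinner m (D n) (cutoff w v n).
    rewrite /sqinner; congr (_ +i* _); apply: eq_Rintegral => t _ /=;
    by rewrite /D /cutoff; case: ifP => _; rewrite ?mulr0 ?mul0r.
  have vnI := cutoff_sqintegrable mw v n.
  transitivity (sqinner m (D n) (fun t => -1 * cutoff w v n t + mksq (UnI n) t)).
    congr sqinner; apply/funext => t; rewrite /D /cutoff/=.
    by case: ifP => _; rewrite ?mulr0 ?addr0// mulN1r addrC.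
  rewrite sqinner_hermitian//; last exact: sqintegrable_lincomb.
  rewrite sqinner_linear// rmorphD rmorphM/= -!sqinner_hermitian//.
  by rewrite rmorphN rmorph1 -E1 E E2 mulN1r addNr.
have : {ae m, forall t n, D n t = 0} by exact/ae_foralln.
rewrite /wcomp/=; apply: filterS => t Dt.
have := Dt (Num.truncn (w t)).+1; rewrite /D ifT ?ltW ?truncnS_gt//.
by move/eqP; rewrite subr_eq0 => /eqP.
Qed.

End adjoint.

Section normal.
Variables Psi Psi' : T -> T.
Hypothesis PP : measure_preserving m Psi.
Hypothesis PP' : measure_preserving m Psi'.
Hypothesis PK : cancel Psi Psi'.
Hypothesis PK' : cancel Psi' Psi.
Hypothesis wP : forall t, w (Psi t) = w t.

Let wP' t : w (Psi' t) = w t.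
Proof. by rewrite -[in RHS](PK' t) wP. Qed.

Lemma adjoint_wcomp : adjoint (wcomp w Psi) = wcomp (m := m) w Psi'.
Proof.
apply/seteqP; split => p; first exact: (adjoint_sub_wcomp PP PP' PK wP).
exact: (wcomp_sub_adjoint PP PP' PK wP).
Qed.

(** Both products of the operator and its adjoint are multiplication by [w ^ 2]
    with the natural domain: if [w ^ 2 * x] is square integrable then so is
    [w * x], since [w ^ 2 <= 1 + w ^ 4]. *)
Lemma wcomp_wcomp : op_comp (wcomp w Psi') (wcomp w Psi) =
  [set p : Lsq * Lsq | {ae m, forall t,
     (repr p.2 : sqfun) t = (w t ^+ 2)%:C * (repr p.1 : sqfun) t}].
Proof.
apply/seteqP; split => -[x z] /=.
  move=> [h /= Nh Nz]; apply: filterS2 (mp_ae PP' Nh) Nz => t /=.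
  by rewrite PK' wP' => -> ->; rewrite expr2 rmorphM mulrA.
move=> xz.
have mx := repr_cmeasurable x.
have hI : sqintegrable m (fun t => (w t)%:C * (repr x : sqfun) (Psi t)).
  apply: mp_sqintegrable => //.
  have xI := sqf_sqintegrable (repr x : sqfun).
  have zI := sqf_sqintegrable (repr z : sqfun).
  have := integral_lincomb_lty ler01 ler01 (measurable_normc2 xI.1)
    (measurable_normc2 zI.1) (fun=> sqr_ge0 _) (fun=> sqr_ge0 _) xI.2 zI.2.
  apply: le_lt_trans; apply: ae_ge0_le_integral => //.
  - by move=> t _; rewrite lee_fin mulr_ge0 ?sqr_ge0.
  - apply/measurable_EFinP; apply: measurable_funM; first exact: measurable_funX.
    exact: measurable_normc2.
  - by move=> t _; rewrite lee_fin !mul1r addr_ge0 ?sqr_ge0.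
  - apply/measurable_EFinP; apply: measurable_funD; apply: measurable_funM => //;
    exact: (measurable_normc2 (repr_cmeasurable _)).
  - apply: filterS xz => t -> _; rewrite lee_fin !mul1r.
    rewrite Normc.normcM exprMn normc_real.
    set a := normc _ ^+ 2; have a0 : 0 <= a by exact: sqr_ge0.
    rewrite -[X in _ <= X + _]mul1r -mulrDl ler_wpM2r//.
    have := sqr_ge0 (w t ^+ 2 - 1); have := sqr_ge0 (w t ^+ 2).
    by rewrite sqrrB; lra.
exists (cls (mksq hI)); first exact: (repr_ae (mksq hI)).
apply: filterS2 xz (mp_ae PP' (repr_ae (mksq hI))) => t /= -> ->.
by rewrite PK' wP' expr2 rmorphM mulrA.
Qed.

End normal.

(** The adjoint is the weighted composition with the inverse map, and the
    product in either order is multiplication by [w ^ 2]; closedness is free,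
    as the operator is itself an adjoint. *)
Theorem wcomp_normal Psi Psi' : measure_preserving m Psi ->
  measure_preserving m Psi' -> cancel Psi Psi' -> cancel Psi' Psi ->
  (forall t, w (Psi t) = w t) -> op_normal (wcomp (m := m) w Psi).
Proof.
move=> PP PP' PK PK' wP.
have wP' t : w (Psi' t) = w t by rewrite -[in RHS](PK' t) wP.
split.
- exact: wcomp_operator.
- exact: wcomp_dense.
- by rewrite -(adjoint_wcomp PP' PP PK' wP'); exact: adjoint_closed.
- by rewrite (adjoint_wcomp PP PP' PK wP) (wcomp_wcomp PP PP' PK' wP)
     (wcomp_wcomp PP' PP PK wP').
Qed.

End wcomp_normal.

(** * Countable sums of measures *)

Section countable_sums.
Local Open Scope ereal_scope.
Context (R : realType).

Lemma nneseries_pickle (I : countType) (a : I -> \bar R) : (forall i, 0 <= a i) ->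
  \sum_(n <oo) (if pickle_inv n is Some i then a i else 0) =
  \esum_(i in [set: I]) a i.
Proof.
move=> a0; rewrite nneseries_esumT; last by move=> n; case: (pickle_inv n).
rewrite (esumID (pickle @` [set: I]))//; last by move=> n _; case: (pickle_inv n).
rewrite [X in _ + X]esum1 ?adde0.
  rewrite setTI esum_image; last by move=> x y _ _; exact: (pcan_inj pickleK).
  by apply: eq_esum => i _; rewrite pickleK_inv.
move=> n [_ nI]; case E: (pickle_inv n) => [i|//].
by exfalso; apply: nI; exists i => //; have := @pickle_invK I n; rewrite E.
Qed.

Lemma esum_pair (A B : choiceType) (f : A -> B -> \bar R) : (forall a b, 0 <= f a b) ->
  \esum_(p in [set: A * B]) f p.1 p.2 = \esum_(a in [set: A]) \esum_(b in [set: B]) f a b.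
Proof.
move=> f0; rewrite esum_esum//; congr esum.
by apply/seteqP; split => -[a b].
Qed.

Lemma esum_exchange (A B : choiceType) (f : A -> B -> \bar R) :
  (forall a b, 0 <= f a b) ->
  \esum_(a in [set: A]) \esum_(b in [set: B]) f a b =
  \esum_(b in [set: B]) \esum_(a in [set: A]) f a b.
Proof.
move=> f0; rewrite -!esum_pair//.
rewrite (@reindex_esum _ _ _ [set: A * B] [set: B * A] (fun p => (p.2, p.1)))//.
by split => //[[a b] [c e] _ _ [-> ->]//|[b a] _]; exists (a, b).
Qed.

Lemma esum_sum_type (A B : choiceType) (f : A + B -> \bar R) : (forall x, 0 <= f x) ->
  \esum_(x in [set: A + B]) f x =
  \esum_(a in [set: A]) f (inl a) + \esum_(b in [set: B]) f (inr b).
Proof.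
move=> f0; rewrite (esumID (inl @` [set: A]))// setTI esum_image; last first.
  by move=> x y _ _ [].
congr (_ + _); rewrite (_ : _ `&` _ = inr @` [set: B]).
  by rewrite esum_image// => x y _ _ [].
apply/seteqP; split => [[a|b]/=|_ [b _ <-]].
- by move=> [_]; case; exists a.
- by move=> _; exists b.
- by split => // -[].
Qed.

(** The inequality that is immediate from the definition of the sum, applied to
    [k] and to its inverse. *)
Lemma ge0_esumZl (I : choiceType) (S : set I) (k : \bar R) (f : I -> \bar R) :
  0 <= k -> k \is a fin_num -> (forall i, 0 <= f i) ->
  \esum_(i in S) (k * f i) = k * \esum_(i in S) f i.
Proof.
move=> k0 kfin f0.
have le (c : \bar R) (g : I -> \bar R) : 0 <= c -> c \is a fin_num -> (forall i, 0 <= g i) ->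
    \esum_(i in S) (c * g i) <= c * \esum_(i in S) g i.
  move=> c0 cf g0; apply: ge_ereal_sup => _ [X [finX XS] <-].
  rewrite -ge0_mule_fsumr//; apply: lee_wpmul2l => //.
  by apply: ereal_sup_ubound; exists X.
apply/eqP; rewrite eq_le; apply/andP; split; first exact: le.
have [->|kn0] := eqVneq k 0.
  by rewrite mul0e esum_ge0// => i _; rewrite mul0e.
have fk0 : fine k != 0%R by apply: contra kn0 => /eqP k1; rewrite -(fineK kfin) k1.
have k1 : (fine k)^-1%:E * k = 1 by rewrite -[in X in _ * X](fineK kfin) -EFinM mulVf.
have k1' : k * (fine k)^-1%:E = 1 by rewrite muleC.
have := le (fine k)^-1%:E (fun i => k * f i).
under eq_esum do rewrite muleA k1 mul1e.
have ik0 : 0 <= (fine k)^-1%:E by rewrite lee_fin invr_ge0 fine_ge0.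
move=> /(_ ik0 isT (fun i => mule_ge0 k0 (f0 i))) /(lee_wpmul2l k0).
by rewrite muleA k1' mul1e.
Qed.

End countable_sums.

Section countable_sum_of_measures.
Local Open Scope ereal_scope.
Context d (T : measurableType d) (R : realType) (I : countType).
Variable mu : I -> {measure set T -> \bar R}.

Let term n : {measure set T -> \bar R} :=
  if pickle_inv n is Some i then mu i else mzero.

(** The index set is only countable: it is enumerated by [pickle], the
    numbers that encode no index contributing the zero measure. *)
Definition csum_measure : {measure set T -> \bar R} := mseries term 0%N.

Lemma csum_measureE A : csum_measure A = \esum_(i in [set: I]) mu i A.
Proof.
rewrite -nneseries_pickle//; apply: eq_eseriesr => n _.
by rewrite /term; case: (pickle_inv n).
Qed.

Lemma integral_csum_measure (D : set T) (f : T -> \bar R) : measurable D ->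
  (forall x, D x -> 0 <= f x) -> measurable_fun D f ->
  \int[csum_measure]_(x in D) f x = \esum_(i in [set: I]) \int[mu i]_(x in D) f x.
Proof.
move=> mD f0 mf; rewrite ge0_integral_measure_series// -nneseries_pickle.
  apply: eq_eseriesr => n _; rewrite /term; case: (pickle_inv n) => //.
  by rewrite integral_measure_zero.
by move=> i; exact: integral_ge0.
Qed.

End countable_sum_of_measures.

(** * Measures with a density *)

Section density.
Local Open Scope ereal_scope.
Context d (T : measurableType d) (R : realType).
Variables (mu : {measure set T -> \bar R}) (f : T -> R).

Definition density (mf : measurable_fun [set: T] f) (f0 : forall x, (0 <= f x)%R) :
    set T -> \bar R := fun A => \int[mu]_(x in A) (f x)%:E.

Variables (mf : measurable_fun [set: T] f) (f0 : forall x, (0 <= f x)%R).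
Local Notation nu := (density mf f0).

Let nu0 : nu set0 = 0. Proof. exact: integral_set0. Qed.

Let nu_ge0 A : 0 <= nu A.
Proof. by apply: integral_ge0 => x _; rewrite lee_fin. Qed.

Let nu_sigma_additive : semi_sigma_additive nu.
Proof.
move=> F mF tF mUF; rewrite /density ge0_integral_bigcup//; last 2 first.
- exact/measurable_EFinP/measurable_funTS.
- by move=> x _; rewrite lee_fin.
by apply: is_cvg_ereal_nneg_natsum => n _; exact: nu_ge0.
Qed.

HB.instance Definition _ := isMeasure.Build _ _ _ nu nu0 nu_ge0 nu_sigma_additive.

Import HBNNSimple.

Let integral_density_indic (E : set T) : measurable E ->
  \int[nu]_x (\1_E x)%:E = \int[mu]_x ((\1_E x)%:E * (f x)%:E).
Proof.
move=> mE; rewrite integral_indic// setIT /density [LHS]integral_mkcond.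
apply: eq_integral => x _; rewrite /patch indicE.
by case: (x \in E); rewrite ?mul1e ?mul0e.
Qed.

Let integral_density_nnsfun (h : {nnsfun T >-> R}) :
  \int[nu]_x (h x)%:E = \int[mu]_x ((h x)%:E * (f x)%:E).
Proof.
under [LHS]eq_integral do rewrite fimfunE -fsumEFin//.
rewrite [LHS]ge0_integral_fsum//; last 2 first.
  - by move=> r; exact/measurable_EFinP/measurableT_comp.
  - by move=> n x _; rewrite EFinM nnfun_muleindic_ge0.
under [RHS]eq_integral.
  move=> x xD; rewrite fimfunE -fsumEFin// ge0_mule_fsuml; last first.
    by move=> r; rewrite EFinM nnfun_muleindic_ge0.
  over.
rewrite [RHS]ge0_integral_fsum//; last 2 first.
  - move=> r; apply: emeasurable_funM => //.
    by apply/measurable_EFinP; apply/measurableT_comp.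
    exact/measurable_EFinP.
  - move=> n x _; apply: mule_ge0; last by rewrite lee_fin.
    by rewrite EFinM nnfun_muleindic_ge0.
apply: eq_fsbigr => r _.
have [r0|r0] := ltP r 0%R.
  rewrite preimage_nnfun0//.
  under eq_integral do rewrite indic0 mulr0.
  under [RHS]eq_integral do rewrite indic0 mulr0 mul0e.
  by rewrite !integral0.
rewrite integralZl_indic_nnsfun// integral_density_indic//.
rewrite -ge0_integralZl//.
- by apply: eq_integral => x _; rewrite EFinM muleA.
- by apply: emeasurable_funM => //; apply/measurable_EFinP.
- by move=> x _; rewrite mule_ge0// lee_fin.
Qed.

Lemma integral_density (g : T -> \bar R) : measurable_fun [set: T] g ->
  (forall x, 0 <= g x) -> \int[nu]_x g x = \int[mu]_x (g x * (f x)%:E).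
Proof.
move=> mg g0; pose g_ := nnsfun_approx measurableT mg.
have mg_ n : measurable_fun [set: T] (fun x => (g_ n x)%:E).
  exact/measurable_EFinP/measurable_funTS.
have cvg_g x : (g_ n x)%:E @[n --> \oo] --> g x by exact: cvg_nnsfun_approx.
have nd_g x : {homo (fun n => (g_ n x)%:E) : a b / (a <= b)%N >-> a <= b}.
  by move=> a b ab; rewrite lee_fin; exact/lefP/nd_nnsfun_approx.
transitivity (limn (fun n => \int[nu]_x (g_ n x)%:E)).
  rewrite -monotone_convergence//=.
  - by apply: eq_integral => x _; apply/esym/cvg_lim => //; exact: cvg_g.
  - by move=> n x _; rewrite lee_fin.
under eq_fun do rewrite integral_density_nnsfun.
rewrite -monotone_convergence//=.
- apply: eq_integral => x _; apply/cvg_lim => //.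
  by apply: cvgeMr => //; exact: cvg_g.
- by move=> n; apply: emeasurable_funM => //; exact/measurable_EFinP.
- by move=> n x _; rewrite mule_ge0// lee_fin.
- by move=> x _ a b ab; rewrite lee_wpmul2r// ?nd_g// lee_fin.
Qed.

End density.

(** * The unrolled graph *)

Section digraph_sums.
Context (R : realType) (eta : option nat) (kappa : nat).
Local Notation X := (digraph eta kappa).
Local Open Scope ereal_scope.

Lemma integral_digraph (mu : {measure set X -> \bar R}) (g : X -> \bar R) :
  (forall x, 0 <= g x) ->
  \int[mu]_x g x = \esum_(x in [set: X]) g x * mu [set x].
Proof.
move=> g0; pose F n := [set x : X | pickle x = n].
have FT : [set: X] = \bigcup_n F n.
  by apply/seteqP; split => // x _; exists (pickle x).
have tF : trivIset setT F.
  apply/trivIsetP => i j _ _ ij; apply/seteqP; split => // x [/= xi xj].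
  by move: ij; rewrite -xi -xj eqxx.
have mF k : measurable (F k) by exact: measurable_discrete.
rewrite [in LHS]FT ge0_integral_bigcup//.
rewrite -nneseries_pickle; last by move=> x; rewrite mule_ge0.
apply: eq_eseriesr => n _; case E: (pickle_inv n) => [x|].
  have -> : F n = [set x].
    apply/seteqP; split => [y /= yn|y /= ->].
      by move: E; rewrite -yn pickleK_inv => -[].
    by have := @pickle_invK X n; rewrite E.
  rewrite (eq_integral (fun=> g x)); last by move=> y; rewrite inE => ->.
  by rewrite integral_cst.
rewrite (_ : F n = set0) ?integral_set0//.
by apply/seteqP; split => // y /= yn; move: E; rewrite -yn pickleK_inv.
Qed.

Lemma esum_digraph (g : X -> \bar R) : (forall x, 0 <= g x) ->
  \esum_(x in [set: X]) g x = \esum_(r in [set: 'I_kappa.+1]) g (circuit r) +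
    \esum_(i in [set: J eta]) \esum_(j in [set: nat]) g (branch i j).
Proof.
move=> g0.
pose e (s : 'I_kappa.+1 + J eta * nat) : X :=
  match s with inl r => circuit r | inr p => branch p.1 p.2 end.
rewrite (@reindex_esum _ _ _ [set: _] _ e); last first.
  split => //.
    by move=> [r|[i j]] [r'|[i' j']] _ _ //= => [[->]|[-> ->]].
  by move=> [r|i j] _; [exists (inl r)|exists (inr (i, j))].
rewrite esum_sum_type//; congr (_ + _).
by rewrite -(esum_pair (fun i j => g0 (branch i j))).
Qed.

End digraph_sums.

(** [inr (i, q, r)] is the point that lies over the vertex [circuit r] and that
    branch [i] reaches during its winding number [q] around the circuit. *)
Definition unrolled (eta : option nat) (kappa : nat) : Type :=
  (digraph eta kappa + J eta * nat * 'I_kappa.+1)%type.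

Section unrolled.
Context (eta : option nat) (kappa : nat).
Local Notation X := (digraph eta kappa).
Local Notation Y := (unrolled eta kappa).

HB.instance Definition _ := Countable.on Y.
HB.instance Definition _ := isPointed.Build Y (inl (circuit ord0)).
HB.instance Definition _ := @isMeasurable.Build default_measure_display Y
  discrete_measurable discrete_measurable0
  discrete_measurableC discrete_measurableU.

Definition fold_orbit (y : Y) : X :=
  match y with inl x => x | inr (_, _, r) => circuit r end.

Definition advance (y : Y) : Y :=
  match y with
  | inl (circuit r) => inl (circuit (ord_pred r))
  | inl (branch i 0) => inr (i, 0%N, ord_max)
  | inl (branch i j.+1) => inl (branch i j)
  | inr (i, q, r) => if val r is 0 then inr (i, q.+1, ord_max)
                     else inr (i, q, ord_pred r)
  end.

Definition retreat (y : Y) : Y :=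
  match y with
  | inl (circuit r) => inl (circuit (ordS r))
  | inl (branch i j) => inl (branch i j.+1)
  | inr (i, q, r) =>
      if r == ord_max then
        if q is q'.+1 then inr (i, q', ord0) else inl (branch i 0)
      else inr (i, q, ordS r)
  end.

Lemma ord_pred_gt0 (r : 'I_kappa.+1) : (0 < r)%N -> ord_pred r = r.-1 :> nat.
Proof.
case: r => [[|r] rk]//= _; rewrite ?modnDr modn_small//.
exact: ltn_trans rk.
Qed.

Lemma advanceK : cancel advance retreat.
Proof.
move=> [[r|i [|j]]|[[i q] r]] //=.
- by rewrite ord_predK.
- by rewrite eqxx.
- case E: (val r) => [|r'] /=.
    by rewrite eqxx; congr (inr (_, _, _)); apply: val_inj; rewrite /= E.
  have rp : ord_pred r = r' :> nat by rewrite ord_pred_gt0 E.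
  case: eqP => [rm|_]; last by rewrite ord_predK.
  have := ltn_ord r; rewrite E ltnS.
  have : ord_pred r = kappa :> nat by rewrite rm.
  by rewrite rp => ->; rewrite ltnn.
Qed.

Lemma retreatK : cancel retreat advance.
Proof.
move=> [[r|i j]|[[i q] r]] //=.
- by rewrite ordSK.
- case: eqP => [->|rm]; first by case: q.
  have rk : (r < kappa)%N.
    rewrite ltn_neqAle -ltnS ltn_ord andbT; apply/eqP => rk.
    by apply: rm; apply: val_inj.
  have -> : advance (inr (i, q, ordS r)) = inr (i, q, ord_pred (ordS r)).
    by rewrite /advance /= modn_small ?ltnS.
  by rewrite ordSK.
Qed.

Lemma ord_predE (r : 'I_kappa.+1) :
  ord_pred r = if val r is r'.+1 then inord r' else ord_max.
Proof.
apply: val_inj; case E: (val r) => [|r'].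
  by rewrite /= E add0n/= modn_small.
have rp : ord_pred r = r' :> nat by rewrite ord_pred_gt0 E.
have rk : (r' < kappa.+1)%N by apply: ltn_trans (ltn_ord r); rewrite E.
exact: (etrans rp (esym (inordK rk))).
Qed.

Lemma fold_advance y : fold_orbit (advance y) = phi (fold_orbit y).
Proof.
case: y => [[r|i [|j]]|[[i q] r]] //=.
  by rewrite ord_predE; case: r => [[|r'] rk].
by case: r => [[|r'] rk] //=; rewrite ord_predE.
Qed.

Context (R : realType).
Local Notation T := (Y * measurableTypeR R)%type.

(** The first factor is countable and discrete, so measurability is a matter of
    sections. *)
Lemma unrolled_measurable (A : set T) :
  (forall y, measurable [set t | A (y, t)]) -> measurable A.
Proof.
move=> mA.
pose F n := if pickle_inv n is Some y then [set y] `*` [set t | A (y, t)] else set0.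
have -> : A = \bigcup_n F n.
  apply/seteqP; split => [[y t] Ayt|[y t] [n _]].
    by exists (pickle y) => //; rewrite /F pickleK_inv.
  by rewrite /F; case: (pickle_inv n) => // y' [/= ->].
apply: bigcupT_measurable => n; rewrite /F; case: (pickle_inv n) => // y.
exact: measurableX.
Qed.

Lemma unrolled_measurable_fun d' (Z : measurableType d') (f : T -> Z) :
  (forall y, measurable_fun setT (fun t => f (y, t))) -> measurable_fun setT f.
Proof.
move=> mf _ B mB; rewrite setTI; apply: unrolled_measurable => y.
by have := mf y measurableT B mB; rewrite setTI.
Qed.

Lemma measurable_unrolled_pair (y : Y) :
  measurable_fun setT (fun t : measurableTypeR R => (y, t) : T).
Proof. exact: measurable_fun_pair. Qed.

Let leaf (lam : {measure set (measurableTypeR R) -> \bar R}) y :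
    {measure set T -> \bar R} :=
  measure_function_pushforward__canonical__measure_function_Measure lam
    (measurable_unrolled_pair y).

Definition unrolled_measure (lam : Y -> {measure set (measurableTypeR R) -> \bar R}) :
  {measure set T -> \bar R} :=
  csum_measure (fun y => leaf (lam y) y).

End unrolled.

(** * Masses on the unrolled graph *)

(** All the measures involved live on [1, +oo[, where this is the identity;
    truncating makes every weight at least [1] everywhere, so that no inverse
    has to be guarded. *)
Definition max1 (R : realType) (t : measurableTypeR R) : R := Num.max t 1.

Lemma max1_ge1 (R : realType) (t : measurableTypeR R) : 1 <= max1 t.
Proof. by rewrite /max1 le_max lexx orbT. Qed.

Lemma max1_gt0 (R : realType) (t : measurableTypeR R) : 0 < max1 t.
Proof. exact: lt_le_trans (max1_ge1 t). Qed.

Lemma measurable_max1 (R : realType) :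
  measurable_fun [set: measurableTypeR R] (@max1 R).
Proof. by apply: measurable_maxr. Qed.

Lemma integral_unrolled (eta : option nat) (kappa : nat) (R : realType)
    (lam : unrolled eta kappa -> {measure set (measurableTypeR R) -> \bar R})
    (f : unrolled eta kappa * measurableTypeR R -> \bar R) :
  measurable_fun setT f -> (forall x, 0 <= f x)%E ->
  (\int[unrolled_measure lam]_x f x =
   \esum_(y in [set: unrolled eta kappa]) \int[lam y]_t f (y, t))%E.
Proof.
move=> mf f0; rewrite integral_csum_measure//; apply: eq_esum => y _.
by rewrite (ge0_integral_pushforward (measurable_unrolled_pair y))// preimage_setT.
Qed.

(** Used to rule out mass below [1]: there multiplication by a power of [t]
    contracts, whereas the balance equation says that it does not decrease the
    mass. *)
Lemma contraction_eq0 (R : realType) (x : \bar R) (q : R) : (0 <= x)%E ->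
  (x < +oo)%E -> q < 1 -> (x <= q%:E * x)%E -> x = 0%E.
Proof.
case: x => //= x x0 _ q1; rewrite -EFinM lee_fin => xq.
rewrite lee_fin in x0; congr EFin; apply/eqP; rewrite eq_le x0 andbT.
have : (1 - q) * x <= 0 by rewrite mulrBl mul1r subr_le0.
by rewrite pmulr_rle0// subr_gt0.
Qed.

Lemma addeI_fin (R : realDomainType) (x y z : \bar R) : x \is a fin_num ->
  (x + y = x + z)%E -> y = z.
Proof. by move=> xf /(congr1 (fun u => (- x + u)%E)); rewrite !addeA !(addeC (- x)%E) !subee// !add0e. Qed.

Section pivot_measures.
Context (R : realType) (eta : option nat) (kappa : nat).
Variable mu : discrete_measure R eta kappa.
Local Notation borel := {measure set (measurableTypeR R) -> \bar R}.
Variables (p : borel) (l : J eta -> borel).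
Local Open Scope ereal_scope.
Local Notation Rp := (`[0%R, +oo[%classic : set (measurableTypeR R)).
Local Notation Rn := (`]-oo, 0%R[%classic : set (measurableTypeR R)).
Hypothesis p_neg : p Rn = 0.
Hypothesis l_neg : forall i, l i Rn = 0.
Hypothesis p_moment : forall r : 'I_kappa.+1,
  \int[p]_(t in Rp) (t ^+ r)%:E = mu [set circuit r].
Hypothesis l_moment : forall i j,
  \int[l i]_(t in Rp) (t ^+ j)%:E = mu [set branch i j].
Hypothesis p_pivot : forall A : set (measurableTypeR R), measurable A -> A `<=` Rp ->
  \int[p]_(t in A) (t ^+ kappa.+1)%:E = p A + \esum_(i in [set: J eta]) l i A.

Let p_fin A : measurable A -> p A < +oo.
Proof.
move=> mA; apply: (@le_lt_trans _ _ (p setT)); first by rewrite le_measure ?inE.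
have -> : [set: measurableTypeR R] = Rn `|` Rp.
  apply/seteqP; split => // t _ /=; rewrite !in_itv/= andbT.
  by case: (ltP t 0%R); [left|right].
apply: (@le_lt_trans _ _ (p Rn + p Rp)).
  by apply: measureU2.
rewrite p_neg add0e.
have := p_moment ord0; under eq_integral do rewrite expr0.
rewrite integral_cst// mul1e => ->.
by rewrite -ge0_fin_numE// dmeas_fin_num.
Qed.

(* On [0, q] with [q < 1] the balance equation bounds the mass by [q] times
   itself. *)
Let p_lt1_0 : p `]-oo, 1%R[%classic = 0.
Proof.
pose F n : set (measurableTypeR R) := `[0%R, (1 - n.+1%:R^-1)%R]%classic.
have -> : (`]-oo, 1%R[%classic : set (measurableTypeR R)) = Rn `|` \bigcup_n F n.
  apply/seteqP; split => t /=; rewrite !in_itv/=.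
    move=> t1; have [t0|t0] := ltP t 0%R; [by left|right].
    exists (Num.truncn (1 - t)^-1) => //; rewrite /F/= in_itv/= t0/=.
    rewrite lerBrDl -lerBrDr -[leRHS]invrK lef_pV2 ?posrE ?invr_gt0 ?subr_gt0//.
    by rewrite ltW// truncnS_gt.
  move=> [t0|[n _]]; first exact: lt_trans t0 ltr01.
  by rewrite /F/= in_itv/= => /andP[_ /le_lt_trans]; apply; rewrite ltrBlDr ltrDl.
have F0 n : p (F n) = 0.
  set q : R := (1 - n.+1%:R^-1)%R.
  have q0 : (0 <= q)%R by rewrite subr_ge0 invf_le1// ler1n.
  have q1 : (q < 1)%R by rewrite ltrBlDr ltrDl invr_gt0.
  have mF : measurable (F n) by exact: measurable_itv.
  have : p (F n) <= q%:E * p (F n).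
    apply: (@le_trans _ _ (\int[p]_(t in F n) (t ^+ kappa.+1)%:E)).
      rewrite p_pivot//; first by rewrite leeDl// esum_ge0.
      by move=> t; rewrite /F/= !in_itv/= => /andP[-> _].
    rewrite -integral_cst//; apply: ge0_le_integral => //.
    - by move=> t; rewrite /F/= in_itv/= => /andP[t0 _]; rewrite lee_fin exprn_ge0.
    - by apply/measurable_EFinP; exact: measurable_funX.
    - move=> t; rewrite /F/= in_itv/= => /andP[t0 tq]; rewrite lee_fin exprS.
      apply: le_trans (tq); rewrite ler_piMr// exprn_ile1//.
      by rewrite (le_trans tq)// ltW.
  by move=> /(contraction_eq0 (measure_ge0 _ _) (p_fin mF) q1).
have mU : measurable (\bigcup_n F n).
  by apply: bigcupT_measurable => n; exact: measurable_itv.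
apply/negligibleP; first exact: measurableU.
apply: negligibleU; first exact/negligibleP.
apply: negligible_bigcup => n; apply/negligibleP; first exact: measurable_itv.
exact: F0.
Qed.

(* On [0, 1[ the measure [p] vanishes, and at the point [1] both sides of the
   balance equation contain the same mass of [p]; what remains of the branches
   is [0]. *)
Let l_le1_0 i : l i `]-oo, 1%R]%classic = 0.
Proof.
have l0 A : (\esum_(i in [set: J eta]) l i A) = 0 -> l i A = 0.
  move=> s0; apply/eqP; rewrite -measure_le0 -s0 (esumID [set i])//.
  by rewrite setTI esum_set1// leeDl// esum_ge0.
have -> : (`]-oo, 1%R]%classic : set (measurableTypeR R)) =
    Rn `|` (`[0%R, 1%R[%classic `|` [set 1%R]).
  apply/seteqP; split => t /=; rewrite !in_itv/=.
    case: (ltP t 0%R) => t0; [by left|right].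
    by move: H; rewrite le_eqVlt => /orP[/eqP|]; [right|left].
  move=> [t0|[/andP[_ t1]|->//]]; last exact: ltW.
  exact/ltW/(lt_trans t0).
have p01 : p `[0%R, 1%R[%classic = 0.
  apply: (subset_measure0 _ _ _ p_lt1_0) => //; try exact: measurable_itv.
  by move=> t /=; rewrite !in_itv/= => /andP[].
have l01 : l i `[0%R, 1%R[%classic = 0.
  apply: l0; have := @p_pivot `[0%R, 1%R[%classic (measurable_itv _).
  rewrite p01 add0e null_set_integral//; last first.
    by apply/measurable_EFinP; exact: measurable_funX.
  by move=> <- //; move=> t /=; rewrite !in_itv/= => /andP[->].
have l1 : l i [set 1%R] = 0.
  apply: l0; have := @p_pivot [set 1%R] (measurable_set1 _).
  rewrite (eq_integral (cst 1)); last first.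
    by move=> t; rewrite inE => ->; rewrite expr1n.
  rewrite integral_cst// mul1e.
  have p1f : p [set 1%R] \is a fin_num by rewrite ge0_fin_numE// p_fin.
  move=> E; apply: (addeI_fin p1f); rewrite adde0 -E// => t /= ->.
  by rewrite in_itv/= ler01.
apply/negligibleP.
  by apply: measurableU => //; apply: measurableU.
apply: negligibleU; first by apply/negligibleP; [exact: measurable_itv|exact: l_neg].
apply: negligibleU; first by apply/negligibleP; [exact: measurable_itv|].
by apply/negligibleP; [exact: measurable_set1|].
Qed.

Local Open Scope ring_scope.
Local Notation mx := (@max1 R).

Let mmx := @measurable_max1 R.
Let mx_ge1 := @max1_ge1 R.
Let mx_gt0 := @max1_gt0 R.

Let ge0_integral_mx (nu : borel) (f : R -> R) : nu `]-oo, 1%R[%classic = 0%E ->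
  measurable_fun setT f -> (forall t, 0 <= t -> 0 <= f t) ->
  (\int[nu]_t (f (mx t))%:E = \int[nu]_(t in Rp) (f t)%:E)%E.
Proof.
move=> nu0 mf f0.
have mN : measurable (`]-oo, 1%R[%classic : set (measurableTypeR R)) by exact: measurable_itv.
have mRp : measurable Rp by exact: measurable_itv.
rewrite (ge0_negligible_integral mN)//; last 2 first.
- exact/measurable_EFinP/(measurableT_comp mf).
- by move=> t _; rewrite lee_fin f0// ltW.
have -> : setT `\` `]-oo, 1%R[%classic = `[1%R, +oo[%classic :> set (measurableTypeR R).
  by apply/seteqP; split => t /=; rewrite !in_itv/= andbT;
    [move=> [_ /negP]; rewrite -leNgt|move=> t1; split => //; apply/negP; rewrite -leNgt].
have -> : (\int[nu]_(t in Rp) (f t)%:E = \int[nu]_(t in Rp `\` `]-oo, 1%R[%classic) (f t)%:E)%E.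
  apply: ge0_negligible_integral => //.
    by apply/measurable_EFinP; exact: measurable_funTS.
  by move=> t; rewrite /= in_itv/= andbT lee_fin => /f0.
have -> : Rp `\` `]-oo, 1%R[%classic = `[1%R, +oo[%classic :> set (measurableTypeR R).
  apply/seteqP; split => t /=; rewrite !in_itv/= !andbT.
    by move=> [_ /negP]; rewrite -leNgt.
  by move=> t1; split; [exact: le_trans t1|apply/negP; rewrite -leNgt].
apply: eq_integral => t; rewrite inE/= in_itv/= andbT => t1.
by rewrite /max1 max_l.
Qed.

Let l_lt1_0 i : l i `]-oo, 1%R[%classic = 0%E.
Proof.
apply: (subset_measure0 _ _ _ (l_le1_0 i)); try exact: measurable_itv.
by move=> t /=; rewrite !in_itv/=; exact: ltW.
Qed.

Let integral_ge1 (nu : borel) (A : set (measurableTypeR R)) (f : R -> R) :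
  nu `]-oo, 1%R[%classic = 0%E -> measurable A -> measurable_fun setT f ->
  (forall t, 0 <= f t) ->
  (\int[nu]_(t in A) (f t)%:E = \int[nu]_(t in A `\` `]-oo, 1%R[%classic) (f t)%:E)%E.
Proof.
move=> nu0 mA mf f0; apply: ge0_negligible_integral => //.
- by apply/measurable_EFinP; exact: measurable_funTS.
- by move=> t _; rewrite lee_fin.
Qed.

Let measure_ge1 (nu : borel) (A : set (measurableTypeR R)) :
  nu `]-oo, 1%R[%classic = 0%E -> measurable A ->
  nu A = nu (A `\` `]-oo, 1%R[%classic).
Proof.
move=> nu0 mA; have mD : measurable (A `\` `]-oo, 1%R[%classic).
  by apply: measurableD => //; exact: measurable_itv.
rewrite -[LHS]mul1e -[RHS]mul1e -!integral_cst//.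
by apply: (@integral_ge1 nu A (cst 1)).
Qed.

Let mmxX n : measurable_fun [set: measurableTypeR R] (fun t => mx t ^+ n).
Proof. exact: measurable_funX. Qed.

Let mxX_ge0 n t : 0 <= mx t ^+ n. Proof. by rewrite exprn_ge0// ltW. Qed.

(* The balance equation is an equality of measures; here it is integrated. *)
Let integral_pivot (g : R -> R) : measurable_fun [set: measurableTypeR R] g ->
  (forall t, 0 <= g t) ->
  (\int[p]_t (g t * mx t ^+ kappa.+1)%:E =
   \int[p]_t (g t)%:E + \esum_(i in [set: J eta]) \int[l i]_t (g t)%:E)%E.
Proof.
move=> mg g0; have mEg : measurable_fun [set: measurableTypeR R] (EFin \o g).
  exact/measurable_EFinP.
have Eg0 t : (0 <= (EFin \o g) t)%E by rewrite lee_fin.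
transitivity (\int[density p (mmxX kappa.+1) (mxX_ge0 kappa.+1)]_t (EFin \o g) t)%E.
  by rewrite integral_density.
transitivity (\int[measure_add p (csum_measure l)]_t (EFin \o g) t)%E; last first.
  by rewrite ge0_integral_measure_add// integral_csum_measure.
apply: eq_measure_integral => A mA _.
apply: (etrans _ (esym (measure_addE _ _ A))); rewrite csum_measureE.
have mD : measurable (A `\` `]-oo, 1%R[%classic).
  by apply: measurableD => //; exact: measurable_itv.
transitivity (\int[p]_(t in A) (mx t ^+ kappa.+1)%:E)%E; first by [].
rewrite (measure_ge1 p_lt1_0)//.
rewrite (@integral_ge1 p A (fun t => mx t ^+ kappa.+1) p_lt1_0)//; last exact: mmxX.
under eq_esum do rewrite (measure_ge1 (l_lt1_0 _))//.
have Dge1 t : (A `\` `]-oo, 1%R[%classic) t -> 1 <= t.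
  by move=> [_ /=]; rewrite in_itv/= => /negP; rewrite -leNgt.
rewrite -p_pivot//; last first.
  by move=> t /Dge1 t1; rewrite /= in_itv/= andbT (le_trans _ t1).
by apply: eq_integral => t; rewrite inE => /Dge1 t1; rewrite /max1 max_l.
Qed.

Section circuit_mass.
Variable r : 'I_kappa.+1.
(* The density at height [r] of the winding number [q]. *)
Let G q t := mx t ^+ r / mx t ^+ (q * kappa.+1).

Let G_ge0 q t : 0 <= G q t. Proof. by rewrite mulr_ge0// invr_ge0. Qed.

Let mG q : measurable_fun [set: measurableTypeR R] (G q).
Proof.
have -> : G q = fun t => mx t ^+ r * (mx t `^ (-1)) ^+ (q * kappa.+1).
  by apply/funext => t; rewrite powR_inv1 ?ltW// exprVn.
apply: measurable_funM; first exact: mmxX.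
apply: measurable_funX; exact: (measurableT_comp (measurable_powR (-1)) mmx).
Qed.

Let H q := (\int[p]_t (G q t)%:E)%E.
Let S q := (\esum_(i in [set: J eta]) \int[l i]_t (G q.+1 t)%:E)%E.

(* One use of the balance equation unwinds one turn. *)
Let HS q : (H q = H q.+1 + S q)%E.
Proof.
rewrite -integral_pivot//; apply: eq_integral => t _; congr EFin.
rewrite /G mulSn exprD [_ * mx t ^+ _]mulrC invfM [in RHS]mulrCA.
by rewrite mulVKf// gt_eqF// exprn_gt0.
Qed.

Let H0 : H 0%N = mu [set circuit r].
Proof.
rewrite -p_moment -(@ge0_integral_mx p (fun t => t ^+ r) p_lt1_0).
- by apply: eq_integral => t _; rewrite /G mul0n expr0 divr1.
- exact: measurable_funX.
- by move=> t t0; exact: exprn_ge0.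
Qed.

(* The densities tend to [0] where [1 < t] and are equal to [1] elsewhere. *)
Let H_cvg : H @ \oo --> p `]-oo, 1%R]%classic.
Proof.
have mI : measurable (`]-oo, 1%R]%classic : set (measurableTypeR R)).
  exact: measurable_itv.
have -> : p `]-oo, 1%R]%classic = (\int[p]_t (\1_(`]-oo, 1%R]%classic) t)%:E)%E.
  by rewrite integral_indic// setIT.
apply: (@dominated_cvg _ _ _ p setT measurableT (fun q t => (G q t)%:E)
  (fun t => (\1_(`]-oo, 1%R]%classic) t)%:E) (fun t => (mx t ^+ r)%:E)) => //.
- by move=> q; exact/measurable_EFinP.
- move=> t _; apply/cvg_EFin; first exact: nearW.
  rewrite indicE mem_setE in_itv/=; case: (leP t 1) => t1.
    apply: cvg_near_cst; apply: nearW => q.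
    by rewrite /= /G /max1 max_r// !expr1n divr1.
  rewrite (_ : _ \o _ = fun q => mx t ^+ r * ((mx t)^-1 ^+ kappa.+1) ^+ q).
    rewrite -[X in _ --> X](mulr0 (mx t ^+ r)).
    apply: cvgMl_tmp; apply: cvg_expr.
    rewrite ger0_norm ?exprn_ge0 ?invr_ge0 ?(ltW (mx_gt0 _))//.
    rewrite exprn_ilt1 ?invr_ge0 ?(ltW (mx_gt0 _))// invf_lt1//.
    by rewrite /max1 lt_max t1.
  by apply/funext => q /=; rewrite /G -exprM exprVn mulnC.
- apply/integrableP; split; first exact/measurable_EFinP.
  under eq_integral do rewrite /= ger0_norm//.
  rewrite (_ : (\int[p]_t (mx t ^+ r)%:E)%E = H 0%N).
    by rewrite H0 -ge0_fin_numE// dmeas_fin_num.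
  by apply: eq_integral => t _; rewrite /G mul0n expr0 divr1.
- move=> q t _; rewrite /= ger0_norm// lee_fin /G ler_piMr// invf_le1.
    exact: exprn_ege1.
  by rewrite exprn_gt0.
Qed.

(** Unwinding for ever: the mass of a circuit vertex is the sum of the masses
    that the branches leave over it at each of their turns, plus the mass of [p]
    at [1]. *)
Lemma circuit_mass : (p `]-oo, 1%R]%classic +
  \esum_(i in [set: J eta]) \esum_(q in [set: nat]) \int[l i]_t (G q.+1 t)%:E =
  mu [set circuit r])%E.
Proof.
have S0 q : (0 <= S q)%E.
  by apply: esum_ge0 => i _; apply: integral_ge0 => t _; rewrite lee_fin.
have HK K : (mu [set circuit r] = H K + \sum_(0 <= q < K) S q)%E.
  elim: K => [|K IH]; first by rewrite big_nil adde0 H0.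
  by rewrite IH HS big_nat_recr//= -addeA (addeC (S K)).
rewrite esum_exchange; last first.
  by move=> i q; apply: integral_ge0 => t _; rewrite lee_fin.
rewrite -(@nneseries_esumT _ S)//.
have : (fun K => H K + \sum_(0 <= q < K) S q)%E @ \oo -->
    (p `]-oo, 1%R]%classic + \sum_(q <oo) S q)%E.
  apply: cvgeD => //; last exact: is_cvg_ereal_nneg_natsum.
  by apply: ge0_adde_def; rewrite !inE// nneseries_ge0.
under eq_fun do rewrite -HK.
by move/(cvg_unique _ (cvg_cst _)) => ->.
Qed.

End circuit_mass.

Lemma branch_mass i j : (\int[l i]_t (mx t ^+ j)%:E = mu [set branch i j])%E.
Proof.
rewrite -l_moment -(@ge0_integral_mx (l i) (fun t => t ^+ j) (l_lt1_0 i))//.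
by move=> t t0; exact: exprn_ge0.
Qed.

End pivot_measures.

(** * The isometric lift *)

Section dilation.
Context (R : realType) (eta : option nat) (kappa : nat).
Local Notation borel := {measure set (measurableTypeR R) -> \bar R}.
Local Notation Y := (unrolled eta kappa).
Local Notation T := (Y * measurableTypeR R)%type.
Local Notation normc := Normc.normc.
Variables (p : borel) (l : J eta -> borel).

Definition sqrtm (t : measurableTypeR R) : R := Num.sqrt (max1 t).

Lemma sqrtm_ge1 t : 1 <= sqrtm t.
Proof. by rewrite -sqrtr1 ler_wsqrtr// max1_ge1. Qed.

Lemma sqrtm_neq0 t : sqrtm t != 0.
Proof. by rewrite gt_eqF// (lt_le_trans _ (sqrtm_ge1 t)). Qed.

Lemma sqr_sqrtm t : sqrtm t ^+ 2 = max1 t.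
Proof. by rewrite sqr_sqrtr// ltW// max1_gt0. Qed.

Lemma measurable_sqrtm : measurable_fun [set: measurableTypeR R] sqrtm.
Proof.
have -> : sqrtm = fun t => max1 t `^ 2^-1.
  by apply/funext => t; rewrite powR12_sqrt// ltW// max1_gt0.
exact: (measurableT_comp (measurable_powR 2^-1) (@measurable_max1 R)).
Qed.

(** The mass of [p] below [1] vanishes, so its restriction to ]-oo, 1] is the
    atom at [1]. *)
Definition fiber (y : Y) : borel :=
  match y with
  | inl (circuit _) =>
      mrestr p (measurable_itv `]-oo, (1 : R)] : measurable (_ : set (measurableTypeR R)))
  | inl (branch i _) => l i
  | inr (i, _, _) => l i
  end.

(** The exponent of [sqrtm t] is the number of steps to the start [branch i 0]
    of branch [i], counted negatively past it. *)
Definition weight (y : Y) (t : measurableTypeR R) : R :=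
  match y with
  | inl (circuit _) => 1
  | inl (branch _ j) => sqrtm t ^+ j
  | inr (_, q, r) => sqrtm t ^+ r / sqrtm t ^+ (q.+1 * kappa.+1)
  end.

(** [weight] grows by this factor along one step backwards; it depends on the
    line only, hence it is invariant under the flow. *)
Definition growth (x : T) : R := if x.1 is inl (circuit _) then 1 else sqrtm x.2.

Definition flow (s : Y -> Y) (x : T) : T := (s x.1, x.2).

Lemma fiber_advance y : fiber (advance y) = fiber y.
Proof. by case: y => [[r|i [|j]]|[[i q] [[|r] rk]]]. Qed.

Lemma growth_advance x : growth (flow (@advance _ _) x) = growth x.
Proof. by case: x => [[[r|i [|j]]|[[i q] [[|r] rk]]] t]. Qed.

Lemma weight_advance y t : growth (y, t) * weight (advance y) t = weight y t.
Proof.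
have n0 k : sqrtm t ^+ k != 0 by rewrite expf_neq0// sqrtm_neq0.
case: y => [[r|i [|j]]|[[i q] r]]; rewrite /growth/=.
- by rewrite mulr1.
- by rewrite mul1n mulrA -exprS divff.
- by rewrite -exprS.
- case: r => [[|r] rk] /=.
    by rewrite expr0 mul1r mulrA -exprS mulSn exprD invfM mulrA divff// mul1r.
  have -> : ((r + kappa.+1) %% kappa.+1 = r)%N.
    by rewrite modnDr modn_small// (ltn_trans _ rk).
  by rewrite mulrA -exprS.
Qed.

Lemma flow_measure_preserving (s s' : Y -> Y) : cancel s s' -> cancel s' s ->
  (forall y, fiber (s y) = fiber y) ->
  measure_preserving (unrolled_measure fiber) (flow s).
Proof.
move=> sK s'K sf; split.
  by apply: unrolled_measurable_fun => y; exact: (measurable_unrolled_pair (s y)).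
move=> A mA; rewrite !csum_measureE.
rewrite [RHS](@reindex_esum _ _ _ [set: Y] _ s).
  by apply: eq_esum => y _; rewrite /= /pushforward/= sf.
split => // [x y _ _ /(can_inj sK)//|y _].
by exists (s' y).
Qed.

Variable mu : discrete_measure R eta kappa.
Hypothesis circuit_mass : forall r : 'I_kappa.+1,
  (p `]-oo, 1%R]%classic + \esum_(i in [set: J eta]) \esum_(q in [set: nat])
    \int[l i]_t (max1 t ^+ r / max1 t ^+ (q.+1 * kappa.+1))%:E =
  mu [set circuit r])%E.
Hypothesis branch_mass : forall i j,
  (\int[l i]_t (max1 t ^+ j)%:E = mu [set branch i j])%E.

Local Notation m := (unrolled_measure fiber).

Let lift (f : L2 mu) (x : T) : R[i] := (weight x.1 x.2)%:C * f (fold_orbit x.1).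

Let measurable_weight y : measurable_fun setT (weight y).
Proof.
case: y => [[r|i j]|[[i q] r]]; rewrite /weight/=.
- exact: measurable_cst.
- by apply: measurable_funX; exact: measurable_sqrtm.
- apply: measurable_funM; first by apply: measurable_funX; exact: measurable_sqrtm.
  rewrite (_ : (fun t => _) = fun t => (sqrtm t `^ (-1)) ^+ (q.+1 * kappa.+1)).
    apply: measurable_funX.
    exact: (measurableT_comp (measurable_powR (-1)) measurable_sqrtm).
  by apply/funext => t; rewrite powR_inv1 ?exprVn// (le_trans ler01)// sqrtm_ge1.
Qed.

Let lift_cmeasurable f : cmeasurable (lift f).
Proof.
have mf y : cmeasurable (fun t => lift f (y, t)).
  apply: (@cmeasurableM _ _ _ (fun t => (weight y t)%:C) (fun=> f (fold_orbit y))).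
    by apply: cmeasurable_real; exact: measurable_weight.
  exact: cmeasurable_cst.
by split; apply: unrolled_measurable_fun => y; [exact: (mf y).1|exact: (mf y).2].
Qed.

Let mass (y : Y) : \bar R := (\int[fiber y]_t (weight y t ^+ 2)%:E)%E.

Let mass_ge0 y : (0 <= mass y)%E.
Proof. by apply: integral_ge0 => t _; rewrite lee_fin sqr_ge0. Qed.

Let mass_circuit r : mass (inl (circuit r)) = p `]-oo, 1%R]%classic.
Proof.
rewrite /mass/=; under eq_integral do rewrite expr1n.
by rewrite integral_cst// mul1e -[LHS]/(p (setT `&` `]-oo, 1%R]%classic)) setTI.
Qed.

Let mass_branch i j : mass (inl (branch i j)) = mu [set branch i j].
Proof.
rewrite -branch_mass; apply: eq_integral => t _.
by rewrite /= -exprM mulnC exprM sqr_sqrtm.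
Qed.

Let mass_inr i q r : mass (inr (i, q, r)) =
  (\int[l i]_t (max1 t ^+ r / max1 t ^+ (q.+1 * kappa.+1))%:E)%E.
Proof.
apply: eq_integral => t _.
have e n : (sqrtm t ^+ n) ^+ 2 = max1 t ^+ n by rewrite -exprM mulnC exprM sqr_sqrtm.
by rewrite /= exprMn exprVn !e.
Qed.

(* Over each vertex the masses of the fibers, weighted by [weight ^ 2], add up
   to the mass of the vertex: for branch vertices there is one fiber, and for
   circuit vertices this is [circuit_mass]. *)
Let integral_lift (f : L2 mu) :
  (\int[m]_x (normc (lift f x) ^+ 2)%:E = \int[mu]_x (normc (f x) ^+ 2)%:E)%E.
Proof.
rewrite integral_unrolled; last 2 first.
- exact/measurable_EFinP/measurable_normc2/lift_cmeasurable.
- by move=> x; rewrite lee_fin sqr_ge0.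
rewrite integral_digraph; last by move=> x; rewrite lee_fin sqr_ge0.
pose F x := (normc (f x) ^+ 2)%:E.
have F0 x : (0 <= F x)%E by rewrite lee_fin sqr_ge0.
transitivity (\esum_(y in [set: Y]) (F (fold_orbit y) * mass y))%E.
  apply: eq_esum => y _.
  rewrite -ge0_integralZl//.
  - apply: eq_integral => t _; rewrite -EFinM; congr EFin.
    by rewrite /lift/= Normc.normcM exprMn normc_real mulrC.
  - by apply/measurable_EFinP/measurable_funX; exact: measurable_weight.
  - by move=> t _; rewrite lee_fin sqr_ge0.
have g0 y : (0 <= F (fold_orbit y) * mass y)%E by exact: mule_ge0 (F0 _) (mass_ge0 _).
have h0 x : (0 <= F x * mu [set x])%E by exact: mule_ge0 (F0 _) (measure_ge0 _ _).
have winding : (\esum_(b in [set: J eta * nat * 'I_kappa.+1])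
      (F (fold_orbit (inr b)) * mass (inr b)) =
    \esum_(r in [set: 'I_kappa.+1]) \esum_(iq in [set: J eta * nat])
      (F (circuit r) * mass (inr (iq, r))))%E.
  rewrite -esum_exchange; last by move=> [i q] r; exact: (g0 (inr (i, q, r))).
  rewrite -esum_pair; last by move=> [i q] r; exact: (g0 (inr (i, q, r))).
  by apply: eq_esum => -[[i q] r] _.
rewrite esum_sum_type// winding.
rewrite (esum_digraph (fun x => g0 (inl x))) (esum_digraph h0)/=.
rewrite addeAC; congr (_ + _)%E; last first.
  by apply: eq_esum => i _; apply: eq_esum => j _; rewrite mass_branch.
rewrite -esumD; last 2 first.
- by move=> r _; exact: (g0 (inl (circuit r))).
- by move=> r _; apply: esum_ge0 => -[i q] _; exact: (g0 (inr (i, q, r))).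
apply: eq_esum => r _; rewrite -circuit_mass -(mass_circuit r).
rewrite ge0_esumZl// -ge0_muleDr//; last exact: esum_ge0.
congr (_ * (_ + _))%E.
transitivity (\esum_(i in [set: J eta]) \esum_(q in [set: nat]) mass (inr (i, q, r))).
  by rewrite -esum_pair//; apply: eq_esum => -[].
by apply: eq_esum => i _; apply: eq_esum => q _; rewrite mass_inr.
Qed.

(** The lift is constant over each vertex up to [weight], and [weight] is chosen
    such that composition with [phi] becomes multiplication by [growth] after
    the flow. *)
Lemma dilation_exists : exists V : {linear L2 mu -> Lsq m},
  (forall f g, inner (V f) (V g) = inner f g) /\
  forall f g, comp_op mu (f, g) -> wcomp growth (flow (@advance _ _)) (V f, V g).
Proof.
have lI f : sqintegrable m (lift f).
  by split; [exact: lift_cmeasurable|rewrite integral_lift; exact: L2_fin].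
pose V0 (f : L2 mu) : Lsq m := cls (mksq (lI f)).
have Vlin : linear V0.
  move=> a f g; rewrite /V0 cls_lincomb; apply/Lsq_eqP; apply: aeW => x.
  rewrite sqfD sqfZ/= /lift.
  by rewrite (_ : (a *: f + g) _ = a * f (fold_orbit x.1) + g (fold_orbit x.1))//
     mulrDr mulrCA.
pose V : {linear L2 mu -> Lsq m} :=
  HB.pack V0 (GRing.isLinear.Build R[i] (L2 mu) (Lsq m) *:%R V0 Vlin).
have PP := flow_measure_preserving (@advanceK _ _) (@retreatK _ _) fiber_advance.
exists V; split.
  apply: isometry_inner => f.
  change (Lsq_inner (V0 f) (V0 f) = L2_inner f f).
  rewrite Lsq_inner_pi sqinner_sqnorm; last exact: sqf_sqintegrable.
  rewrite L2_inner_sqnorm; congr (_%:C).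
  by rewrite /sqnorm /L2_sqnorm /Rintegral integral_lift.
move=> f g fg.
apply: filterS2 (repr_ae (mksq (lI g))) (mp_ae PP (repr_ae (mksq (lI f)))).
move=> [y t] /= -> ->; rewrite /lift/= fold_advance -fg.
by rewrite mulrA -rmorphM weight_advance.
Qed.

End dilation.

(** * Preimages under the iterates of phi *)

Section backward_orbits.
Context (eta : option nat) (kappa : nat).
Local Notation X := (digraph eta kappa).
Local Notation phi := (@phi eta kappa).

Lemma phi_eq_branch (x : X) i j : phi x = branch i j <-> x = branch i j.+1.
Proof.
split=> [|->//]; case: x => [[[|r] rk]|i' [|j']] //=.
by move=> [-> ->].
Qed.

Lemma phi_eq_circuit (x : X) (r : 'I_kappa.+1) : (r < kappa)%N ->
  phi x = circuit r <-> x = circuit (inord r.+1).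
Proof.
move=> rk; split=> [|->]; last first.
  by rewrite /= inordK// inord_val.
case: x => [[[|s] sk]|i' [|j']] //=.
- by move=> [rE]; move: rk; rewrite -rE ltnn.
- move=> [rE]; congr circuit; apply: val_inj => /=; rewrite -rE.
  by rewrite !inordK// (ltn_trans _ sk).
- by move=> [rE]; move: rk; rewrite -rE ltnn.
Qed.

Lemma phi_eq_top (x : X) : phi x = circuit ord_max <->
  x = circuit ord0 \/ exists i, x = branch i 0.
Proof.
split=> [|[->//|[i ->]//]].
case: x => [[[|s] sk]|i' [|j']] //=.
- by move=> _; left; congr circuit; exact: val_inj.
- move=> [] /(congr1 val); rewrite /= inordK; last exact: ltn_trans sk.
  by move=> sE; exfalso; move: sk; rewrite sE ltnn.
- by move=> _; right; exists i'.
Qed.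

Lemma iter_eq_branch n (x : X) i : iter n phi x = branch i 0 <-> x = branch i n.
Proof.
elim: n x => [//|n IH] x; rewrite iterSr; split.
  by move=> /IH/phi_eq_branch.
by move=> /phi_eq_branch/IH.
Qed.

Lemma iter_eq_root r (x : X) : (r <= kappa)%N ->
  iter r phi x = circuit ord0 <-> x = circuit (inord r).
Proof.
elim: r x => [|r IH] x rk.
  by rewrite (_ : inord 0 = ord0)//; apply: val_inj; rewrite /= inordK.
rewrite iterSr; have rk1 : (inord r : 'I_kappa.+1) = r :> nat by rewrite inordK// ltnW.
split.
  move=> /(IH _ (ltnW rk)) /phi_eq_circuit; rewrite rk1; exact.
move=> xE; apply/(IH _ (ltnW rk)); apply/phi_eq_circuit; rewrite rk1//.
Qed.

(** A path of length [n + kappa + 1] that ends at the root makes its last turn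
    around the circuit from the top vertex, which is entered from the root or
    from a branch. *)
Lemma iter_eq_root_loop n (x : X) : iter (n + kappa.+1) phi x = circuit ord0 <->
  iter n phi x = circuit ord0 \/ exists i, x = branch i n.
Proof.
rewrite addnC iterD iterSr; split.
  move=> /(iter_eq_root _ (leqnn _)); rewrite (_ : inord kappa = ord_max); last first.
    by apply: val_inj; rewrite /= inordK.
  move=> /phi_eq_top[->|[i /iter_eq_branch ->]]; [by left|by right; exists i].
move=> h; apply/(iter_eq_root _ (leqnn _)); rewrite (_ : inord kappa = ord_max); last first.
  by apply: val_inj; rewrite /= inordK.
apply/phi_eq_top; case: h => [|[i ->]]; [by left|right; exists i].
exact/iter_eq_branch.
Qed.

End backward_orbits.

Section hphi_values.
Context (R : realType) (eta : option nat) (kappa : nat).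
Variable mu : discrete_measure R eta kappa.
Local Notation X := (digraph eta kappa).
Local Notation phi := (@phi eta kappa).
Local Notation x0 := (circuit ord0 : X).
Local Open Scope ereal_scope.

Lemma hphi_mulE n x : mu (iter n phi @^-1` [set x]) = hphi mu n x * mu [set x].
Proof.
rewrite /hphi -muleA (muleC (_^-1)).
have muf := dmeas_fin_num mu x; have mu0 := dmeas_gt0 mu x.
by rewrite divee ?mule1// gt_eqF.
Qed.

Lemma mu_branch n i : mu [set branch i n] = hphi mu n (branch i 0) * mu [set branch i 0].
Proof.
rewrite -hphi_mulE; congr (mu _); apply/seteqP.
by split => x /=; [move=> ->; apply/iter_eq_branch|move/iter_eq_branch].
Qed.

Lemma mu_circuit (r : 'I_kappa.+1) : mu [set circuit r] = hphi mu r x0 * mu [set x0].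
Proof.
rewrite -hphi_mulE; congr (mu _); apply/seteqP; split => x /=.
  by move=> ->; apply/iter_eq_root; rewrite ?inord_val// -ltnS.
by move=> /iter_eq_root; rewrite inord_val; apply; rewrite -ltnS.
Qed.

Lemma measure_branches n : mu [set x | exists i, x = branch i n] =
  \esum_(i in [set: J eta]) mu [set branch i n].
Proof.
pose F k := if pickle_inv k is Some i then [set branch i n] else set0 : set X.
have -> : [set x | exists i, x = branch i n] = \bigcup_k F k.
  apply/seteqP; split => [_ [i ->]|x [k _]]; rewrite /F.
    by exists (pickle i) => //; rewrite pickleK_inv.
  by case: (pickle_inv k) => // i /= ->; exists i.
rewrite measure_bigcup//; last first.
  apply/trivIsetP => i j _ _ ij; apply/seteqP; split => // x [Fi Fj].
  move: Fi Fj; rewrite /F; case Ei: (pickle_inv i) => [a|//].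
  case Ej: (pickle_inv j) => [b|//] /= -> [ab].
  move: ij; have := @pickle_invK (J eta) i; have := @pickle_invK (J eta) j.
  by rewrite Ei Ej /= ab => <- <-; rewrite eqxx.
rewrite -nneseries_pickle// [LHS]eseries_mkcond; apply: eq_eseriesr => k _.
rewrite in_setT /F.
by case: (pickle_inv k).
Qed.

(** The combinatorial source of the balance equation. *)
Lemma hphi_loop n : hphi mu (n + kappa.+1) x0 * mu [set x0] =
  hphi mu n x0 * mu [set x0] +
  \esum_(i in [set: J eta]) hphi mu n (branch i 0) * mu [set branch i 0].
Proof.
rewrite -!hphi_mulE.
under eq_esum do rewrite -mu_branch.
rewrite -measure_branches -measureU//; last first.
  apply/seteqP; split => // x [/= xn [i xE]]; move: xn; rewrite xE.
  have : iter n phi (branch i n) = branch i 0 by apply/iter_eq_branch.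
  by move=> ->.
congr (mu _); apply/seteqP; split => x /=.
  by move=> /iter_eq_root_loop[]; [left|right].
by move=> h; apply/iter_eq_root_loop; case: h; [left|right].
Qed.

Lemma preimage_phi_fin : hphi mu kappa.+1 x0 < +oo ->
  forall x, mu (phi @^-1` [set x]) < +oo.
Proof.
move=> h x.
have fin1 y : mu [set y] < +oo by rewrite -ge0_fin_numE// dmeas_fin_num.
case: x => [r|i j]; last first.
  rewrite (_ : _ @^-1` _ = [set branch i j.+1])//.
  by apply/seteqP; split => y /=; [move/phi_eq_branch|move=> ->].
have [rk|rk] := ltnP r kappa.
  rewrite (_ : _ @^-1` _ = [set circuit (inord r.+1)])//.
  apply/seteqP; split => y /=; first by move/(phi_eq_circuit _ rk).
  by move=> yE; apply/(phi_eq_circuit _ rk).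
rewrite (_ : _ @^-1` _ = iter kappa.+1 phi @^-1` [set x0]).
  rewrite hphi_mulE; apply: lte_mul_pinfty => //.
    by rewrite /hphi; rewrite mule_ge0// inve_ge0.
  by rewrite ge0_fin_numE// /hphi mule_ge0// inve_ge0.
have -> : r = ord_max by apply: val_inj; apply/eqP; rewrite eqn_leq rk -ltnS ltn_ord.
have E := @iter_eq_root_loop eta kappa 0.
apply/seteqP; split => y yP; first by apply/(E y)/phi_eq_top.
by apply/phi_eq_top/(E y).
Qed.

End hphi_values.

(** * Density of the domain *)

Section density_of_domain.
Context (R : realType) (eta : option nat) (kappa : nat).
Variable mu : discrete_measure R eta kappa.
Local Notation X := (digraph eta kappa).
Local Notation normc := Normc.normc.
Hypothesis preimage_fin : forall x, (mu (@phi eta kappa @^-1` [set x]) < +oo)%E.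

(* Functions of finite support belong to the domain as soon as the preimages of
   points have finite mass. *)
Let trunc (f : L2 mu) n (x : X) : R[i] := if (pickle x < n)%N then f x else 0.

Let normc_trunc f n x : normc (trunc f n x) ^+ 2 <= normc (f x) ^+ 2.
Proof.
by rewrite /trunc; case: ifP => // _; rewrite Normc.normc0 expr0n/= sqr_ge0.
Qed.

Let truncI f n : trunc f n \in sqint mu.
Proof.
exact: (@sqint_le _ _ _ mu _ (fun x => normc (f x) ^+ 2) (normc_trunc f n) (L2_fin f)).
Qed.

Let trunc_dom f n : op_dom (comp_op mu) (MkL2 (truncI f n)).
Proof.
apply/comp_op_dom.
pose c k x : \bar R := (if pickle_inv k is Some y then
  ((normc (f y) ^+ 2)%:E * (\1_(@phi eta kappa @^-1` [set y]) x)%:E)%E else 0%E).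
have c0 k x : (0 <= c k x)%E.
  by rewrite /c; case: (pickle_inv k) => // y; rewrite mule_ge0// lee_fin ?sqr_ge0.
have le_c x : ((normc (trunc f n (phi x)) ^+ 2)%:E <= \sum_(k < n) c k x)%E.
  rewrite /trunc; case: ifP => xn; last first.
    by rewrite Normc.normc0 expr0n/= sume_ge0.
  rewrite (bigD1 (Ordinal xn))//= {1}/c pickleK_inv indicE mem_set// mule1.
  by rewrite leeDl// sume_ge0.
rewrite inE/=.
apply: (@le_lt_trans _ _ (\int[mu]_x (\sum_(k < n) c k x))%E).
  apply: ge0_le_integral => //.
  - by move=> x _; rewrite lee_fin sqr_ge0.
rewrite ge0_integral_sum//.
apply: lte_sum_pinfty => k _; rewrite /c; case: (pickle_inv k) => [y|].
  rewrite ge0_integralZl//; last by rewrite lee_fin sqr_ge0.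
  rewrite integral_indic// setIT; apply: lte_mul_pinfty => //.
  by rewrite lee_fin sqr_ge0.
by rewrite integral0 ltry.
Qed.

Lemma comp_op_dense : densely_defined (comp_op mu).
Proof.
apply: dense_approx => f e e0.
suff [n fn] : exists n, `|f - MkL2 (truncI f n)| < e%:C.
  by exists (MkL2 (truncI f n)) => //; exact: trunc_dom.
pose h n x := (normc (f x - trunc f n x) ^+ 2)%:E.
have hx n x : (h n x <= (normc (f x) ^+ 2)%:E)%E.
  rewrite lee_fin /trunc; case: ifP => _; last by rewrite subr0.
  by rewrite subrr Normc.normc0 expr0n/= sqr_ge0.
have : (\int[mu]_x h n x)%E @[n --> \oo] --> (\int[mu]_x (cst 0 x))%E.
  apply: (@dominated_cvg _ _ _ mu setT measurableT h (cst 0%E)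
    (fun x => (normc (f x) ^+ 2)%:E)) => //.
  - move=> x _; apply/cvg_EFin; first exact: nearW.
    apply: cvg_near_cst; near=> n.
    rewrite /= /h /trunc ifT ?subrr ?Normc.normc0 ?expr0n//.
    by near: n; exists (pickle x).+1.
  - exact: L2_integrable_sq.
  - by move=> n x _; rewrite gee0_abs ?hx// lee_fin sqr_ge0.
rewrite integral0 => /fine_cvgP[hfin h00].
have /= h1 := @cvgr_lt _ _ _ _ _ _ h00 ((e / 2) ^+ 2) _.
have : \forall n \near \oo, (\int[mu]_x h n x < ((e / 2) ^+ 2)%:E)%E.
  near=> n; rewrite -[X in (X < _)%E]fineK; first by rewrite lte_fin; near: n; apply: h1;
    rewrite exprn_gt0// divr_gt0.
  by near: n.
move=> [n _ /(_ n (leqnn n)) hn]; exists n.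
apply: (@le_lt_trans _ _ (e / 2)%:C); last by rewrite ltcR; lra.
rewrite L2_norm_le ?divr_ge0 ?(ltW e0)//; rewrite -lee_fin -L2_sqnormE.
exact: ltW hn.
Unshelve. all: by end_near. Qed.

End density_of_domain.

(** * Balanced representing measures *)

Section balance.
Context (R : realType) (eta : option nat) (kappa : nat).
Variable mu : discrete_measure R eta kappa.
Local Notation borel := {measure set (measurableTypeR R) -> \bar R}.
Local Notation x0 := (circuit ord0 : digraph eta kappa).
Local Open Scope ereal_scope.
Local Notation Rp := (`[0%R, +oo[%classic : set (measurableTypeR R)).

(** At the level of [n]-th moments this is [hphi_loop]; the content is that it
    holds for the measures themselves. *)
Definition balanced (P : borel) (Q : J eta -> borel) :=
  forall A : set (measurableTypeR R), measurable A -> A `<=` Rp ->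
  \int[P]_(t in A) (t ^+ kappa.+1)%:E =
  P A + \esum_(i in [set: J eta]) mu [set branch i 0%N] / mu [set x0] * Q i A.

Theorem subnormal_of_balanced (P : borel) (Q : J eta -> borel) :
  S_representing (fun n => hphi mu n x0) P ->
  (forall i, S_representing (fun n => hphi mu n (branch i 0)) (Q i)) ->
  balanced P Q -> op_subnormal (comp_op mu).
Proof.
move=> [P0 Pm] QS PQ.
have mRp : measurable Rp by exact: measurable_itv.
have mXp n : measurable_fun Rp (fun t => (t ^+ n)%:E).
  by apply/measurable_EFinP; exact: measurable_funTS.
have Xp0 n t : Rp t -> 0 <= (t ^+ n)%:E.
  by rewrite /= in_itv/= andbT lee_fin => t0; exact: exprn_ge0.
pose c x : {nonneg R} := NngNum (fine_ge0 (measure_ge0 mu [set x])).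
have cE x : (fine (mu [set x]))%:E = mu [set x] by rewrite fineK// dmeas_fin_num.
have scaleI x (nu : borel) (A : set (measurableTypeR R)) n : measurable A -> A `<=` Rp ->
    \int[mscale (c x) nu]_(t in A) (t ^+ n)%:E =
    mu [set x] * \int[nu]_(t in A) (t ^+ n)%:E.
  move=> mA AR; rewrite ge0_integral_mscale//.
  - by congr (_ * _); exact: cE.
  - by apply/measurable_EFinP; exact: measurable_funTS.
  - by move=> t /AR; exact: Xp0.
have scaleE x (nu : borel) A : mscale (c x) nu A = mu [set x] * nu A.
  by rewrite -cE.
pose p : borel := mscale (c x0) P.
pose l i : borel := mscale (c (branch i 0)) (Q i).
have pE A : p A = mu [set x0] * P A by exact: scaleE.
have lE i A : l i A = mu [set branch i 0%N] * Q i A by exact: scaleE.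
have p_moment (r : 'I_kappa.+1) : \int[p]_(t in Rp) (t ^+ r)%:E = mu [set circuit r].
  by rewrite scaleI// mu_circuit muleC; congr (_ * _); exact/esym/(Pm _).2.
have l_moment i j : \int[l i]_(t in Rp) (t ^+ j)%:E = mu [set branch i j].
  by rewrite scaleI// mu_branch muleC; congr (_ * _); exact/esym/((QS i).2 _).2.
have p_neg : p `]-oo, 0%R[%classic = 0 by rewrite pE P0 mule0.
have l_neg i : l i `]-oo, 0%R[%classic = 0 by rewrite lE (QS i).1 mule0.
have p_pivot (A : set (measurableTypeR R)) : measurable A -> A `<=` Rp ->
    \int[p]_(t in A) (t ^+ kappa.+1)%:E = p A + \esum_(i in [set: J eta]) l i A.
  move=> mA AR; rewrite scaleI// PQ//.
  have cQ0 i : 0 <= mu [set branch i 0%N] / mu [set x0] * Q i A.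
    by rewrite !mule_ge0// inve_ge0.
  rewrite ge0_muleDr//; last by apply: esum_ge0 => i _.
  rewrite pE; congr (_ + _); rewrite -ge0_esumZl//; last exact: dmeas_fin_num.
  have mu0V : mu [set x0] / mu [set x0] = 1.
    have muf := dmeas_fin_num mu x0; have mu0 := dmeas_gt0 mu x0.
    by rewrite divee// gt_eqF.
  by apply: eq_esum => i _; rewrite lE muleA muleCA mu0V mule1.
have gfin : hphi mu kappa.+1 x0 < +oo.
  by have := (Pm kappa.+1).1; rewrite fin_numE => /andP[_]; rewrite -ltey.
split.
- exact: comp_op_is_operator.
- apply: comp_op_dense; exact: preimage_phi_fin.
have [V [Viso VN]] := dilation_exists (circuit_mass p_neg l_neg p_moment p_pivot)
  (branch_mass p_neg l_neg p_moment l_moment p_pivot).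
exists (Lsq (unrolled_measure (fiber p l) : {measure set (unrolled eta kappa * measurableTypeR R) -> \bar R})), V,
  (wcomp (growth (kappa := kappa)) (flow (@advance eta kappa))).
split => //.
apply: (@wcomp_normal _ _ _ _ _ _ _ _ (flow (@retreat _ _))).
- apply: unrolled_measurable_fun => -[[r|i j]|[[i q] r]]; rewrite /growth/=;
    try exact: measurable_sqrtm; exact: measurable_cst.
- move=> [[[r|i j]|[[i q] r]] t]; rewrite /growth/= ?ler01//;
  by rewrite (le_trans ler01)// sqrtm_ge1.
- exact: flow_measure_preserving (@advanceK _ _) (@retreatK _ _) (fiber_advance _ _).
- apply: flow_measure_preserving (@retreatK _ _) (@advanceK _ _) _ => y.
  by rewrite -[in RHS](retreatK y) fiber_advance.
- by move=> [y t]; rewrite /flow/= advanceK.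
- by move=> [y t]; rewrite /flow/= retreatK.
- exact: growth_advance.
Qed.

End balance.

(** * Carleman's inequality *)

Section carleman_inequality.
Context (R : realType).
Implicit Types (r c : nat -> R).

Lemma fact_ge_expn n : (n%:R / expR 1) ^+ n <= n`!%:R :> R.
Proof.
case: n => [|n]; first by rewrite expr0 fact0.
have := @expR_ge1Dxn R n.+1%:R n (ler0n _ _).
rewrite -[in expR _](mulr1 n.+1%:R) expRM_natl => h.
rewrite exprMn exprVn ler_pdivrMr ?exprn_gt0 ?expR_gt0//.
rewrite mulrC -ler_pdivrMr ?ltr0n ?fact_gt0//.
by apply: le_trans h; rewrite lerDr.
Qed.

(** Arithmetic--geometric mean for the products [k.+1 * r k]; the factor [n`!]
    that they bring in is at least [(n / e) ^ n]. *)
Lemma carleman_mean r (c : R) n : (0 < n)%N -> (forall k, 0 <= r k) -> 0 <= c ->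
  c ^+ n <= \prod_(k < n) r k ->
  c <= expR 1 * ((\sum_(k < n) k.+1%:R * r k) / n%:R ^+ 2).
Proof.
move=> n0 r0 c0 cn; set S := \sum_(k < n) _.
have S0 : 0 <= S by apply: sumr_ge0 => k _; rewrite mulr_ge0.
have n0R : 0 < n%:R :> R by rewrite ltr0n.
have amgm : \prod_(k < n) (k.+1%:R * r k) <= (S / n%:R) ^+ n.
  have := @leif_AGM R 'I_n predT (fun k => k.+1%:R * r k).
  rewrite card_ord; case=> [k _|+ _]; first by rewrite mulr_ge0.
  by [].
have : (n%:R * c / expR 1) ^+ n <= (S / n%:R) ^+ n.
  apply: le_trans amgm; rewrite big_split/= -natr_prod.
  rewrite (_ : (\prod_(i < n) i.+1)%N = n`!); last first.
    by rewrite fact_prod big_add1 big_mkord.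
  rewrite mulrAC exprMn; apply: ler_pM => //.
  - by rewrite exprn_ge0// divr_ge0// ltW// expR_gt0.
  - exact: fact_ge_expn.
rewrite ler_pXn2r ?nnegrE ?divr_ge0 ?mulr_ge0 ?ler0n ?expR_ge0// => h.
have e0 : expR 1 != 0 :> R by rewrite gt_eqF// expR_gt0.
have nn0 : n%:R != 0 :> R by rewrite gt_eqF.
have -> : c = expR 1 / n%:R * (n%:R * c / expR 1) by field; rewrite e0.
have -> : expR 1 * (S / n%:R ^+ 2) = expR 1 / n%:R * (S / n%:R) by field.
by rewrite ler_wpM2l// divr_ge0// expR_ge0.
Qed.

(** Summing the bounds of [carleman_mean]: the terms telescope against the
    potential [2 * S K / K.+1]. *)
Lemma carleman_inequality r c N : (forall k, 0 <= r k) -> (forall n, 0 <= c n) ->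
  (forall n, c n.+1 ^+ n.+1 <= \prod_(k < n.+1) r k) ->
  \sum_(n < N) c n.+1 <= 2 * expR 1 * \sum_(k < N) r k.
Proof.
move=> r0 c0 cr.
pose S n := \sum_(k < n) k.+1%:R * r k.
have S0 n : 0 <= S n by apply: sumr_ge0 => k _; rewrite mulr_ge0.
have e0 : 0 <= expR 1 :> R by exact: expR_ge0.
have bound n : c n.+1 <= expR 1 * (S n.+1 / n.+1%:R ^+ 2) by exact: carleman_mean.
have potential K : \sum_(n < K) S n.+1 / n.+1%:R ^+ 2 + 2 * S K / K.+1%:R <=
    2 * \sum_(k < K) r k.
  elim: K => [|K IH]; first by rewrite /S !big_ord0 !mulr0 mul0r addr0.
  have SK : S K.+1 = S K + K.+1%:R * r K by rewrite /S big_ord_recr.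
  rewrite !big_ord_recr/= mulrDr; move: IH; set A := \sum_(n < K) _; set B := \sum_(n < K) _.
  move=> IH; apply: le_trans (lerD IH (lexx _)).
  rewrite -!addrA lerD2l.
  have K1 : 0 < K.+1%:R :> R by rewrite ltr0n.
  have K2 : 0 < K.+2%:R :> R by rewrite ltr0n.
  have -> : 2 * S K / K.+1%:R + 2 * r K = 2 * S K.+1 / K.+1%:R.
    by rewrite SK; field; rewrite gt_eqF.
  rewrite -subr_ge0.
  have -> : 2 * S K.+1 / K.+1%:R - (S K.+1 / K.+1%:R ^+ 2 + 2 * S K.+1 / K.+2%:R) =
    S K.+1 * (K%:R / (K.+1%:R ^+ 2 * K.+2%:R)).
    have E1 : K.+1%:R = K%:R + 1 :> R by rewrite -natr1.
    have E2 : K.+2%:R = K%:R + 2 :> R by rewrite -addn2 natrD.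
    move: K1 K2; rewrite E1 E2 => K1 K2.
    by field; rewrite !gt_eqF.
  by rewrite mulr_ge0// divr_ge0// mulr_ge0// exprn_ge0.
apply: (@le_trans _ _ (\sum_(n < N) expR 1 * (S n.+1 / n.+1%:R ^+ 2))).
  by apply: ler_sum => n _; exact: bound.
rewrite -mulr_sumr [2 * _]mulrC -mulrA ler_wpM2l//.
by apply: le_trans (potential N); rewrite lerDl divr_ge0 ?mulr_ge0.
Qed.

End carleman_inequality.

(** * Bang's vanishing theorem *)

Section bang.
Context (R : realType).
Variables (F : nat -> R -> R) (M : nat -> R).
Hypothesis M_gt0 : forall n, 0 < M n.
Hypothesis M_logconvex : forall n, M n.+1 ^+ 2 <= M n * M n.+2.
(* [F n] plays the role of the derivative of order [n] of a function bounded,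
   together with its derivatives, by the sequence [M]. *)
Hypothesis F_taylor : forall n N x h, 0 <= x -> 0 <= h ->
  `|F n (x + h)| <= \sum_(j < N) `|F (n + j)%N x| * (h ^+ j / j`!%:R) +
                    M (n + N)%N * (h ^+ N / N`!%:R).
Hypothesis F0 : forall n, F n 0 = 0.

Let e : R := expR 1.
Let e_gt0 : 0 < e. Proof. exact: expR_gt0. Qed.

Lemma logconvex_ratio i k : (i <= k)%N -> M k * M i.+1 <= M i * M k.+1.
Proof.
move=> ik; rewrite -(subnK ik); elim: (k - i)%N => [|j IH].
  by rewrite add0n.
rewrite addSn; set n := (j + i)%N in IH *.
rewrite -(ler_pM2l (M_gt0 n)); apply: (@le_trans _ _ (M n.+1 * (M i * M n.+1))).
  by rewrite mulrCA ler_pM2l.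
rewrite (_ : _ * _ = M i * M n.+1 ^+ 2); last by ring.
rewrite (_ : M n * _ = M i * (M n * M n.+2)); last by ring.
by rewrite ler_pM2l.
Qed.

Lemma sum_inv_fact n : \sum_(j < n) (j`!%:R)^-1 <= e.
Proof.
have nd : nondecreasing_seq (series (exp_coeff (1 : R))).
  by apply: nondecreasing_series => j _ _; exact: exp_coeff_ge0.
have := nondecreasing_cvgn_le nd (is_cvg_series_exp_coeff 1) n.
rewrite /series/= big_mkord; apply: le_trans.
by apply: ler_sum => j _; rewrite /exp_coeff/= expr1n mul1r.
Qed.

(** A function all of whose derivatives of order at most [k] are small at [x],
    in the graded sense of the hypothesis, stays so on an interval of length
    [M k / (e * M k.+1)], at the cost of one degree in the grading. *)
Lemma bang_step k x h : 0 <= x -> 0 <= h -> h * (e * M k.+1) <= M k ->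
  (forall n, `|F n x| <= e ^+ n / e ^+ k.+1 * M n) ->
  forall n, `|F n (x + h)| <= e ^+ n / e ^+ k * M n.
Proof.
move=> x0 h0 hM Fx n.
have e1 : 1 <= e by rewrite -expR0 ler_expR.
have [nk|kn] := leqP n k; last first.
  have := @F_taylor n 0 x h x0 h0.
  rewrite big_ord0 add0r expr0 fact0 divr1 mulr1 addn0 => /le_trans; apply.
  rewrite ler_peMl ?(ltW (M_gt0 _))// ler_pdivlMr ?exprn_gt0// mul1r.
  by rewrite ler_weXn2l// ltnW.
have nk1 : (n <= k.+1)%N by exact: leqW.
have := @F_taylor n (k.+1 - n) x h x0 h0.
rewrite subnKC// => /le_trans; apply.
have chain j : (n + j <= k.+1)%N -> M (n + j)%N * (e * h) ^+ j <= M n.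
  elim: j => [|j IH] njk; first by rewrite addn0 expr0 mulr1.
  apply: le_trans (IH _); last by rewrite ltnW// -addnS.
  rewrite exprS mulrA ler_wpM2r ?exprn_ge0 ?mulr_ge0 ?(ltW e_gt0)//.
  have njk' : (n + j <= k)%N by rewrite -ltnS -addnS.
  have := logconvex_ratio njk'; rewrite addnS => rat.
  rewrite -(ler_pM2l (M_gt0 k)).
  apply: (@le_trans _ _ (M (n + j)%N * M k.+1 * (e * h))).
    by rewrite [leLHS]mulrA ler_wpM2r// mulr_ge0// ltW.
  rewrite (_ : _ * (e * h) = M (n + j)%N * (h * (e * M k.+1))); last by ring.
  by rewrite [leRHS]mulrC ler_pM2l.
pose a := e ^+ n / e ^+ k.+1 * M n.
have a0 : 0 <= a by rewrite mulr_ge0 ?divr_ge0 ?exprn_ge0 ?ltW.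
have term j : (n + j <= k.+1)%N ->
    e ^+ (n + j) / e ^+ k.+1 * M (n + j)%N * (h ^+ j / j`!%:R) <= a * (j`!%:R)^-1.
  move=> /chain c; rewrite mulrA ler_wpM2r ?invr_ge0//.
  rewrite exprD [X in X <= _](_ : _ = e ^+ n / e ^+ k.+1 * (M (n + j)%N * (e * h) ^+ j)).
    by rewrite ler_wpM2l// divr_ge0// exprn_ge0// ltW.
  by rewrite exprMn; ring.
apply: (@le_trans _ _ (\sum_(j < (k.+1 - n).+1) a * (j`!%:R)^-1)).
  rewrite big_ord_recr/=; apply: lerD.
    apply: ler_sum => j _; apply: le_trans (term j _).
      by rewrite ler_wpM2r ?divr_ge0 ?exprn_ge0.
    by rewrite -leq_subRL// ltnW.
  have := @term (k.+1 - n)%N; rewrite subnKC// => /(_ (leqnn _)).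
  by rewrite divff ?mul1r// gt_eqF// exprn_gt0.
rewrite -mulr_sumr (le_trans (ler_wpM2l a0 (sum_inv_fact _)))//.
rewrite (_ : a * e = e ^+ n / e ^+ k * M n)// /a exprS.
have ek : e ^+ k != 0 by rewrite gt_eqF// exprn_gt0.
by field; rewrite ek gt_eqF.
Qed.

Hypothesis M_div : forall C, exists N, C < \sum_(k < N) M k / M k.+1.

(** Starting from a zero of infinite order with the grading [k + n], one walks
    the distance [\sum_(k <= i < k + n) M i / (e * M i.+1)] before the grading
    falls to [k].  The sum diverges, so any [x] is reached with any [k] left. *)
Theorem bang x : 0 <= x -> F 0%N x = 0.
Proof.
move=> x0.
have Fle n y : 0 <= y -> `|F n y| <= M n.
  move=> y0; have := @F_taylor n 0 y 0 y0 (lexx _).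
  by rewrite big_ord0 add0r expr0 fact0 divr1 mulr1 addn0 addr0.
pose r k := M k / (e * M k.+1).
have r0 k : 0 <= r k by rewrite divr_ge0 ?mulr_ge0 ?ltW.
have climb n k y : 0 <= y -> y <= \sum_(k <= i < k + n) r i ->
    forall j, `|F j y| <= e ^+ j / e ^+ k * M j.
  elim: n k y => [|n IH] k y y0 yn.
    have -> : y = 0.
      by apply/eqP; rewrite eq_le y0 andbT; move: yn; rewrite addn0 big_geq.
    by move=> j; rewrite F0 normr0 mulr_ge0 ?divr_ge0 ?exprn_ge0 ?ltW.
  set s := \sum_(k.+1 <= i < k.+1 + n) r i.
  have yE : y = Num.min y s + (y - Num.min y s) by rewrite addrC subrK.
  rewrite yE; apply: bang_step.
  - by rewrite le_min y0 sumr_ge0.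
  - by rewrite subr_ge0 ge_min lexx.
  - rewrite -ler_pdivlMr ?mulr_gt0// -/(r k) lerBlDr.
    have : y <= r k + s.
      by rewrite (le_trans yn)// big_ltn ?addnS ?ltnS ?leq_addr// addSn.
    by case: (leP y s) => // _ _; rewrite lerDr.
  - apply: IH; first by rewrite le_min y0 sumr_ge0.
    by rewrite ge_min lexx orbT.
have small k : `|F 0%N x| * e ^+ k <= M 0%N.
  have [N] := M_div (e * (x + \sum_(0 <= i < k) r i)).
  rewrite -ltr_pdivlMl// => xN.
  have : x <= \sum_(k <= i < k + N) r i.
    have : x + \sum_(0 <= i < k) r i <= \sum_(0 <= i < k + N) r i.
      apply: (le_trans (ltW xN)).
      rewrite mulr_sumr addnC (@big_cat_nat _ _ _ N) ?leq_addr//=.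
      rewrite big_mkord -[leLHS]addr0 lerD ?sumr_ge0//.
      by apply: ler_sum => i _; rewrite /r invfM mulrCA mulrC.
    have -> : \sum_(0 <= i < k + N) r i =
        \sum_(0 <= i < k) r i + \sum_(k <= i < k + N) r i.
      by rewrite -big_cat_nat//= leq_addr.
    by rewrite [x + _]addrC lerD2l.
  move=> /(climb _ _ _ x0)/(_ 0%N); rewrite expr0 div1r mulrC.
  by rewrite -ler_pdivlMr ?exprn_gt0.
apply/eqP; rewrite -normr_le0 leNgt; apply/negP => Fx.
have [k ek] : exists k : nat, M 0%N / `|F 0%N x| < e ^+ k.
  exists (Num.truncn (M 0%N / `|F 0%N x|)).+1.
  apply: lt_le_trans (truncnS_gt _) _.
  have h n : n%:R <= e ^+ n.
    rewrite /e -expRM_natl mulr1; apply: le_trans (expR_ge1Dx _).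
    by rewrite lerDr.
  exact: h.
have := small k; rewrite leNgt => /negP; apply.
by rewrite -ltr_pdivrMl// mulrC.
Qed.

End bang.

(** * Taylor bounds for the derivatives of the cosine *)

Section cosine_taylor.
Context (R : realType).

(** The derivative of order [n] of the cosine. *)
Definition dcos n (y : R) : R := cos (y + n%:R * (pi / 2)).

Lemma dcos0 y : dcos 0 y = cos y.
Proof. by rewrite /dcos mul0r addr0. Qed.

Lemma dcosS n y : dcos n.+1 y = - sin (y + n%:R * (pi / 2)).
Proof.
rewrite /dcos -natr1 mulrDl mul1r addrA cosD cos_pihalf sin_pihalf.
by rewrite mulr0 mulr1 add0r.
Qed.

Lemma dcos_le1 n y : `|dcos n y| <= 1. Proof. exact: cos_max. Qed.

Lemma dcos_odd0 n : odd n -> dcos n 0 = 0.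
Proof.
move=> on; rewrite -(odd_double_half n) on add1n dcosS add0r -muln2 natrM.
rewrite -mulrA (mulrC 2) divfK// mulr_natl.
elim: (n./2) => [|m IH]; first by rewrite mulr0n sin0 oppr0.
rewrite mulrSr sinD sinpi cospi mulr0 addr0 mulrN1 opprK.
by apply/eqP; rewrite -oppr_eq0 IH.
Qed.

Lemma is_derive_dcos n (y k : R) :
  is_derive k 1 (fun k => dcos n (y + k)) (dcos n.+1 (y + k)).
Proof.
rewrite dcosS /dcos.
have -> : (fun k0 : R => cos (y + k0 + n%:R * (pi / 2))) =
  cos \o (fun k0 => y + n%:R * (pi / 2) + k0).
  by apply/funext => z /=; congr cos; ring.
apply: is_derive_eq => //.
by rewrite add0r !mulr1; congr (- sin _); ring.
Qed.

Lemma is_derive_monomial (c : R) n (z : R) :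
  is_derive z 1 (fun k : R => c * k ^+ n) (c * (n%:R * z ^+ n.-1)).
Proof.
have d := is_deriveZ c (is_deriveX n (is_derive_id z (1 : R))).
rewrite (_ : (fun k => _) = c \*: (id ^+ n)); last first.
  by apply/funext => k; rewrite /GRing.scale/= fctE.
by apply: is_derive_eq; rewrite /GRing.scale/= mulr1.
Qed.

(** Integration of the bound on the derivative. *)
Lemma monotone_bound (g : R -> R) (dg : R -> R) (N : nat) :
  (forall k : R, is_derive k 1 g (dg k)) -> g 0 = 0 ->
  (forall k, 0 <= k -> `|dg k| <= k ^+ N / N`!%:R) ->
  forall k, 0 <= k -> `|g k| <= k ^+ N.+1 / N.+1`!%:R.
Proof.
move=> gd g0 dgN k k0.
have N0 : N`!%:R != 0 :> R by rewrite pnatr_eq0 -lt0n fact_gt0.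
have N1 : N.+1%:R != 0 :> R by rewrite pnatr_eq0.
have NS : N.+1`!%:R = N.+1%:R * N`!%:R :> R by rewrite factS natrM.
pose p (k : R) : R := (N.+1`!%:R)^-1 * k ^+ N.+1.
have pd (z : R) : is_derive z 1 p (z ^+ N / N`!%:R).
  have -> : z ^+ N / N`!%:R = (N.+1`!%:R)^-1 * (N.+1%:R * z ^+ N.+1.-1).
    by rewrite NS/= invfM mulrACA mulVf// mul1r mulrC.
  exact: is_derive_monomial.
have key (s : R) : `|s| = 1 -> s * g k <= p k.
  move=> s1.
  pose q z := p z - s * g z.
  have qd (z : R) : is_derive z 1 q (z ^+ N / N`!%:R - s * dg z).
    exact: is_deriveB (pd z) (is_deriveZ s (gd z)).
  have qc : continuous q.
    by move=> z; apply/differentiable_continuous/derivable1_diffP; case: (qd z).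
  have q0 : q 0 = 0 by rewrite /q /p g0 expr0n !mulr0 subr0.
  suff : q 0 <= q k by rewrite q0 subr_ge0.
  apply: (@ger0_derive1_ndecr _ q 0 k) => //.
  - move=> z; rewrite in_itv/= => /andP[z0 _]; rewrite derive1E.
    case: (qd z) => _ ->; rewrite subr_ge0.
    apply: le_trans (dgN z (ltW z0)); apply: (le_trans (ler_norm _)).
    by rewrite normrM s1 mul1r.
  - exact: continuous_subspaceT.
rewrite (_ : _ / _ = p k); last by rewrite /p mulrC.
rewrite ler_norml; apply/andP; split.
  by rewrite lerNl -mulN1r key// normrN1.
by rewrite -[g k]mul1r key// normr1.
Qed.

(** The remainder of order [N.+1] vanishes at [0], and its derivative is the
    remainder of order [N] for the next derivative of the cosine. *)
Lemma dcos_taylor N n y k : 0 <= k ->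
  `|dcos n (y + k) - \sum_(j < N) dcos (n + j) y * (k ^+ j / j`!%:R)| <=
  k ^+ N / N`!%:R.
Proof.
elim: N n k => [|N IH] n k k0.
  by rewrite big_ord0 subr0 expr0 fact0 divr1 dcos_le1.
pose g k := dcos n (y + k) - \sum_(j < N.+1) dcos (n + j) y * (k ^+ j / j`!%:R).
pose dg k := dcos n.+1 (y + k) - \sum_(j < N) dcos (n.+1 + j) y * (k ^+ j / j`!%:R).
have gd (z : R) : is_derive z 1 g (dg z).
  have term (j : nat) : is_derive z 1 (fun k : R => dcos (n + j) y * (k ^+ j / j`!%:R))
     (dcos (n + j) y * (j%:R * z ^+ j.-1 / j`!%:R)).
    have := is_derive_monomial (dcos (n + j) y / j`!%:R) j z.
    rewrite (_ : (fun k => _) = fun k : R => dcos (n + j) y * (k ^+ j / j`!%:R)).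
      by rewrite (_ : _ / _ * _ = dcos (n + j) y * (j%:R * z ^+ j.-1 / j`!%:R)) //; ring.
    by apply/funext => x; ring.
  have sumd K : is_derive z 1 (fun k : R => \sum_(j < K) dcos (n + j) y * (k ^+ j / j`!%:R))
     (\sum_(j < K) dcos (n + j) y * (j%:R * z ^+ j.-1 / j`!%:R)).
    rewrite (_ : (fun k => _) = \sum_(j < K) (fun k : R => dcos (n + j) y * (k ^+ j / j`!%:R))).
      exact: is_derive_sum.
    by apply/funext => x; rewrite fct_sumE.
  have d1 := is_derive_dcos n y z.
  have d2 := sumd N.+1.
  suff -> : dg z = dcos n.+1 (y + z) -
      \sum_(j < N.+1) dcos (n + j) y * (j%:R * z ^+ j.-1 / j`!%:R).
    exact: is_deriveB d1 d2.
  rewrite /dg; congr (_ - _).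
  rewrite big_ord_recl/= !mul0r mulr0 add0r; apply: eq_bigr => j _.
  rewrite /bump/= add1n addSnnS factS natrM; congr (_ * _).
  by rewrite -mulf_div divff ?mul1r// pnatr_eq0.
have g0 : g 0 = 0.
  rewrite /g big_ord_recl/= addr0 addn0 expr0 fact0 divr1 mulr1 big1 ?addr0 ?subrr//.
  by move=> j _; rewrite /bump/= expr0n/= mul0r mulr0.
have dgN (z : R) : 0 <= z -> `|dg z| <= z ^+ N / N`!%:R by move=> z0; exact: IH.
exact: (monotone_bound gd g0 dgN k0).
Qed.

End cosine_taylor.

(** * Moments determine the cosine transform *)

Section quasianalytic.
Context d (T : measurableType d) (R : realType).
Variable u : T -> R.
Hypothesis mu_ : measurable_fun [set: T] u.
Hypothesis u0 : forall t, 0 <= u t.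

Lemma Rintegral_sumr (nu : {measure set T -> \bar R}) (f : nat -> T -> R) N :
  (forall j, nu.-integrable setT (EFin \o f j)) ->
  nu.-integrable setT (EFin \o (fun t => \sum_(j < N) f j t)) /\
  \int[nu]_t (\sum_(j < N) f j t) = \sum_(j < N) \int[nu]_t f j t.
Proof.
move=> fI; elim: N => [|N [IH1 IH2]].
  rewrite big_ord0 (_ : (fun t => _) = cst 0); last first.
    by apply/funext => t; rewrite big_ord0.
  split; first exact: integrable0.
  by rewrite /Rintegral integral0.
rewrite (_ : (fun t => _) = (fun t => \sum_(j < N) f j t + f N t)); last first.
  by apply/funext => t; rewrite big_ord_recr.
rewrite big_ord_recr/= -IH2; split; last by rewrite RintegralD.
exact: (integrableD measurableT IH1 (fI N)).
Qed.

Section one_measure.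
Variable nu : {measure set T -> \bar R}.
Hypothesis moment_fin : forall n, (\int[nu]_t (u t ^+ (2 * n))%:E < +oo)%E.

(** Odd powers lie below the mean of two even ones. *)
Lemma moment_integrable n : nu.-integrable setT (EFin \o (fun t => u t ^+ n)).
Proof.
have even k : nu.-integrable setT (EFin \o (fun t => u t ^+ (2 * k))).
  apply/integrableP; split; first by apply/measurable_EFinP; exact: measurable_funX.
  by under eq_integral do rewrite /= ger0_norm ?exprn_ge0//.
have := integrableD measurableT (even 0%N) (even n).
apply: le_integrable => //; first by apply/measurable_EFinP; exact: measurable_funX.
move=> t _; rewrite /= lee_fin muln0 expr0.
have un : 0 <= u t ^+ n by rewrite exprn_ge0.
rewrite ger0_norm// ger0_norm ?addr_ge0 ?exprn_ge0//.
rewrite mulnC exprM; have := sqr_ge0 (u t ^+ n - 1); rewrite sqrrB1.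
by move: (u t ^+ n) un => z z0; nra.
Qed.

Definition moment n := \int[nu]_t (u t ^+ n).

Lemma moment_ge0 n : 0 <= moment n.
Proof. by apply: Rintegral_ge0 => t _; rewrite exprn_ge0. Qed.

(** The integral of [u ^ n * (u - s) ^ 2]; minimizing in [s] gives the
    logarithmic convexity of the moments. *)
Lemma moment_quadratic n s :
  0 <= moment n.+2 - 2 * s * moment n.+1 + s ^+ 2 * moment n.
Proof.
have iZ c k : nu.-integrable setT (EFin \o (fun t => c * u t ^+ k)).
  exact: (@integrableZl _ _ _ nu _ measurableT c _ (moment_integrable k)).
have i1 : nu.-integrable setT (EFin \o (fun t => u t ^+ n.+2 + - (2 * s) * u t ^+ n.+1)).
  exact: (integrableD measurableT (moment_integrable n.+2) (iZ (- (2 * s)) n.+1)).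
have : 0 <= \int[nu]_t (u t ^+ n.+2 + - (2 * s) * u t ^+ n.+1 + s ^+ 2 * u t ^+ n).
  apply: Rintegral_ge0 => t _.
  rewrite (_ : _ + _ = u t ^+ n * (u t - s) ^+ 2); last by rewrite !exprS; ring.
  by rewrite mulr_ge0 ?sqr_ge0// exprn_ge0.
rewrite (RintegralD measurableT i1 (iZ (s ^+ 2) n)).
rewrite (RintegralD measurableT (moment_integrable n.+2) (iZ (- (2 * s)) n.+1)).
rewrite (RintegralZl _ measurableT (moment_integrable n.+1)).
by rewrite (RintegralZl _ measurableT (moment_integrable n)) /moment mulNr.
Qed.

Lemma dcos_measurable n x : measurable_fun setT (fun t => u t ^+ n * dcos n (x * u t)).
Proof.
apply: measurable_funM; first exact: measurable_funX.
apply: (measurableT_comp (f := @cos R)).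
  by apply: continuous_measurable_fun => y; exact: continuous_cos.
apply: measurable_funD => //; exact: measurable_funM.
Qed.

Lemma dcos_integrable n x :
  nu.-integrable setT (EFin \o (fun t => u t ^+ n * dcos n (x * u t))).
Proof.
apply: le_integrable (moment_integrable n) => //.
  exact/measurable_EFinP/dcos_measurable.
by move=> t _; rewrite /= lee_fin normrM ler_piMr// dcos_le1. 
Qed.

Definition cos_moment n x := \int[nu]_t (u t ^+ n * dcos n (x * u t)).

(** The bound [dcos_taylor], integrated. *)
Lemma cos_moment_taylor n N x h : 0 <= h ->
  `|cos_moment n (x + h) - \sum_(j < N) cos_moment (n + j) x * (h ^+ j / j`!%:R)|
   <= moment (n + N) * (h ^+ N / N`!%:R).
Proof.
move=> h0.
pose f j t := h ^+ j / j`!%:R * (u t ^+ (n + j) * dcos (n + j) (x * u t)).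
have fI j : nu.-integrable setT (EFin \o f j).
  exact: (@integrableZl _ _ _ nu _ measurableT (h ^+ j / j`!%:R) _ (dcos_integrable (n + j) x)).
have [SI SE] := Rintegral_sumr N fI.
have -> : \sum_(j < N) cos_moment (n + j) x * (h ^+ j / j`!%:R) =
    \int[nu]_t (\sum_(j < N) f j t).
  rewrite SE; apply: eq_bigr => j _; rewrite mulrC /f RintegralZl//.
  exact: dcos_integrable.
rewrite /cos_moment -RintegralB//; last exact: dcos_integrable.
have DI := integrableB measurableT (dcos_integrable n (x + h)) SI.
apply: (le_trans (le_normr_Rintegral measurableT DI)).
rewrite [leRHS]mulrC /moment -RintegralZl//; last exact: moment_integrable.
apply: le_Rintegral => //.
- exact: (@integrable_norm _ _ _ nu setT _ DI).
- exact: (@integrableZl _ _ _ nu _ measurableT (h ^+ N / N`!%:R) _ (moment_integrable (n + N))).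
move=> t _.
have -> : u t ^+ n * dcos n ((x + h) * u t) - \sum_(j < N) f j t =
    u t ^+ n * (dcos n (x * u t + h * u t) -
      \sum_(j < N) dcos (n + j) (x * u t) * ((h * u t) ^+ j / j`!%:R)).
  rewrite mulrDl mulrBr mulr_sumr; congr (_ - _).
  by apply: eq_bigr => j _; rewrite /f exprD exprMn; ring.
rewrite normrM ger0_norm ?exprn_ge0// exprD.
have hu : 0 <= h * u t by rewrite mulr_ge0.
apply: le_trans (ler_wpM2l _ (dcos_taylor N n (x * u t) hu)) _.
  by rewrite exprn_ge0.
by rewrite exprMn le_eqVlt; apply/orP; left; apply/eqP; ring.
Qed.

End one_measure.

Variables nu1 nu2 : {measure set T -> \bar R}.
Hypothesis moment_fin : forall n, (\int[nu1]_t (u t ^+ (2 * n))%:E < +oo)%E.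
Hypothesis moment_eq : forall n,
  (\int[nu1]_t (u t ^+ (2 * n))%:E = \int[nu2]_t (u t ^+ (2 * n))%:E)%E.
Variable b : nat -> R.
Hypothesis b_ge0 : forall n, 0 <= b n.
(* [b n] lies below the root of order [2 * n] of the inverse of the moment, and
   its sum nevertheless diverges. *)
Hypothesis b_le : forall n, b n.+1 ^+ (2 * n.+1) * (1 + moment nu1 (2 * n.+1)) <= 1.
Hypothesis b_div : forall C, exists N, C < \sum_(n < N) b n.+1.

Let moment_fin2 n : (\int[nu2]_t (u t ^+ (2 * n))%:E < +oo)%E.
Proof. by rewrite -moment_eq. Qed.

(* The summand [1] keeps the sequence positive without spoiling its convexity. *)
Let M n := moment nu1 n + moment nu2 n + 1.

Let M_ge1 n : 1 <= M n.
Proof. by rewrite lerDr addr_ge0// moment_ge0. Qed.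

Let M_gt0 n : 0 < M n. Proof. exact: lt_le_trans (M_ge1 n). Qed.

Let M_logconvex n : M n.+1 ^+ 2 <= M n * M n.+2.
Proof.
pose s := M n.+1 / M n.
have q1 := moment_quadratic moment_fin n s; have q2 := moment_quadratic moment_fin2 n s.
have : 0 <= M n.+2 - 2 * s * M n.+1 + s ^+ 2 * M n.
  by rewrite /M; have := sqr_ge0 (1 - s); rewrite sqrrB; lra.
have -> : M n.+2 - 2 * s * M n.+1 + s ^+ 2 * M n = M n.+2 - M n.+1 ^+ 2 / M n.
  by rewrite /s; field; rewrite gt_eqF.
by rewrite subr_ge0 ler_pdivrMr// mulrC.
Qed.

(* Carleman's inequality compares the ratios [M k / M k.+1] with the roots of
   their products, which telescope to [M 0 / M n]; only the even indices are
   used. *)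
Let M_div C : exists N, C < \sum_(k < N) M k / M k.+1.
Proof.
apply: contrapT => nC.
have rC N : \sum_(k < N) M k / M k.+1 <= C.
  by rewrite leNgt; apply/negP => h; apply: nC; exists N.
pose c n := if odd n then 0 else b n./2 / 2.
have prodM n : \prod_(k < n) (M k / M k.+1) = M 0%N / M n.
  elim: n => [|n IH]; first by rewrite big_ord0 divff// gt_eqF.
  by rewrite big_ord_recr/= IH mulrA divfK// gt_eqF.
have cr n : c n.+1 ^+ n.+1 <= \prod_(k < n.+1) (M k / M k.+1).
  rewrite prodM /c; case: ifPn => [_|].
    by rewrite expr0n/= divr_ge0// ltW.
  move=> no; have [m mE] : exists m, n.+1 = (2 * m.+1)%N.
    exists (n.+1./2).-1; rewrite prednK; last by case: n no.
    by rewrite mul2n -[LHS]odd_double_half (negbTE no).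
  rewrite mE mul2n doubleK -mul2n.
  rewrite ler_pdivlMr// (le_trans _ (M_ge1 0))// exprMn.
  have ME : M (2 * m.+1) <= 2 * (1 + moment nu1 (2 * m.+1)).
    have -> : M (2 * m.+1) = 2 * moment nu1 (2 * m.+1) + 1.
      rewrite /M (_ : moment nu2 _ = moment nu1 (2 * m.+1)); first by ring.
      by rewrite /moment /Rintegral moment_eq.
    lra.
  apply: (@le_trans _ _ (b m.+1 ^+ (2 * m.+1) * 2^-1 * (2 * (1 + moment nu1 (2 * m.+1))))).
    apply: ler_pM => //.
    - by rewrite mulr_ge0 ?exprn_ge0// invr_ge0.
    - exact: ltW.
    - rewrite ler_wpM2l ?exprn_ge0// mulnS exprD -[leRHS]mulr1 ler_pM//.
      + by rewrite expr2; lra.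
      + by rewrite exprn_ile1//; lra.
  by move: (b_le m); set B := b _ ^+ _; set D := 1 + _ => BD; lra.
have c0 n : 0 <= c n by rewrite /c; case: ifP => // _; rewrite divr_ge0.
have r0 k : 0 <= M k / M k.+1 by rewrite divr_ge0// ltW.
have [N] := b_div (4 * expR 1 * C).
apply/negP; rewrite -leNgt.
have := carleman_inequality (2 * N) r0 c0 cr.
have -> : \sum_(n < 2 * N) c n.+1 = 2^-1 * \sum_(n < N) b n.+1.
  rewrite mul2n; elim: N => [|N IH]; first by rewrite !big_ord0 mulr0.
  rewrite doubleS !big_ord_recr/= IH mulrDr /c/= ?negbK ?odd_double/= ?addr0.
  by rewrite doubleK [b _ / 2]mulrC.
have := rC (2 * N)%N; set X := \sum_(k < _) _; set Y := \sum_(n < N) _ => XC h.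
have e0 := @expR_gt0 R 1.
have : 2 * expR 1 * X <= 2 * expR 1 * C by rewrite ler_wpM2l// mulr_ge0// ltW.
lra.
Qed.

(** [bang] applied to the difference of the cosine transforms.  Its derivatives
    at [0] vanish: those of even order are differences of moments, and the
    others contain the sine of [0]. *)
Lemma cos_transform_eq x : \int[nu1]_t cos (x * u t) = \int[nu2]_t cos (x * u t).
Proof.
wlog x0 : x / 0 <= x => [W|].
  have [|xn] := leP 0 x; first exact: W.
  have := W (- x); rewrite oppr_ge0 => /(_ (ltW xn)).
  by under eq_Rintegral do rewrite mulNr cosN;
     under [RHS]eq_Rintegral do rewrite mulNr cosN.
pose F n x := cos_moment nu1 n x - cos_moment nu2 n x.
have F_taylor n N y h : 0 <= y -> 0 <= h ->
  `|F n (y + h)| <= \sum_(j < N) `|F (n + j)%N y| * (h ^+ j / j`!%:R) +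
                    M (n + N)%N * (h ^+ N / N`!%:R).
  move=> y0 h0.
  have c0 j : 0 <= h ^+ j / j`!%:R by rewrite divr_ge0 ?exprn_ge0.
  have t1 := cos_moment_taylor moment_fin n N y h0.
  have t2 := cos_moment_taylor moment_fin2 n N y h0.
  set A1 := cos_moment nu1 n _ in t1; set S1 := \sum_(j < N) _ in t1.
  set A2 := cos_moment nu2 n _ in t2; set S2 := \sum_(j < N) _ in t2.
  have -> : F n (y + h) = (S1 - S2) + ((A1 - S1) - (A2 - S2)).
    by rewrite /F -/A1 -/A2; ring.
  apply: le_trans (ler_normD _ _) _; apply: lerD.
    rewrite /S1 /S2 -sumrB; apply: le_trans (ler_norm_sum _ _ _) _.
    by apply: ler_sum => j _; rewrite -mulrBl normrM (ger0_norm (c0 j)).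
  apply: le_trans (ler_normB _ _) _; apply: le_trans (lerD t1 t2) _.
  by rewrite -mulrDl ler_wpM2r// /M lerDl.
have F0 n : F n 0 = 0.
  rewrite /F /cos_moment.
  under eq_Rintegral do rewrite mul0r.
  under [X in _ - X]eq_Rintegral do rewrite mul0r.
  have [on|en] := boolP (odd n).
    rewrite dcos_odd0//; under eq_Rintegral do rewrite mulr0.
    under [X in _ - X]eq_Rintegral do rewrite mulr0.
    by rewrite /Rintegral !integral0 subrr.
  under eq_Rintegral do rewrite mulrC.
  under [X in _ - X]eq_Rintegral do rewrite mulrC.
  rewrite !RintegralZl//; [|exact: moment_integrable|exact: moment_integrable].
  apply/eqP; rewrite subr_eq0; apply/eqP; congr (_ * _).
  by rewrite /Rintegral -[n]odd_double_half (negbTE en) add0n -mul2n moment_eq.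
have := bang M_gt0 M_logconvex F_taylor F0 M_div x0.
rewrite /F /cos_moment => /eqP; rewrite subr_eq0 => /eqP.
under eq_Rintegral do rewrite expr0 mul1r dcos0.
by under [RHS]eq_Rintegral do rewrite expr0 mul1r dcos0.
Qed.

End quasianalytic.

(** * The cosine transform determines the measure *)

Section indicator_approximation.
Context (R : realType).
Implicit Types q w c x : R.

Lemma bernoulli_inequality x n : 0 <= x <= 1 -> 1 - n%:R * x <= (1 - x) ^+ n.
Proof.
move=> /andP[x0 x1]; elim: n => [|n IH]; first by rewrite mul0r subr0 expr0.
rewrite exprS; apply: le_trans (ler_wpM2l _ IH); last by rewrite subr_ge0.
rewrite -natr1; have : 0 <= n%:R * x * x by rewrite !mulr_ge0.
by move: n%:R => N h; nra.
Qed.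

Lemma cvg_natr_geometric q : 0 <= q < 1 -> (fun n => n%:R * q ^+ n) @ \oo --> (0 : R).
Proof.
move=> /andP[q0 q1]; set r := Num.sqrt q.
have r0 : 0 <= r by exact: sqrtr_ge0.
have rq : q = r ^+ 2 by rewrite sqr_sqrtr.
have r1 : r < 1 by rewrite -sqrtr1 ltr_sqrt.
have s0 : 0 < 1 - r by rewrite subr_gt0.
have nr n : n%:R * r ^+ n <= (1 - r)^-1.
  rewrite -div1r ler_pdivlMr// mulrC.
  apply: (@le_trans _ _ (1 - r ^+ n)); last by rewrite gerBl exprn_ge0.
  elim: n => [|n IH]; first by rewrite mul0r mulr0 expr0 subrr.
  have h : (1 - r) * (n.+1%:R * r ^+ n.+1) =
    (1 - r) * (n%:R * r ^+ n) * r + (1 - r) * r ^+ n.+1.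
    by rewrite -natr1 exprS; ring.
  rewrite h exprS.
  have rn : 0 <= r ^+ n by exact: exprn_ge0.
  have rn1 : r ^+ n <= 1 by rewrite exprn_ile1// ltW.
  have IHr := ler_wpM2r r0 IH.
  have : 0 <= (1 - r) * (1 - r * r ^+ n).
    by rewrite mulr_ge0 ?(ltW s0)// subr_ge0 mulr_ile1// ltW.
  by move: IHr; set A := _ * (_ * _); move: (r ^+ n) => p; lra.
apply: (@squeeze_cvgr _ _ _ _ (cst 0) (fun n => (1 - r)^-1 * r ^+ n)).
- apply: nearW => n; rewrite rq mulr_ge0 ?exprn_ge0//=.
  by rewrite -exprM mulnC exprM expr2 mulrA ler_wpM2r// exprn_ge0.
- exact: cvg_cst.
- rewrite -[X in _ --> X](mulr0 (1 - r)^-1); apply: cvgMl_tmp.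
  by apply: cvg_expr; rewrite ger0_norm.
Qed.

(** The exponent grows just fast enough to kill [1 - w ^+ n] as soon as
    [c <= w], and slowly enough to leave it untouched when [w < c]. *)
Lemma cvg_power_indicator c w : 0 < c < 1 -> 0 <= w <= 1 ->
  (fun n => (1 - w ^+ n) ^+ (Num.truncn (n%:R / c ^+ n)).+1) @ \oo -->
  ((w < c)%R%:R : R).
Proof.
move=> /andP[c0 c1] /andP[w0 w1].
have cn n : 0 < c ^+ n by rewrite exprn_gt0.
have m0 n : 0 <= n%:R / c ^+ n by rewrite divr_ge0// ltW.
have wn n : 0 <= w ^+ n <= 1 by rewrite exprn_ge0// exprn_ile1.
have [wc|cw] := ltP w c.
  have q : 0 <= w / c < 1 by rewrite divr_ge0 ?(ltW c0)//= ltr_pdivrMr// mul1r.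
  apply: (@squeeze_cvgr _ _ _ _
    (fun n => 1 - (n%:R * (w / c) ^+ n + w ^+ n)) (cst 1)).
  - apply: nearW => n; apply/andP; split; last first.
      by case/andP: (wn n) => a b; rewrite exprn_ile1// ?subr_ge0// gerBl.
    apply: le_trans (bernoulli_inequality _ (wn n)); rewrite lerD2l lerN2.
    rewrite -natr1 mulrDl mul1r lerD2r exprMn exprVn mulrA mulrAC.
    by rewrite ler_wpM2r ?exprn_ge0// truncn_le m0.
  - rewrite -[X in _ --> X](subr0 1) -[X in _ --> _ - X](addr0 0).
    apply: cvgB; first exact: cvg_cst.
    apply: cvgD; first exact: cvg_natr_geometric.
    by apply: cvg_expr; rewrite ger0_norm// (lt_trans wc).
  - exact: cvg_cst.
apply: (@squeeze_cvgr _ _ _ _ (cst 0) (fun n => expR (-1) ^+ n)).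
- apply: nearW => n; case/andP: (wn n) => a b.
  rewrite exprn_ge0 ?subr_ge0//=; set m := (Num.truncn _).+1.
  have mE : n%:R / c ^+ n < m%:R by exact: truncnS_gt.
  apply: (@le_trans _ _ (expR (- w ^+ n) ^+ m)).
    by apply: lerXn2r; rewrite ?nnegrE ?subr_ge0 ?expR_ge0// expR_ge1Dx.
  rewrite -!expRM_natl ler_expR mulrN mulrN1 lerN2.
  rewrite ltr_pdivrMr// in mE; apply: (le_trans (ltW mE)).
  by rewrite ler_wpM2l// lerXn2r// ?nnegrE// ltW.
- exact: cvg_cst.
- by apply: cvg_expr; rewrite ger0_norm ?expR_ge0// -expR0 ltr_expR; lra.
Qed.

End indicator_approximation.

Section cosine_uniqueness.
Context d (T : measurableType d) (R : realType).
Variable u : T -> R.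
Hypothesis mu_ : measurable_fun [set: T] u.
Hypothesis u0 : forall t, 0 <= u t.
Variables nu1 nu2 : {measure set T -> \bar R}.
Hypothesis fin1 : (nu1 setT < +oo)%E.
Hypothesis fin2 : (nu2 setT < +oo)%E.
Hypothesis cos_eq : forall x,
  \int[nu1]_t cos (x * u t) = \int[nu2]_t cos (x * u t).

(* The bounded functions that have the same integral for both measures form a
   vector space closed under bounded pointwise limits. *)
Let agree (f : T -> R) := [/\ measurable_fun setT f,
  exists C : R, forall t, `|f t| <= C & \int[nu1]_t f t = \int[nu2]_t f t].

Let bounded_integrable (nu : {measure set T -> \bar R}) (f : T -> R) C :
  (nu setT < +oo)%E -> measurable_fun setT f -> (forall t, `|f t| <= C) ->
  nu.-integrable setT (EFin \o f).
Proof.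
move=> fin mf fC; apply: measurable_bounded_integrable => //.
by exists C; split; rewrite ?num_real// => x Cx t _; apply: le_trans (ltW Cx).
Qed.

Let agreeD f g : agree f -> agree g -> agree (fun t => f t + g t).
Proof.
move=> [mf [C fC] fE] [mg [D gD] gE]; split.
- exact: measurable_funD.
- by exists (C + D) => t; apply: le_trans (ler_normD _ _) (lerD _ _).
- have fI nu h := bounded_integrable (nu := nu) h mf fC.
  have gI nu h := bounded_integrable (nu := nu) h mg gD.
  rewrite (RintegralD measurableT (fI _ fin1) (gI _ fin1)).
  by rewrite (RintegralD measurableT (fI _ fin2) (gI _ fin2)) fE gE.
Qed.

Let agreeZ c f : agree f -> agree (fun t => c * f t).
Proof.
move=> [mf [C fC] fE]; split.
- exact: measurable_funM.
- by exists (`|c| * C) => t; rewrite normrM ler_wpM2l.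
- have fI nu h := bounded_integrable (nu := nu) h mf fC.
  rewrite (RintegralZl _ measurableT (fI _ fin1)).
  by rewrite (RintegralZl _ measurableT (fI _ fin2)) fE.
Qed.

Let agree_cos x : agree (fun t => cos (x * u t)).
Proof.
split => //.
- apply: (measurableT_comp (f := @cos R)).
    by apply: continuous_measurable_fun => y; exact: continuous_cos.
  exact: measurable_funM.
- by exists 1 => t; exact: cos_max.
Qed.

(* The additional factor [cos (y * u)] makes the induction on the degree go
   through: products of cosines are sums of cosines. *)
Let agree_poly (p : {poly R}) x y : agree (fun t => p.[cos (x * u t)] * cos (y * u t)).
Proof.
elim/poly_ind: p y => [|p c IH] y.
  rewrite (_ : (fun t => _) = (fun t => 0 * cos (y * u t))).
    exact/agreeZ/agree_cos.
  by apply/funext => t; rewrite horner0 !mul0r.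
rewrite (_ : (fun t => _) = (fun t => 2^-1 * (p.[cos (x * u t)] * cos ((x + y) * u t) +
    p.[cos (x * u t)] * cos ((x - y) * u t)) + c * cos (y * u t))).
  by apply: agreeD; apply: agreeZ; [apply: agreeD|exact: agree_cos].
apply/funext => t; rewrite hornerMXaddC mulrDl; congr (_ + _).
by rewrite [(x + y) * _]mulrDl [(x - y) * _]mulrBl cosD cosB; field.
Qed.

Let agree_lim (f_ : nat -> T -> R) f :
  (forall n, agree (f_ n)) -> (forall n t, `|f_ n t| <= 1) ->
  (forall t, (fun n => f_ n t) @ \oo --> f t) -> agree f.
Proof.
move=> fA f1 fl.
have mf : measurable_fun setT f.
  apply: (measurable_fun_cvg (h := f_)) => //; first by move=> n; case: (fA n).
have fle t : `|f t| <= 1.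
  exact: (cvgr_to_le (cvg_norm (fl t)) (nearW _ (f1 ^~ t))).
split => //; first by exists 1.
have lim (nu : {measure set T -> \bar R}) : (nu setT < +oo)%E ->
  (fun n => \int[nu]_t f_ n t) @ \oo --> \int[nu]_t f t.
  move=> fin.
  have [] := @dominated_convergence _ T R nu setT measurableT
     (fun n => EFin \o f_ n) (EFin \o f) (cst 1%:E).
  - by move=> n; apply/measurable_EFinP; case: (fA n).
  - exact/measurable_EFinP.
  - by apply: aeW => t _; apply: cvg_EFin; [exact: nearW|exact: fl].
  - by apply: (bounded_integrable (C := 1) fin) => // t; rewrite normr1.
  - by apply: aeW => t n _; rewrite /= lee_fin.
  move=> fI _.
  by rewrite -(fineK (integrable_fin_num measurableT fI)) => /fine_cvgP[].
have l1 := lim _ fin1; have l2 := lim _ fin2.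
rewrite (_ : (fun n => _) = (fun n => \int[nu2]_t f_ n t)) in l1; last first.
  by apply/funext => n; case: (fA n).
exact: (cvg_unique _ l1 l2).
Qed.

Let agree_indicator x c : 0 < c < 1 ->
  agree (fun t => ((1 - cos (x * u t)) / 2 < c)%R%:R).
Proof.
move=> c01.
pose p n : {poly R} :=
  (1 - (2^-1%:P * (1 - 'X)) ^+ n) ^+ (Num.truncn (n%:R / c ^+ n)).+1.
have pE n t : (p n).[cos (x * u t)] =
    (1 - ((1 - cos (x * u t)) / 2) ^+ n) ^+ (Num.truncn (n%:R / c ^+ n)).+1.
  by rewrite /p !(hornerE, horner_exp) [2^-1 * _]mulrC.
have w01 t : 0 <= (1 - cos (x * u t)) / 2 <= 1.
  by have := cos_max (x * u t); rewrite ler_norml; lra.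
apply: (agree_lim (f_ := fun n t => (p n).[cos (x * u t)])).
- move=> n; rewrite (_ : (fun t => _) =
    fun t => (p n).[cos (x * u t)] * cos (0 * u t)); first exact: agree_poly.
  by apply/funext => t; rewrite mul0r cos0 mulr1.
- move=> n t; rewrite pE; case/andP: (w01 t) => a b.
  have h : 0 <= 1 - ((1 - cos (x * u t)) / 2) ^+ n <= 1.
    by rewrite subr_ge0 exprn_ile1// gerBl exprn_ge0.
  by case/andP: h => h1 h2; rewrite ger0_norm ?exprn_ge0// exprn_ile1.
- by move=> t; under eq_fun do rewrite pE; exact: cvg_power_indicator.
Qed.

(** A condition on [cos (x * u)] is not monotone in [u], but it becomes so on
    larger and larger ranges as [x] tends to [0]: the sets
    [cos (x * a) < cos (x * u)] converge to [u < a]. *)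
Lemma cos_transform_uniqueness a : 0 < a ->
  nu1 [set t | u t < a] = nu2 [set t | u t < a].
Proof.
move=> a0.
pose x m : R := (m + (Num.truncn a).+1)%:R^-1.
have x0 m : 0 < x m by rewrite invr_gt0 ltr0n addnS.
have xa m : 0 < x m * a < 1.
  rewrite mulr_gt0//= mulrC ltr_pdivrMr ?ltr0n ?addnS// mul1r.
  by apply: lt_le_trans (truncnS_gt a) _; rewrite ler_nat -addnS leq_addl.
have pi1 : 1 < pi :> R by rewrite (lt_le_trans _ (pi_ge2 R))// ltr1n.
have cosa m : -1 < cos (x m * a) < 1.
  case/andP: (xa m) => a1 a2; rewrite -cospi -cos0.
  by rewrite !ltr_cos ?in_itv/=; lra.
have [] : agree (fun t => (u t < a)%R%:R).
  apply: (agree_lim (f_ := fun m t => ((1 - cos (x m * u t)) / 2 < (1 - cos (x m * a)) / 2)%R%:R)).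
  - by move=> m; apply: agree_indicator; have := cosa m; lra.
  - by move=> n t; case: (_ < _); rewrite ?normr1 ?normr0.
  - move=> t; apply: cvg_near_cst.
    have : (fun m => x m * u t) @ \oo --> (0 : R).
      rewrite -[X in _ --> X](mul0r (u t)); apply: cvgMr_tmp.
      rewrite (_ : x = fun m => harmonic (m + Num.truncn a)%N); last first.
        by apply/funext => m; rewrite /x addnS.
      by rewrite (cvg_shiftn (Num.truncn a) (@harmonic R)); exact: cvg_harmonic.
    move=> /cvgr_lt /(_ _ (lt_trans ltr01 pi1)); apply: filterS => m xm.
    case/andP: (xa m) => a1 a2; congr (nat_of_bool _)%:R.
    rewrite ltr_pM2r ?invr_gt0// ltrD2l ltrN2 ltr_cos ?in_itv/= ?ltr_pM2l//.
      by rewrite mulr_ge0 ?(ltW (x0 m))// ltW.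
    by rewrite (ltW a1) ltW// (lt_trans a2).
move=> mf _.
have mA : measurable [set t | u t < a].
  rewrite (_ : mkset _ = setT `&` u @^-1` `]-oo, a[).
    exact: mu_ measurableT _ (measurable_itv _).
  by rewrite setTI; apply/seteqP; split => t; rewrite /= in_itv.
have E : (fun t => (u t < a)%R%:R) = (\1_[set t | u t < a] : T -> R).
  by apply/funext => t; rewrite indicE; congr (nat_of_bool _)%:R; apply/idP/idP;
    rewrite inE.
rewrite E /Rintegral !integral_indic// !setIT => e.
have fin (nu : {measure set T -> \bar R}) : (nu setT < +oo)%E ->
    nu [set t | u t < a] \is a fin_num.
  move=> h; rewrite ge0_fin_numE//; apply: le_lt_trans h.
  by apply: le_measure; rewrite ?inE.
by rewrite -(fineK (fin _ fin1)) -(fineK (fin _ fin2)) e.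
Qed.

End cosine_uniqueness.

(** * Uniqueness on the half line *)

Section half_line_uniqueness.
Context (R : realType).
Local Notation borel := {measure set (measurableTypeR R) -> \bar R}.
Local Notation Rp := (`[0%R, +oo[%classic : set (measurableTypeR R)).

Lemma measure_eq_of_rays (m1 m2 : borel) :
  (forall b : R, m1 `]-oo, b[%classic = m2 `]-oo, b[%classic) ->
  (forall b : R, (m1 `]-oo, b[%classic < +oo)%E) ->
  forall A : set (measurableTypeR R), measurable A -> m1 A = m2 A.
Proof.
move=> m12 m1fin A mA.
apply: (@measure_unique _ R (measurableTypeR R) (@RGenInftyO.G R) (fun n => `]-oo, n%:R[%classic)) => //.
- exact: RGenInftyO.measurableE.
- move=> _ _ [b ->] [c ->]; exists (Num.min b c).
  by apply/seteqP; split => t /=; rewrite !in_itv/= lt_min => /andP.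
- by move=> n; exists n%:R.
- apply/seteqP; split => // t _; exists (Num.truncn t).+1 => //=.
  by rewrite in_itv/= truncnS_gt.
- by move=> _ [b ->].
Qed.

Lemma integral_half_line (nu : borel) (f : measurableTypeR R -> \bar R) :
  nu `]-oo, 0%R[%classic = 0%E -> measurable_fun setT f ->
  (forall t, (0 <= f t)%E) ->
  (\int[nu]_t f t = \int[nu]_(t in Rp) f t)%E.
Proof.
move=> nu0 mf f0.
rewrite (@ge0_negligible_integral _ _ _ nu setT `]-oo, 0%R[%classic)//.
congr (integral _ _ _); apply/seteqP; split => t; rewrite /= !in_itv/= andbT.
  by move=> [_ /negP]; rewrite -leNgt.
by move=> t0; split => //; apply/negP; rewrite -leNgt.
Qed.

Variable k : nat.

(** The variable of the cosine transform: its even powers are the powers of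
    [t ^ (k + 1)] on the half line. *)
Definition sqrt_power (t : R) : R := Num.sqrt (Num.max t 0 ^+ k.+1).

Lemma measurable_sqrt_power : measurable_fun setT (sqrt_power : measurableTypeR R -> R).
Proof.
apply: (measurableT_comp (f := @Num.sqrt R)).
  by apply: continuous_measurable_fun => y; exact: sqrt_continuous.
by apply: measurable_funX; exact: measurable_maxr.
Qed.

Lemma sqrt_power_ge0 t : 0 <= sqrt_power t.
Proof. exact: sqrtr_ge0. Qed.

Lemma sqrt_power_double t n : sqrt_power t ^+ (2 * n) = Num.max t 0 ^+ (n * k.+1).
Proof.
by rewrite exprM sqr_sqrtr ?exprn_ge0 ?le_max ?lexx ?orbT// -exprM mulnC.
Qed.

Lemma sqrt_power_moment (nu : borel) n : nu `]-oo, 0%R[%classic = 0%E ->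
  (\int[nu]_t (sqrt_power t ^+ (2 * n))%:E = \int[nu]_(t in Rp) (t ^+ (n * k.+1))%:E)%E.
Proof.
move=> nu0; rewrite integral_half_line//; last 2 first.
- apply/measurable_EFinP; apply: measurable_funX; exact: measurable_sqrt_power.
- by move=> t; rewrite lee_fin exprn_ge0// sqrt_power_ge0.
apply: eq_integral => t; rewrite inE/= in_itv/= andbT => t0.
by rewrite sqrt_power_double (max_idPl t0).
Qed.

(** Bang's argument for the Carleman condition: the even moments of
    [t ^ ((k+1)/2)] determine a measure on the half line. *)
Theorem half_line_uniqueness (m1 m2 : borel) (g b : nat -> R) :
  m1 `]-oo, 0%R[%classic = 0%E -> m2 `]-oo, 0%R[%classic = 0%E ->
  (forall n, \int[m1]_(t in Rp) (t ^+ (n * k.+1))%:E = (g n)%:E)%E ->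
  (forall n, \int[m2]_(t in Rp) (t ^+ (n * k.+1))%:E = (g n)%:E)%E ->
  (forall n, 0 <= b n) ->
  (forall n, b n.+1 ^+ (2 * n.+1) * (1 + g n.+1) <= 1) ->
  (forall C, exists N, C < \sum_(n < N) b n.+1) ->
  forall A : set (measurableTypeR R), measurable A -> m1 A = m2 A.
Proof.
move=> m10 m20 g1 g2 b0 b1 bdiv.
have u1 n : (\int[m1]_t (sqrt_power t ^+ (2 * n))%:E = (g n)%:E)%E.
  by rewrite sqrt_power_moment.
have u2 n : (\int[m2]_t (sqrt_power t ^+ (2 * n))%:E = (g n)%:E)%E.
  by rewrite sqrt_power_moment.
have total (m : borel) : (\int[m]_t (sqrt_power t ^+ (2 * 0))%:E = m setT)%E.
  under eq_integral do rewrite muln0 expr0.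
  by rewrite integral_cst// mul1e.
have fin1 : (m1 setT < +oo)%E by rewrite -total u1 ltry.
have fin2 : (m2 setT < +oo)%E by rewrite -total u2 ltry.
have cosE := @cos_transform_eq _ _ _ _ measurable_sqrt_power sqrt_power_ge0 m1 m2.
apply: measure_eq_of_rays => c; last first.
  by apply: le_lt_trans fin1; apply: le_measure; rewrite ?inE.
have [c0|c0] := leP c 0.
  have neg (m : borel) : m `]-oo, 0%R[%classic = 0%E -> m `]-oo, c[%classic = 0%E.
    move=> m0; apply/eqP; rewrite -measure_le0 -m0; apply: le_measure; rewrite ?inE//.
    by move=> t /=; rewrite !in_itv/= => tc; apply: lt_le_trans c0.
  by rewrite !neg.
have -> : `]-oo, c[%classic = [set t : R | sqrt_power t < sqrt_power c].
  apply/seteqP; split => t; rewrite /= in_itv/= /sqrt_power ltr_sqrt ?exprn_gt0 ?lt_max ?c0//.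
    move=> tc; rewrite ltr_pXn2r ?nnegrE ?le_max ?lexx ?orbT//.
    by rewrite gt_max !lt_max tc c0 ?orbT.
  rewrite ltr_pXn2r ?nnegrE ?le_max ?lexx ?orbT//.
  by rewrite (max_idPl (ltW c0)) gt_max => /andP[].
apply: cos_transform_uniqueness => //.
- exact: measurable_sqrt_power.
- exact: sqrt_power_ge0.
- apply: (cosE _ _ b) => //.
  + by move=> n; rewrite u1 ltry.
  + by move=> n; rewrite u1 u2.
  + by move=> n; rewrite /moment /Rintegral u1.
- by rewrite sqrtr_gt0 exprn_gt0// lt_max c0.
Qed.

End half_line_uniqueness.

(** * Divergent sums of roots *)

Section carleman_sequences.
Context (R : realType).

(** If the sum were finite, its terms would tend to zero; then the values [g n]
    would dominate the added constant and the original sum would be finite. *)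
Lemma carleman_divergence (g : nat -> R) : (forall n, 0 < g n) ->
  carleman (fun n => (g n)%:E) ->
  forall C, exists N, C < \sum_(n < N) (1 + g n.+1) `^ (- (2 * n.+1)%:R^-1).
Proof.
move=> g0 cg C; apply: contrapT => nC.
pose r n := (1 + g n) `^ (- (2 * n)%:R^-1).
pose c n := g n `^ (- (2 * n)%:R^-1).
have r0 n : 0 <= r n by exact: powR_ge0.
have c0 n : 0 <= c n by exact: powR_ge0.
have rC N : \sum_(n < N) r n.+1 <= C.
  by rewrite leNgt; apply/negP => h; apply: nC; exists N.
have [N0 rN0] : exists N0, forall n, (N0 <= n)%N -> r n.+1 < 2^-1.
  have cv : cvgn (series (fun n => r n.+1)).
    apply: nondecreasing_is_cvgn.
      by apply/nondecreasing_seqP => n; rewrite seriesSr lerDl.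
    by exists C => _ [n _ <-]; rewrite /series/= big_mkord.
  have := cvg_series_cvg_0 cv => /cvgr_lt /(_ 2^-1).
  by rewrite invr_gt0 ltr0n => /(_ isT)[N0 _ h]; exists N0 => n; exact: h.
have c_le n : (N0 <= n)%N -> c n.+1 <= 2 * r n.+1.
  move=> /rN0; rewrite /r /c.
  set e := (2 * n.+1)%:R^-1 => rh.
  have e0 : 0 < e by rewrite invr_gt0 ltr0n.
  have e1 : e <= 1 by rewrite invf_le1 ?ltr0n// ler1n.
  have g1 : 1 <= g n.+1.
    rewrite leNgt; apply/negP => gl; move: rh; apply/negP; rewrite -leNgt.
    have -> : 2^-1 = (2 : R) `^ (- 1) by rewrite powR_inv1.
    apply: (@le_trans _ _ (2 `^ (- e))).
      by rewrite ler_powR ?ler1n// lerN2.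
    rewrite !powRN lef_pV2 ?posrE ?powR_gt0//; last by rewrite addr_gt0.
    by apply: ge0_ler_powR; rewrite ?nnegrE ?(ltW e0)//; have := g0 n.+1; lra.
  rewrite !powRN -[leLHS]mul1r ler_pdivrMr ?powR_gt0//.
  rewrite mulrAC ler_pdivlMr ?powR_gt0 ?addr_gt0// mul1r.
  apply: (@le_trans _ _ ((2 * g n.+1) `^ e)).
    by apply: ge0_ler_powR; rewrite ?nnegrE ?(ltW e0)//; have := g0 n.+1; lra.
  rewrite powRM ?(ltW (g0 _))// ler_wpM2r ?powR_ge0//.
  by rewrite -[leRHS]powRr1// ler_powR ?ler1n.
pose K := 2 * C + \sum_(n < N0) c n.+1.
have partial N : \sum_(n < N) c n.+1 <= K.
  apply: (@le_trans _ _ (\sum_(n < N) (2 * r n.+1 + (if (n < N0)%N then c n.+1 else 0)))).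
    apply: ler_sum => n _; case: ltnP => h; first by rewrite lerDr mulr_ge0.
    by rewrite addr0 c_le.
  rewrite big_split/=; apply: lerD.
    by rewrite -mulr_sumr; apply: ler_wpM2l (rC N).
  apply: (@le_trans _ _ (\sum_(n < N0 + N) (if (n < N0)%N then c n.+1 else 0))).
    rewrite addnC big_split_ord/= lerDl sumr_ge0// => n _.
    by case: ifP.
  rewrite big_split_ord/= [X in _ + X]big1 ?addr0; last first.
    by move=> n _; rewrite ltnNge leq_addr.
  by apply: ler_sum => n _; rewrite ltn_ord.
have : carleman (fun n => (g n)%:E) -> (+oo <= K%:E)%E.
  move=> <-; apply: lime_le.
    by apply: is_cvg_nneseries => n _ _; rewrite inve_ge0 poweR_ge0.
  apply: nearW => -[|N]; first by rewrite big_geq// lee_fin (le_trans _ (partial 0%N))// big_ord0.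
  rewrite big_add1/= big_mkord (eq_bigr (fun n : 'I_N => (c n.+1)%:E)).
    by rewrite sumEFin lee_fin partial.
  by move=> n _; rewrite inver gt_eqF ?powR_gt0// /c powRN.
by move=> /(_ cg); rewrite leye_eq.
Qed.

(** Dropping the first moment: a root larger than [2 ^- n] loses at most a
    factor [2] when its exponent decreases from [2 * n.+1] to [2 * n]. *)
Lemma roots_shift (r : nat -> R) : (forall n, 0 <= r n <= 1) ->
  (forall C, exists N, C < \sum_(n < N) r n.+1) ->
  exists b : nat -> R, [/\ forall n, 0 <= b n,
    forall n, b n.+1 ^+ (2 * n.+1) <= r n.+2 ^+ (2 * n.+2) &
    forall C, exists N, C < \sum_(n < N) b n.+1].
Proof.
move=> r01 rdiv.
have r0 n : 0 <= r n by case/andP: (r01 n).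
have r1 n : r n <= 1 by case/andP: (r01 n).
pose b n : R := if 2^-1 ^+ n <= r n.+1 then r n.+1 / 2 else 0.
have b0 n : 0 <= b n by rewrite /b; case: ifP => // _; rewrite divr_ge0.
exists b; split => //.
  move=> n; rewrite /b; case: ifPn => h; last by rewrite expr0n/= exprn_ge0.
  rewrite exprMn [(2 * n.+2)%N]mulnS addnC exprD ler_wpM2l ?exprn_ge0//.
  by rewrite mulnC exprM lerXn2r ?nnegrE ?exprn_ge0.
move=> C; have [N hN] := rdiv (2 * C + 2).
exists N.
have bl n : r n.+1 / 2 - 2^-1 ^+ n.+1 <= b n.
  rewrite /b; case: ifPn; first by rewrite gerBl exprn_ge0 ?invr_ge0.
  by rewrite -ltNge exprS => h; lra.
have geo M : \sum_(n < M) (2^-1 : R) ^+ n.+1 = 1 - 2^-1 ^+ M.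
  elim: M => [|M IH]; first by rewrite big_ord0 expr0 subrr.
  by rewrite big_ord_recr/= IH exprS; lra.
have S0 : \sum_(n < N) r n.+1 <= 1 + \sum_(n < N) r n.+2.
  apply: (@le_trans _ _ (\sum_(n < N.+1) r n.+1)).
    by rewrite big_ord_recr lerDl.
  by rewrite big_ord_recl lerD2r.
have : \sum_(n < N) (r n.+2 / 2 - 2^-1 ^+ n.+2) <= \sum_(n < N) b n.+1.
  by apply: ler_sum => n _; exact: bl.
have : \sum_(n < N) (2^-1 : R) ^+ n.+2 <= 2^-1.
  under eq_bigr do rewrite exprS; rewrite -mulr_sumr geo.
  have : 0 <= (2^-1 : R) ^+ N by rewrite exprn_ge0.
  by lra.
rewrite sumrB -mulr_suml; lra.
Qed.

End carleman_sequences.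

(** * The measure carried by the branches *)

Lemma root_power (R : realType) (y : R) n : 0 <= y ->
  ((1 + y) `^ (- (2 * n.+1)%:R^-1)) ^+ (2 * n.+1) * (1 + y) = 1.
Proof.
move=> y0; have y1 : 0 < 1 + y by rewrite ltr_wpDr.
rewrite -powR_mulrn ?powR_ge0// -powRrM mulNr mulVf ?pnatr_eq0//.
by rewrite powR_inv1 ?(ltW y1)// mulVf// gt_eqF.
Qed.

Section pivot.
Context (R : realType) (eta : option nat) (kappa : nat).
Variable mu : discrete_measure R eta kappa.
Local Notation borel := {measure set (measurableTypeR R) -> \bar R}.
Local Notation x0 := (circuit ord0 : digraph eta kappa).
Local Notation Rp := (`[0%R, +oo[%classic : set (measurableTypeR R)).
Variables (P : borel) (Q : J eta -> borel).
Hypothesis PS : S_representing (fun n => hphi mu n x0) P.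
Hypothesis QS : forall i, S_representing (fun n => hphi mu n (branch i 0)) (Q i).

Let m x : R := fine (mu [set x]).
Let mE x : mu [set x] = (m x)%:E. Proof. by rewrite fineK// dmeas_fin_num. Qed.
Let m_gt0 x : 0 < m x. Proof. by rewrite -lte_fin -mE dmeas_gt0. Qed.

(** Backward orbits never stop, so no term of the sequences vanishes and the
    convention on [0^-1] in the Carleman condition never comes into play. *)
Lemma phi_surjective (y : digraph eta kappa) : exists x, phi x = y.
Proof.
case: y => [r|i j]; last by exists (branch i j.+1).
have [rk|rk] := ltnP r kappa.
  exists (circuit (inord r.+1)); rewrite /phi/= inordK ?ltnS//.
  by rewrite -[in RHS](inord_val r).
exists x0; rewrite /phi/=; congr circuit; apply/val_inj/eqP.
by rewrite eqn_leq/= rk -ltnS ltn_ord.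
Qed.

Lemma hphi_gt0 n x : (0 < hphi mu n x)%E.
Proof.
have [y yx] : exists y, iter n (@phi eta kappa) y = x.
  elim: n => [|n [y yx]]; first by exists x.
  by have [z zy] := phi_surjective y; exists z; rewrite iterSr zy.
rewrite /hphi mule_gt0//; last by rewrite mE inver gt_eqF ?lte_fin ?invr_gt0.
apply: lt_le_trans (dmeas_gt0 mu y) _.
by apply: le_measure; rewrite ?inE// => z ->.
Qed.

Definition gap n : R := fine (hphi mu (n + kappa.+1) x0 - hphi mu n x0).

Let gam n : R := fine (hphi mu n x0).
Let gamE n : hphi mu n x0 = (gam n)%:E.
Proof. by rewrite fineK//; exact: (PS.2 n).1. Qed.

Lemma gapE n : (hphi mu (n + kappa.+1) x0 - hphi mu n x0)%E = (gap n)%:E.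
Proof. by rewrite /gap !gamE. Qed.

Let gam_step n : gam (n + kappa.+1) = gam n + gap n.
Proof. by rewrite /gap !gamE/= addrCA subrr addr0. Qed.

Let c i : {nonneg R} := NngNum (divr_ge0 (ltW (m_gt0 (branch i 0))) (ltW (m_gt0 x0))).

Let cE i : (mu [set branch i 0%N] / mu [set x0])%E = ((c i)%:num)%:E.
Proof. by rewrite !mE inver gt_eqF. Qed.

Definition branch_measure : borel := csum_measure (fun i => mscale (c i) (Q i)).

Lemma branch_measureE A :
  branch_measure A = (\esum_(i in [set: J eta]) (mu [set branch i 0%N] / mu [set x0] * Q i A))%E.
Proof. by rewrite /branch_measure csum_measureE; apply: eq_esum => i _; rewrite cE. Qed.

Let mXp n : measurable_fun Rp (fun t => (t ^+ n)%:E).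
Proof. by apply/measurable_EFinP; exact: measurable_funTS. Qed.

Let Xp0 n t : Rp t -> (0 <= (t ^+ n)%:E)%E.
Proof. by rewrite /= in_itv/= andbT lee_fin => t0; exact: exprn_ge0. Qed.

Let gap_esum n : (\esum_(i in [set: J eta]) hphi mu n (branch i 0) * mu [set branch i 0%N] =
  (gap n * m x0)%:E)%E.
Proof.
have := hphi_loop mu n; rewrite !gamE gam_step mE -!EFinM.
set S := (\esum_(_ in _) _)%E; case: S => [s| |]//= [].
by rewrite mulrDl => /addrI ->.
Qed.

Lemma branch_moment n :
  (\int[branch_measure]_(t in Rp) (t ^+ n)%:E = (gap n)%:E)%E.
Proof.
rewrite integral_csum_measure//; last exact: Xp0.
have x0V : (mu [set x0] / mu [set x0] = 1)%E by rewrite divee// mE// gt_eqF ?lte_fin.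
have -> : (\esum_(i in [set: J eta]) \int[mscale (c i) (Q i)]_(t in Rp) (t ^+ n)%:E =
   \esum_(i in [set: J eta]) (mu [set x0])^-1 * (hphi mu n (branch i 0) * mu [set branch i 0%N]))%E.
  apply: eq_esum => i _; rewrite ge0_integral_mscale//; last exact: Xp0.
  by rewrite -((QS i).2 n).2 -cE [LHS]muleC muleA [RHS]muleC.
have x0f : ((mu [set x0])^-1)%E \is a fin_num by rewrite mE inver gt_eqF.
have v0 : (0 <= (mu [set x0])^-1)%E by rewrite inve_ge0.
rewrite (ge0_esumZl _ v0 x0f); last by move=> i; rewrite mule_ge0// ltW// hphi_gt0.
by rewrite gap_esum mE inver gt_eqF// -EFinM mulrC mulfK// gt_eqF.
Qed.

Lemma branch_represents :
  S_representing (fun n => hphi mu (n + kappa.+1) x0 - hphi mu n x0)%E branch_measure.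
Proof.
split; last by move=> n; rewrite gapE branch_moment.
rewrite branch_measureE esum1// => i _.
by rewrite (QS i).1 mule0.
Qed.

(** The balance equation compares two measures on the half line: the one with
    density [t ^ (kappa + 1)] and the sum of [P] with the branch measure. *)
Let loop_weight (t : R) : R := Num.max t 0 ^+ kappa.+1.
Let loop_weight0 t : 0 <= loop_weight t.
Proof. by rewrite exprn_ge0// le_max lexx orbT. Qed.
Let m_loop_weight : measurable_fun setT (loop_weight : measurableTypeR R -> R).
Proof. by apply: measurable_funX; exact: measurable_maxr. Qed.

Lemma loop_weightE t : 0 <= t -> loop_weight t = t ^+ kappa.+1.
Proof. by move=> t0; rewrite /loop_weight (max_idPl t0). Qed.

Definition loop_measure : borel := density P m_loop_weight loop_weight0.
Definition entry_measure : borel := measure_add P branch_measure.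

Lemma loop_measureE A : A `<=` Rp ->
  (loop_measure A = \int[P]_(t in A) (t ^+ kappa.+1)%:E)%E.
Proof.
move=> AR; apply: eq_integral => t /set_mem/AR.
by rewrite /= in_itv/= andbT => /loop_weightE ->.
Qed.

Lemma entry_measureE A : entry_measure A = (P A + branch_measure A)%E.
Proof. exact: measure_addE. Qed.

Lemma balanced_of_measure_eq :
  (forall A : set (measurableTypeR R), measurable A -> loop_measure A = entry_measure A) ->
  balanced mu P Q.
Proof.
move=> e A mA AR; rewrite -loop_measureE// e//.
by rewrite entry_measureE branch_measureE.
Qed.

Lemma loop_moment n :
  (\int[loop_measure]_(t in Rp) (t ^+ n)%:E = (gam (n + kappa.+1))%:E)%E.
Proof.
rewrite -gamE (PS.2 _).2 [LHS]integral_mkcond [RHS]integral_mkcond integral_density.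
- apply: eq_integral => t _; rewrite /patch; case: ifPn => [|_]; last by rewrite mul0e.
  by rewrite inE/= in_itv/= andbT => /loop_weightE ->; rewrite -EFinM -exprD.
- exact/(measurable_restrictT _ _).1.
- by move=> t; rewrite /patch; case: ifPn => // /set_mem/Xp0.
Qed.

Lemma entry_moment n :
  (\int[entry_measure]_(t in Rp) (t ^+ n)%:E = (gam (n + kappa.+1))%:E)%E.
Proof.
rewrite ge0_integral_measure_add//; last exact: Xp0.
by rewrite branch_moment -(PS.2 _).2 gamE gam_step EFinD.
Qed.

Lemma balanced_of_roots (b : nat -> R) : (forall n, 0 <= b n) ->
  (forall n, b n.+1 ^+ (2 * n.+1) * (1 + gam (n.+2 * kappa.+1)) <= 1) ->
  (forall C, exists N, C < \sum_(n < N) b n.+1) -> balanced mu P Q.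
Proof.
move=> b0 b1 bdiv; apply: balanced_of_measure_eq.
apply: (half_line_uniqueness (k := kappa) (g := fun n => gam (n.+1 * kappa.+1)) (b := b)) => //.
- rewrite /loop_measure /= /density null_set_integral//; last exact: PS.1.
  by apply/measurable_EFinP; exact: measurable_funTS.
- by rewrite entry_measureE PS.1 branch_represents.1 adde0.
- by move=> n; rewrite loop_moment mulSn addnC.
- by move=> n; rewrite entry_moment mulSn addnC.
Qed.

(** The two measures to compare have the moments [gam (n.+1 * kappa.+1)]: the
    condition concerns the same sequence without the shift by one, which
    [roots_shift] absorbs. *)
Theorem balanced_of_carleman :
  carleman (fun j => hphi mu (j * kappa.+1) x0) -> balanced mu P Q.
Proof.
rewrite (_ : (fun j => _) = fun j => (gam (j * kappa.+1))%:E); last first.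
  by apply/funext => j; rewrite gamE.
have g0 n : 0 < gam (n * kappa.+1) by rewrite -lte_fin -gamE hphi_gt0.
move=> /(carleman_divergence g0) rdiv.
pose r' n : R := (1 + gam (n * kappa.+1)) `^ (- (2 * n)%:R^-1).
have r'01 n : 0 <= r' n <= 1.
  rewrite powR_ge0/= /r' powRN invf_le1 ?powR_gt0 ?addr_gt0//.
  by rewrite -[leLHS](powRr0 (1 + gam (n * kappa.+1))) ler_powR// lerDl ltW.
have r'X n : r' n.+1 ^+ (2 * n.+1) * (1 + gam (n.+1 * kappa.+1)) = 1.
  by apply: root_power; exact: ltW.
have [b [b0 br bdiv]] := roots_shift r'01 rdiv.
apply: (balanced_of_roots b0) => // n.
apply: le_trans (ler_wpM2r _ (br n)) _; first by rewrite addr_ge0// ltW.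
by rewrite r'X.
Qed.

Hypothesis eta0 : eta <> Some 0%N.

Lemma gap_gt0 n : 0 < gap n.
Proof.
have J1 : in_J eta 1 by case: eta eta0 => [[]|].
pose i : J eta := exist _ 1%N J1.
rewrite -(pmulr_lgt0 _ (m_gt0 x0)) -lte_fin -gap_esum.
apply: (@lt_le_trans _ _ (hphi mu n (branch i 0) * mu [set branch i 0%N])%E).
  by rewrite mule_gt0 ?hphi_gt0 ?dmeas_gt0.
apply: esum_ge; exists [set i]; first by split => //; exact: finite_set1.
by rewrite fsbig_set1.
Qed.

(** Moments of a positive measure on the half line: [s ^ i <= 1 + s ^ n]. *)
Lemma gap_le i n : (i <= n)%N ->
  gap (i * kappa.+1) <= gap 0 + gap (n * kappa.+1).
Proof.
move=> le_in; rewrite -lee_fin EFinD -!branch_moment.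
rewrite -ge0_integralD//; last exact: Xp0.
apply: ge0_le_integral => //; [exact: Xp0| |].
  by apply: emeasurable_funD.
move=> t /= tp; rewrite -EFinD lee_fin expr0.
move: tp; rewrite in_itv/= andbT => t0.
have [t1|/ltW t1] := leP t 1; last first.
  have : t ^+ (i * kappa.+1) <= t ^+ (n * kappa.+1).
    by apply: ler_weXn2l => //; rewrite leq_mul2r le_in orbT.
  by lra.
have := exprn_ile1 (i * kappa.+1) t0 t1.
by have := exprn_ge0 (n * kappa.+1) t0; lra.
Qed.

(** Summing differences, [gam (n.+1 * kappa.+1)] exceeds [gap (n * kappa.+1)] at
    most by a factor of linear growth in [n], whose root of order [2 * n] is
    bounded; hence a constant multiple of the roots for the differences works. *)
Theorem balanced_of_carleman_gap :
  carleman (fun j => hphi mu (j.+1 * kappa.+1) x0 - hphi mu (j * kappa.+1) x0)%E ->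
  balanced mu P Q.
Proof.
rewrite (_ : (fun j => _) = fun j => (gap (j * kappa.+1))%:E); last first.
  by apply/funext => j; rewrite mulSn addnC gapE.
have g0 n : 0 < gap (n * kappa.+1) by exact: gap_gt0.
move=> /(carleman_divergence g0) rdiv.
pose K := 2 + gap 0.
have K2 : 2 <= K by rewrite lerDl ltW// gap_gt0.
have K0 : 0 < K by apply: lt_le_trans K2.
have gam0 : gam 0 = 1 by rewrite /gam /hphi/= mE inver gt_eqF//= divff// gt_eqF.
have gam_le n : 1 + gam (n.+1 * kappa.+1) <= K * n.+1%:R * (1 + gap (n * kappa.+1)).
  have gam_gap : gam (n.+1 * kappa.+1) <= 1 + n.+1%:R * (gap 0 + gap (n * kappa.+1)).
    have : forall j, (j <= n.+1)%N ->
        gam (j * kappa.+1) <= 1 + j%:R * (gap 0 + gap (n * kappa.+1)).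
      elim=> [|j IH] jn; first by rewrite mul0n gam0 mul0r addr0.
      have := gap_le (i := j) (n := n) jn; have := IH (ltnW jn).
      by rewrite mulSn addnC gam_step -natr1; lra.
    exact.
  have n1 : 1 <= n.+1%:R :> R by rewrite ler1n.
  apply: le_trans (lerD (lexx 1) gam_gap) _.
  have d0 := gap_gt0 0; have d1 := g0 n.
  rewrite /K; move: (gap _) (gap _) n.+1%:R d0 d1 n1 => e d N d0 e0 N1.
  have : 0 <= N * (d * e) by rewrite !mulr_ge0 ?ltW//; lra.
  have : 0 <= N * e by rewrite mulr_ge0 ?ltW//; lra.
  by lra.
pose r n : R := (1 + gap (n * kappa.+1)) `^ (- (2 * n)%:R^-1).
have r0 n : 0 <= r n by exact: powR_ge0.
apply: (@balanced_of_roots (fun n => r n / (2 * K))).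
- by move=> n; rewrite divr_ge0// mulr_ge0// ltW.
- move=> n; apply: le_trans (ler_wpM2l _ (gam_le n.+1)) _.
    by rewrite exprn_ge0// divr_ge0// mulr_ge0// ltW.
  have rX : r n.+1 ^+ (2 * n.+1) * (1 + gap (n.+1 * kappa.+1)) = 1.
    by apply: root_power; exact: ltW.
  have nK : K * n.+2%:R <= (2 * K) ^+ (2 * n.+1).
    have K1 : 1 <= K by lra.
    apply: (@le_trans _ _ (2 ^+ (2 * n.+1) * K)).
      rewrite mulrC ler_wpM2r ?(ltW K0)// -natrX ler_nat.
      by apply: leq_trans (ltnW (ltn_expl (2 * n.+1) (isT : 1 < 2)%N)); lia.
    by rewrite exprMn ler_wpM2l ?exprn_ge0// mul2n doubleS exprS ler_peMr ?(ltW K0)// exprn_ege1.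
  rewrite expr_div_n mulrAC.
  rewrite ler_pdivrMr ?exprn_gt0 ?mulr_gt0// mul1r.
  by rewrite mulrCA rX mulr1.
move=> C; have [N hN] := rdiv (2 * K * C); exists N.
by rewrite -mulr_suml ltr_pdivlMr ?mulr_gt0// mulrC.
Qed.

End pivot.

(** * The M. Riesz extension theorem *)

Section riesz_extension.
Context (R : realType) (T : Type) (D : set T).
Local Notation graph := (set ((T -> R) * R)).
Implicit Types (G B : graph) (z : (T -> R) * R).

Definition lin_comb (c : R) z1 z2 : (T -> R) * R :=
  (fun x => c * z1.1 x + z2.1 x, c * z1.2 + z2.2).

(** The graph of a linear functional on a space of functions that is
    nonnegative on the functions that are nonnegative on [D]; single-valuedness
    is a consequence of positivity. *)
Definition positive_graph G := [/\ G (fun=> 0, 0),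
  forall c z1 z2, G z1 -> G z2 -> G (lin_comb c z1 z2) &
  forall z, G z -> (forall x, D x -> 0 <= z.1 x) -> 0 <= z.2].

Lemma positive_graph_le G z1 z2 : positive_graph G -> G z1 -> G z2 ->
  (forall x, D x -> z1.1 x <= z2.1 x) -> z1.2 <= z2.2.
Proof.
move=> [_ Glin Gpos] G1 G2 le12.
have := Gpos _ (Glin (-1) _ _ G1 G2); rewrite /= mulN1r addrC subr_ge0; apply.
by move=> x Dx; rewrite mulN1r addrC subr_ge0 le12.
Qed.

Lemma positive_graph_scale G c z : positive_graph G -> G z ->
  G (fun x => c * z.1 x, c * z.2).
Proof.
move=> [G0 Glin _] Gz; have := Glin c _ _ Gz G0; rewrite /lin_comb/= addr0.
by rewrite (_ : (fun x => _) = (fun x => c * z.1 x))//; apply/funext => x; rewrite addr0.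
Qed.

(** The functional extended to the span of its domain and [f], with the value
    [a] at [f]. *)
Definition adjoin G (f : T -> R) (a : R) : graph :=
  [set z | exists g t, G g /\ z = (fun x => g.1 x + t * f x, g.2 + t * a)].

(** A value for [f] that separates the values of the minorants of [f] from those
    of its majorants keeps the enlarged functional positive. *)
Lemma adjoin_positive G f a : positive_graph G ->
  (forall z, G z -> (forall x, D x -> z.1 x <= f x) -> z.2 <= a) ->
  (forall z, G z -> (forall x, D x -> f x <= z.1 x) -> a <= z.2) ->
  positive_graph (adjoin G f a).
Proof.
move=> GP lo up; have [G0 Glin Gpos] := GP; split.
- exists (fun=> 0, 0), 0; split => //; congr pair; rewrite ?mul0r ?addr0//.
  by apply/funext => x; rewrite mul0r addr0.
- move=> c _ _ [g [t [Gg ->]]] [h [s [Gh ->]]].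
  exists (lin_comb c g h), (c * t + s); split; first exact: Glin.
  by congr pair; [apply/funext => x|]; rewrite /=; ring.
- move=> _ [g [t [Gg ->]]] /= ge0.
  have [t0|t0|t0] := ltgtP t 0.
  + have nt : 0 < - t by rewrite oppr_gt0.
    have := up _ (positive_graph_scale (- t)^-1 GP Gg); rewrite /= => h.
    have : a <= (- t)^-1 * g.2.
      apply: h => x Dx; rewrite ler_pdivlMl//.
      by have := ge0 x Dx; rewrite mulNr; lra.
    by rewrite ler_pdivlMl// mulNr; lra.
  + have nt : 0 < t^-1 by rewrite invr_gt0.
    have := lo _ (positive_graph_scale (- t^-1) GP Gg); rewrite /= => h.
    have : - t^-1 * g.2 <= a.
      apply: h => x Dx; rewrite mulNr lerNl -subr_ge0.
      rewrite (_ : _ - _ = t^-1 * (g.1 x + t * f x)); last by field; rewrite gt_eqF.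
      by rewrite mulr_ge0 ?(ltW nt)// ge0.
    rewrite mulNr lerNl -subr_ge0 (_ : _ - _ = t^-1 * (g.2 + t * a)); last by field; rewrite gt_eqF.
    by rewrite pmulr_rge0.
  + have := Gpos _ Gg; rewrite t0 mul0r addr0; apply => x Dx.
    by have := ge0 x Dx; rewrite t0 mul0r addr0.
Qed.

(** Zorn's lemma on graphs ordered by inclusion; the empty graph is admitted
    because it is the union of the empty chain.  A maximal graph contains every
    [f] that lies between two elements of [B], as the supremum over the
    minorants of [f] is a separating value. *)
Theorem riesz_extension B : positive_graph B ->
  exists G, [/\ positive_graph G, B `<=` G &
    forall f, (exists p q, [/\ B p, B q & forall x, D x -> p.1 x <= f x <= q.1 x]) ->
    exists a, G (f, a)].
Proof.
move=> BP.
pose good G := G = set0 \/ positive_graph G /\ B `<=` G.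
have [G [Ggood Gmax]] : exists G, good G /\ forall G', G `<` G' -> ~ good G'.
  apply: Zorn_bigcup => F Fgood Ftot.
  have [[G1 FG1 G1n]|Fe] := pselect (exists2 G1, F G1 & G1 <> set0); last first.
    left; apply/seteqP; split => // z [X FX Xz]; apply: Fe; exists X => //.
    by move=> X0; move: Xz; rewrite X0.
  right.
  have G1P : positive_graph G1 /\ B `<=` G1 by case: (Fgood _ FG1).
  have FP X z : F X -> X z -> positive_graph X /\ B `<=` X.
    by move=> FX Xz; case: (Fgood _ FX) => // X0; move: Xz; rewrite X0.
  split; last by move=> z Bz; exists G1 => //; exact: G1P.2.
  split.
  - by exists G1 => //; case: G1P => -[].
  - move=> c z1 z2 [X FX Xz1] [Y FY Yz2].
    have [XY|YX] := Ftot _ _ FX FY.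
      by exists Y => //; have [[_ h _] _] := FP _ _ FY Yz2; apply: h => //; exact: XY.
    by exists X => //; have [[_ h _] _] := FP _ _ FX Xz1; apply: h => //; exact: YX.
  - by move=> z [X FX Xz]; have [[_ _ h] _] := FP _ _ FX Xz; exact: h.
have [GP BG] : positive_graph G /\ B `<=` G.
  case: Ggood => // G0; exfalso; apply: (Gmax B); last by right; split.
  split; first by rewrite G0.
  by case: BP => B0 _ _ /(_ _ B0); rewrite G0.
exists G; split => // f [p [q [Bp Bq pfq]]].
pose S := [set y | exists2 z, G z & y = z.2 /\ forall x, D x -> z.1 x <= f x].
have Sup z : G z -> (forall x, D x -> f x <= z.1 x) -> ubound S z.2.
  move=> Gz fz _ [w Gw [-> wf]]; apply: (positive_graph_le GP Gw Gz) => x Dx.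
  exact: le_trans (wf x Dx) (fz x Dx).
have S0 : S !=set0.
  by exists p.2; exists p; [exact: BG|split => // x /pfq /andP[]].
have Sq : has_sup S.
  split => //; exists q.2; apply: Sup; first exact: BG.
  by move=> x /pfq /andP[].
exists (sup S).
have GfP : positive_graph (adjoin G f (sup S)).
  apply: adjoin_positive => // z Gz h.
  - by apply: sup_ubound; [case: Sq|exists z].
  - by apply: ge_sup => //; exact: Sup.
have GGf : G `<=` adjoin G f (sup S).
  move=> z Gz; exists z, 0; split => //; rewrite mul0r addr0.
  rewrite [LHS]surjective_pairing; congr pair.
  by apply/funext => x; rewrite mul0r addr0.
have : adjoin G f (sup S) `<=` G.
  apply: contrapT => nG; apply: (Gmax (adjoin G f (sup S))) => //; right.
  by split => //; exact: subset_trans BG GGf.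
apply; exists (fun=> 0, 0), 1; split; first by case: GP.
by congr pair; [apply/funext => x|]; rewrite /= mul1r add0r.
Qed.

End riesz_extension.

(** * Polynomials nonnegative on a half line *)

Section positive_polynomials.
Context (R : realType).
Implicit Types p q A B : {poly R}.

Definition nonneg_from (a : R) p := forall x, a <= x -> 0 <= p.[x].

(** Horner's scheme: a polynomial that stays away from [0] becomes unbounded when
    it is multiplied by ['X], and remains so when a constant is added. *)
Lemma poly_unbounded p M : (1 < size p)%N ->
  exists b, forall x, b <= x -> M <= `|p.[x]|.
Proof.
elim/poly_ind: p M => [|q c IH] M; first by rewrite size_poly0.
rewrite size_MXaddC; case: ifP => // _; rewrite ltnS => sq.
have [b [d [d0 bP]]] : exists b d, 0 < d /\ forall x, b <= x -> d <= `|q.[x]|.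
  have [s1|s1] := leqP (size q) 1; last first.
    by have [b bP] := IH 1 s1; exists b, 1.
  exists 0, `|q`_0|; split; last first.
    by move=> x _; rewrite {2}(size1_polyC s1) hornerC.
  rewrite normr_gt0; move: sq; rewrite lt0n size_poly_eq0; apply: contra_neq => q0.
  by rewrite (size1_polyC s1) q0.
exists (Num.max b (Num.max 0 ((M + `|c|) / d))) => x.
rewrite !ge_max => /and3P[/bP bx x0]; rewrite ler_pdivrMr// => h.
rewrite hornerMXaddC -[c in leRHS]opprK; apply: le_trans (lerB_dist _ _).
rewrite normrN normrM (ger0_norm x0) lerBrDr (le_trans h)//.
by rewrite mulrC ler_wpM2r.
Qed.

Lemma horner_ge0_right p a : (forall x, a < x -> 0 <= p.[x]) -> 0 <= p.[a].
Proof.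
move=> p0; have cv : p.[x] @[x --> a^'+] --> p.[a].
  by apply: cvg_at_right_filter; exact: continuous_horner.
apply: (cvgr_to_ge cv).
by near=> x; apply: p0; near: x; exact: nbhs_right_gt.
Unshelve. all: by end_near. Qed.

Lemma horner_le0_left p a b : b < a -> (forall x, b < x < a -> p.[x] <= 0) -> p.[a] <= 0.
Proof.
move=> ba p0; have cv : p.[x] @[x --> a^'-] --> p.[a].
  by apply: cvg_at_left_filter; exact: continuous_horner.
apply: (cvgr_to_le cv).
near=> x; apply: p0; apply/andP; split; near: x; first exact: nbhs_left_gt.
exact: nbhs_left_lt.
Unshelve. all: by end_near. Qed.

Lemma poly_attains_min p a : nonneg_from a p -> (1 < size p)%N ->
  exists2 c, a <= c & forall x, a <= x -> p.[c] <= p.[x].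
Proof.
move=> p0 /(poly_unbounded p.[a])[b bP].
have ab : a <= Num.max a b by rewrite le_max lexx.
have [|c] := @EVT_min R (horner p) _ _ ab.
  by apply: continuous_subspaceT => x; exact: continuous_horner.
rewrite in_itv/= => /andP[ac _] cP; exists c => // x ax.
have [xb|bx] := leP x (Num.max a b); first by apply: cP; rewrite in_itv/= ax.
apply: le_trans (cP a _) _; first by rewrite in_itv/= lexx.
rewrite -[leRHS]ger0_norm ?p0//; apply: bP; apply: le_trans (ltW bx).
by rewrite le_max lexx orbT.
Qed.

(** Two kinds of positivity are at hand: against [P] for polynomials nonnegative
    on [0, +oo[, and against the branch measure after division by ['X - 1]. *)
Definition shifted_cone p := exists A B,
  [/\ nonneg_from 0 A, nonneg_from 0 B & p = A + ('X - 1) * B].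

Lemma shifted_coneD p q : shifted_cone p -> shifted_cone q -> shifted_cone (p + q).
Proof.
move=> [A [B [A0 B0 ->]]] [C [D [C0 D0 ->]]]; exists (A + C), (B + D); split.
- by move=> x x0; rewrite hornerD addr_ge0//; [exact: A0|exact: C0].
- by move=> x x0; rewrite hornerD addr_ge0//; [exact: B0|exact: D0].
- by ring.
Qed.

Lemma shifted_coneM p q : shifted_cone p -> shifted_cone q -> shifted_cone (p * q).
Proof.
move=> [A [B [A0 B0 ->]]] [C [D [C0 D0 ->]]].
exists (A * C + ('X - 1) ^+ 2 * (B * D)), (A * D + B * C); split.
- move=> x x0; rewrite hornerD !hornerM -expr2.
  have [a b c d] := And4 (A0 _ x0) (B0 _ x0) (C0 _ x0) (D0 _ x0).
  by apply: addr_ge0; [exact: mulr_ge0|apply: mulr_ge0; [exact: sqr_ge0|exact: mulr_ge0]].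
- move=> x x0; rewrite hornerD !hornerM.
  have [a b c d] := And4 (A0 _ x0) (B0 _ x0) (C0 _ x0) (D0 _ x0).
  by apply: addr_ge0; exact: mulr_ge0.
- by ring.
Qed.

Lemma shifted_cone_nonneg p : nonneg_from 0 p -> shifted_cone p.
Proof.
move=> p0; exists p, 0; split => //; last by rewrite mulr0 addr0.
by move=> x _; rewrite horner0.
Qed.

Lemma shifted_coneX : shifted_cone ('X - 1).
Proof.
exists 0, 1; split; last by rewrite add0r mulr1.
- by move=> x _; rewrite horner0.
- by move=> x _; rewrite hornerE.
Qed.

(** Subtract the minimum on the half line: it is attained at a root of even
    order, or at the end point, where the factor ['X - 1] splits off. *)
Theorem shifted_cone_of_nonneg p : nonneg_from 1 p -> shifted_cone p.
Proof.
have [n] := ubnP (size p); elim: n p => // n IH p pn p1.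
have cst c : 0 <= c -> shifted_cone c%:P.
  by move=> c0; apply: shifted_cone_nonneg => x _; rewrite hornerC.
have [sp|sp] := leqP (size p) 1.
  have [c pE] : exists c, p = c%:P by exists p`_0; exact: size1_polyC.
  by rewrite pE; apply: cst; have := p1 1 (lexx _); rewrite pE hornerC.
have [a a1 amin] := poly_attains_min p1 sp.
have pE : p = p.[a]%:P + (p - p.[a]%:P) by rewrite addrC subrK.
rewrite pE; apply: shifted_coneD; first by apply: cst; exact: p1.
have p0 : p - p.[a]%:P != 0.
  rewrite subr_eq0; apply: contraTneq sp => ->; rewrite -leqNgt.
  exact: size_polyC_leq1.
have sizep : (size (p - p.[a]%:P)%R <= size p)%N.
  apply: leq_trans (size_polyD _ _) _; rewrite size_polyN geq_max leqnn.
  exact: leq_trans (size_polyC_leq1 _) (ltnW sp).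
have : root (p - p.[a]%:P) a by rewrite /root !hornerE subrr.
move=> /factor_theorem[r rE].
have r0 : r != 0 by apply: contraNneq p0 => r0; rewrite rE r0 mul0r.
have sr : (size r < n)%N.
  by move: sizep; rewrite rE size_Mmonic ?monicXsubC// size_XsubC addn2/= => /leq_trans; apply.
have rP x : 1 <= x -> 0 <= r.[x] * (x - a).
  move=> x1; have -> : r.[x] * (x - a) = p.[x] - p.[a].
    have := congr1 (horner^~ x) rE; rewrite !hornerE => ->.
    by [].
  by rewrite subr_ge0 amin.
have r_right x : a < x -> 0 <= r.[x].
  move=> ax; have := rP x (le_trans a1 (ltW ax)).
  by rewrite pmulr_lge0// subr_gt0.
have ra := horner_ge0_right r_right.
have [a1'|a1'] := eqVneq a 1.
  rewrite rE a1' mulrC; apply: shifted_coneM; first exact: shifted_coneX.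
  apply: IH => // x; rewrite le_eqVlt => /orP[/eqP <-|x1]; first by rewrite -a1'.
  by apply: r_right; rewrite a1'.
have {a1'} a1' : 1 < a by rewrite lt_neqAle eq_sym a1'.
have ra0 : r.[a] = 0.
  apply/le_anti; rewrite ra andbT.
  apply: (horner_le0_left a1') => x /andP[x1 xa].
  have := rP x (ltW x1); rewrite nmulr_lge0// subr_lt0//.
have : root r a by rewrite /root ra0.
move=> /factor_theorem[s sE].
have s0 : s != 0 by apply: contraNneq r0 => s0; rewrite sE s0 mul0r.
rewrite rE sE -mulrA mulrC; apply: shifted_coneM.
  by apply: shifted_cone_nonneg => x _; rewrite !hornerE -expr2 sqr_ge0.
have s_off x : 1 <= x -> x != a -> 0 <= s.[x].
  move=> x1 xa; have := rP x x1.
  rewrite sE !hornerE -mulrA -expr2 pmulr_lge0// lt_neqAle sqr_ge0 andbT eq_sym.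
  by rewrite expf_eq0/= subr_eq0.
apply: IH.
  apply: leq_trans _ sr; rewrite ltnS.
  by rewrite sE size_Mmonic ?monicXsubC// size_XsubC addn2/=.
move=> x x1; have [->|xa] := eqVneq x a; last exact: s_off.
apply: horner_ge0_right => y ay; apply: s_off; first by rewrite (le_trans a1)// ltW.
by rewrite gt_eqF.
Qed.

End positive_polynomials.

(** * Step functions on geometric grids *)

Section geometric_steps.
Context (R : realType).
Variables (r : R) (n : nat).
Hypothesis r1 : 1 < r.

Definition step_weight j : R := r ^+ (j.+1 * n) - r ^+ (j * n).

(** The step function that equals [r ^+ (j * n)] between [r ^+ j.-1] and
    [r ^+ j], frozen from [r ^+ N] on. *)
Definition geometric_step N (x : R) : R :=
  1 + \sum_(j < N) step_weight j * ((r ^+ j < x)%R)%:R.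

Lemma step_weight_ge0 j : 0 <= step_weight j.
Proof. by rewrite subr_ge0 ler_weXn2l ?(ltW r1)// leq_mul2r leqnSn orbT. Qed.

Lemma step_weightS j : step_weight j.+1 = r ^+ n * step_weight j.
Proof. by rewrite /step_weight mulrBr -!exprD !mulSn. Qed.

Let r_mono i j : (i <= j)%N -> r ^+ i <= r ^+ j.
Proof. by move=> ij; rewrite ler_weXn2l// ltW. Qed.

Lemma geometric_stepS N x :
  geometric_step N.+1 x = geometric_step N x + step_weight N * ((r ^+ N < x)%R)%:R.
Proof. by rewrite /geometric_step big_ord_recr/= addrA. Qed.

Let step_full N x : r ^+ N < x -> geometric_step N.+1 x = r ^+ (N.+1 * n).
Proof.
move=> Nx; rewrite geometric_stepS Nx mulr1.
have full M : (M <= N)%N -> geometric_step M x = r ^+ (M * n).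
  elim: M => [|M IH] MN; first by rewrite /geometric_step big_ord0 addr0 mul0n expr0.
  have Mx : r ^+ M < x by apply: le_lt_trans Nx; apply: r_mono; exact: ltnW.
  by rewrite geometric_stepS Mx mulr1 IH ?(ltnW MN)// addrC subrK.
by rewrite full// addrC subrK.
Qed.

Lemma geometric_step_le N x : 1 <= x -> geometric_step N x <= r ^+ n * x ^+ n.
Proof.
move=> x1; have r0 : 0 <= r by rewrite ltW// (lt_trans ltr01).
elim: N => [|N IH].
  rewrite /geometric_step big_ord0 addr0 -exprMn exprn_ege1//.
  by rewrite mulr_ege1// ltW.
have [Nx|Nx] := ltP (r ^+ N) x; last by rewrite geometric_stepS ltNge Nx/= mulr0 addr0.
rewrite step_full// mulSn exprD exprM ler_wpM2l ?exprn_ge0//.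
by rewrite lerXn2r ?nnegrE ?exprn_ge0// ?(ltW Nx)// (le_trans ler01).
Qed.

Lemma geometric_step_monotone x M N : (M <= N)%N -> geometric_step M x <= geometric_step N x.
Proof.
move=> /subnK <-; elim: (N - M)%N => [//|k IH].
by rewrite addSn geometric_stepS (le_trans IH)// lerDl mulr_ge0// step_weight_ge0.
Qed.

Lemma geometric_step_ge N x : 0 <= x -> x <= r ^+ N -> x ^+ n <= geometric_step N x.
Proof.
move=> x0; elim: N => [|N IH] xN.
  by rewrite /geometric_step big_ord0 addr0 exprn_ile1.
have [Nx|Nx] := ltP (r ^+ N) x; last first.
  by rewrite (le_trans (IH Nx))// geometric_step_monotone.
rewrite step_full// exprM lerXn2r ?nnegrE ?exprn_ge0//.
by rewrite ltW// (lt_trans ltr01).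
Qed.

Lemma geometric_step_tail N x : 1 <= x ->
  x ^+ n <= geometric_step N x + x ^+ n.+1 / r ^+ N.
Proof.
move=> x1; have x0 : 0 <= x by rewrite (le_trans ler01).
have rN : 0 < r ^+ N by rewrite exprn_gt0// (lt_trans ltr01).
have [xN|Nx] := leP x (r ^+ N).
  apply: le_trans (geometric_step_ge x0 xN) _.
  by rewrite lerDl divr_ge0 ?(ltW rN)// exprn_ge0.
have : x ^+ n <= x ^+ n.+1 / r ^+ N.
  by rewrite ler_pdivlMr// exprSr ler_wpM2l ?exprn_ge0// ltW.
move=> /le_trans; apply; rewrite lerDr addr_ge0// sumr_ge0// => j _.
by rewrite mulr_ge0 ?step_weight_ge0.
Qed.

End geometric_steps.

(** [H a] stands for the mass of [{x | a < x}]; the two bounds are what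
    positivity of a functional says about the step functions. *)
Definition tail_function (R : realType) (mom : nat -> R) (H : R -> R) := [/\
  forall a b, a <= b -> H b <= H a, forall a, 0 <= H a,
  forall a, a < 1 -> H a = mom 0,
  forall r n N, 1 < r ->
    mom 0 + \sum_(j < N) step_weight r n j * H (r ^+ j) <= r ^+ n * mom n &
  forall r n N, 1 < r ->
    mom n <= mom 0 + \sum_(j < N) step_weight r n j * H (r ^+ j) + mom n.+1 / r ^+ N].

(** The values of a positive functional at the indicators of rays. *)
Lemma tail_function_exists (R : realType) (G : set ((R -> R) * R)) (mom : nat -> R) :
  positive_graph [set x | 1 <= x] G -> (forall n, G (fun x => x ^+ n, mom n)) ->
  (forall a : R, exists h, G (fun x => ((a < x)%R)%:R, h)) ->
  exists H, tail_function mom H.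
Proof.
move=> GP Gmom /choice[H GH]; exists H.
have [G0 Glin Gpos] := GP.
have Gle z1 z2 := @positive_graph_le _ _ _ G z1 z2 GP.
have Gstep r n N : G (geometric_step r n N,
    mom 0 + \sum_(j < N) step_weight r n j * H (r ^+ j)).
  elim: N => [|N IH].
    rewrite big_ord0 addr0 (_ : geometric_step _ _ _ = fun x => x ^+ 0)//.
    by apply/funext => x; rewrite /geometric_step big_ord0 addr0.
  have := Glin (step_weight r n N) _ _ (GH (r ^+ N)) IH.
  rewrite /lin_comb/= big_ord_recr/= [_ * H _ + _]addrC addrA.
  rewrite (_ : (fun x => _) = geometric_step r n N.+1)//.
  by apply/funext => x; rewrite geometric_stepS addrC.
split.
- move=> a b ab; apply: (Gle _ _ (GH b) (GH a)) => x _ /=.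
  by rewrite ler_nat; case: ltP => // bx; rewrite (le_lt_trans ab bx).
- by move=> a; apply: (Gpos _ (GH a)).
- move=> a a1; have e x : 1 <= x -> ((a < x)%R)%:R = x ^+ 0 :> R.
    by move=> x1; rewrite (lt_le_trans a1 x1).
  by apply/le_anti/andP; split;
    [apply: (Gle _ _ (GH a) (Gmom 0))|apply: (Gle _ _ (Gmom 0) (GH a))] => x x1 /=;
    rewrite e.
- move=> r n N r1.
  apply: (Gle _ _ (Gstep r n N) (positive_graph_scale (r ^+ n) GP (Gmom n))) => x x1 /=.
  exact: geometric_step_le.
- move=> r n N r1; rewrite addrC [_ / _]mulrC.
  apply: (Gle _ _ (Gmom n) (Glin (r ^+ N)^-1 _ _ (Gmom n.+1) (Gstep r n N))) => x x1 /=.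
  by rewrite addrC [_^-1 * _]mulrC; exact: geometric_step_tail.
Qed.

(** * A measure with prescribed tails *)

Section quantile_measure.
Context (R : realType).
Local Notation borel := {measure set (measurableTypeR R) -> \bar R}.
Variables (mom : nat -> R) (H : R -> R).
Hypothesis HT : tail_function mom H.

Let H_noninc a b : a <= b -> H b <= H a. Proof. by case: HT => + _ _ _ _; exact. Qed.
Let H_ge0 a : 0 <= H a. Proof. by case: HT. Qed.
Let H_start a : a < 1 -> H a = mom 0. Proof. by case: HT => _ _ + _ _; exact. Qed.
Let H0 : H 0 = mom 0. Proof. exact/H_start/ltr01. Qed.
Let H_le a : 0 <= a -> H a <= mom 0. Proof. by rewrite -H0; exact: H_noninc. Qed.

(** Tails: [H (2 ^ j)] is at most a constant over [2 ^ j]. *)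
Let H_decay u : 0 < u -> exists b, 0 <= b /\ forall a, u < H a -> a <= b.
Proof.
move=> u0; pose C := 2 * mom 1; pose j := (Num.truncn (C / u)).+1.
exists (2 ^+ j); split => [|a ua]; first by rewrite exprn_ge0.
rewrite leNgt; apply/negP => ja.
have uj : u < H (2 ^+ j) by apply: lt_le_trans ua (H_noninc (ltW ja)).
have wj i : step_weight (2 : R) 1 i = 2 ^+ i.
  by rewrite /step_weight !muln1 exprS; ring.
have : 2 ^+ j * H (2 ^+ j) <= C.
  case: HT => _ _ _ /(_ 2 1%N j.+1 (ltr1n _ 2)) + _.
  rewrite big_ord_recr/= wj expr1; apply: le_trans.
  rewrite addrA lerDr addr_ge0 ?H0 -?H0// sumr_ge0// => i _.
  by rewrite wj mulr_ge0// exprn_ge0.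
apply/negP; rewrite -ltNge.
apply: (@lt_trans _ _ (2 ^+ j * u)); last by rewrite ltr_pM2l// exprn_gt0.
rewrite -ltr_pdivrMr//; apply: lt_le_trans (truncnS_gt _) _.
by rewrite -natrX ler_nat ltnW// ltn_expl.
Qed.

(** The quantile function of [H]; adding [0] to the set keeps it inhabited. *)
Let above u := [set a | a = 0 \/ u < H a].
Let quantile (u : R) : R := if 0 < u then sup (above u) else 0.

Let above_sup u : 0 < u -> has_sup (above u).
Proof.
move=> u0; split; first by exists 0; left.
by have [b [b0 bP]] := H_decay u0; exists b => a [->//|/bP].
Qed.

(* [u] enters the tail beyond [a] exactly when some value of [H] strictly beyond
   [a] exceeds it; hence the two one-sided comparisons of the tails with [H]
   below. *)
Let quantile_gtP u a : 0 <= a -> 0 < u -> (a < quantile u) <-> exists2 b, a < b & u < H b.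
Proof.
move=> a0 u0; rewrite /quantile u0; split => [|[b ab ub]].
  move=> /(sup_gt (above_sup u0).1)[b [->|ub] ab]; last by exists b.
  by move: ab; rewrite ltNge a0.
by apply: lt_le_trans ab _; apply: sup_ubound; [exact: (above_sup u0).2|right].
Qed.

Let quantile_ge0 u : 0 <= quantile u.
Proof.
rewrite /quantile; case: ifP => // u0.
by apply: sup_ubound; [exact: (above_sup u0).2|left].
Qed.

Let quantile_ge1 u : 0 < u < mom 0 -> 1 <= quantile u.
Proof.
move=> /andP[u0 um]; rewrite leNgt; apply/negP => q1.
have q0 := quantile_ge0 u.
have : ~ (quantile u < quantile u) by rewrite ltxx.
apply; apply/(quantile_gtP q0 u0); exists ((quantile u + 1) / 2); first by lra.
by rewrite H_start//; lra.
Qed.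

Let measurable_quantile : measurable_fun setT (quantile : measurableTypeR R -> measurableTypeR R).
Proof.
apply: (measurability _ (RGenOInfty.measurableE R)) => // _ [_ [a ->] <-].
rewrite setTI; have [a0|a0] := ltP a 0.
  rewrite (_ : _ @^-1` _ = setT)//; apply/seteqP; split => // u _ /=.
  by rewrite in_itv/= andbT (lt_le_trans a0).
apply: is_interval_measurable => u v /=; rewrite !in_itv/= !andbT => qu qv w /andP[uw wv].
have pos x : a < quantile x -> 0 < x.
  by rewrite /quantile; case: ifP => // _; rewrite ltNge a0.
have w0 : 0 < w by apply: lt_le_trans (pos _ qu) uw.
rewrite in_itv/= andbT; apply/(quantile_gtP a0 w0).
have [b ab vb] := (quantile_gtP a0 (pos _ qv)).1 qv.
by exists b => //; apply: le_lt_trans vb.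
Qed.

Let base : set (measurableTypeR R) := `]0, (mom 0)[%classic.
Let mbase : measurable base. Proof. exact: measurable_itv. Qed.

(** The image of Lebesgue measure by the quantile function: countable additivity
    comes for free. *)
Definition quantile_measure : borel :=
  measure_function_pushforward__canonical__measure_function_Measure
    (mrestr (@lebesgue_measure R) mbase) measurable_quantile.

Let qmE A : quantile_measure A = lebesgue_measure (quantile @^-1` A `&` base).
Proof. by []. Qed.

Let lebesgue_from0 c : 0 <= c -> lebesgue_measure (`]0, c[%classic : set R) = c%:E.
Proof.
move=> c0; rewrite lebesgue_measure_itv/= lte_fin; case: ltP => h; first by rewrite sube0.
by congr EFin; apply/le_anti; rewrite h c0.
Qed.

Lemma quantile_measure_lt1 : quantile_measure `]-oo, 1[%classic = 0%E.
Proof.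
rewrite qmE (_ : _ `&` _ = set0) ?measure0//; apply/seteqP; split => // u [/=].
by rewrite /base/= !in_itv/= => qu /quantile_ge1; rewrite leNgt qu.
Qed.

Lemma quantile_measure_ge1 : quantile_measure `[1, +oo[%classic = (mom 0)%:E.
Proof.
rewrite qmE (_ : _ `&` _ = base) ?lebesgue_from0 -?H0//.
apply/seteqP; split => [u []//|u ub]; split => //=.
by rewrite in_itv/= andbT quantile_ge1//; move: ub; rewrite /base/= in_itv.
Qed.

Lemma quantile_measure_tail_le a : 0 <= a ->
  (quantile_measure `]a, +oo[%classic <= (H a)%:E)%E.
Proof.
move=> a0; rewrite qmE -lebesgue_from0//; apply: le_measure; rewrite ?inE.
- apply: measurableI => //; rewrite -[X in measurable X]setTI.
  exact: measurable_quantile measurableT _ (measurable_itv _).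
- exact: measurable_itv.
move=> u []; rewrite /base/= !in_itv/= andbT => qu /andP[u0 _].
have [b ab ub] := (quantile_gtP a0 u0).1 qu.
by rewrite u0 (lt_le_trans ub)// H_noninc// ltW.
Qed.

Lemma quantile_measure_tail_ge a b : 0 <= a -> a < b ->
  ((H b)%:E <= quantile_measure `]a, +oo[%classic)%E.
Proof.
move=> a0 ab; rewrite qmE -lebesgue_from0//; apply: le_measure; rewrite ?inE.
- exact: measurable_itv.
- apply: measurableI => //; rewrite -[X in measurable X]setTI.
  exact: measurable_quantile measurableT _ (measurable_itv _).
move=> u; rewrite /base/= !in_itv/= andbT => /andP[u0 ub]; split.
  by apply/(quantile_gtP a0 u0); exists b.
by rewrite u0 (lt_le_trans ub)// H_le// (le_trans a0)// ltW.
Qed.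

End quantile_measure.

(** * The moments of the quantile measure *)

Section quantile_moments.
Context (R : realType).
Local Notation borel := {measure set (measurableTypeR R) -> \bar R}.
Local Notation D1 := (`[1%R, +oo[%classic : set (measurableTypeR R)).

Lemma le_of_geometric_error (a b c r : R) : 1 < r ->
  (forall N, a <= b + c / r ^+ N) -> a <= b.
Proof.
move=> r1 abc.
have cv : (fun N => b + c * (r^-1) ^+ N) @ \oo --> b + c * 0.
  apply: cvgD; first exact: cvg_cst.
  apply: cvgMl_tmp; apply: cvg_expr.
  rewrite ger0_norm ?invr_ge0 ?ltW ?(lt_trans ltr01)// invf_lt1// (lt_trans ltr01)//.
rewrite -[b](addr0 b) -[X in b + X](mulr0 c); apply: (cvgr_to_ge cv).
by apply: nearW => N; rewrite exprVn abc.
Qed.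

Variables (mom : nat -> R) (H : R -> R).
Hypothesis HT : tail_function mom H.
Let sigma : borel := quantile_measure HT.

Let tail a : R := fine (sigma `]a, +oo[%classic).

Let tailE a : 0 <= a -> sigma `]a, +oo[%classic = (tail a)%:E.
Proof.
move=> a0; rewrite fineK// ge0_fin_numE//.
by apply: le_lt_trans (quantile_measure_tail_le HT a0) _; rewrite ltry.
Qed.

Let measurable_step r n N : measurable_fun setT (geometric_step r n N : measurableTypeR R -> R).
Proof.
elim: N => [|N IH].
  rewrite (_ : geometric_step _ _ _ = cst 1)//.
  by apply/funext => x; rewrite /geometric_step big_ord0 addr0.
rewrite (_ : geometric_step _ _ _ = fun x => geometric_step r n N x +
    step_weight r n N * (\1_(`]r ^+ N, +oo[%classic : set (measurableTypeR R)) x)).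
  by apply: measurable_funD => //; apply: measurable_funM => //.
apply/funext => x; rewrite geometric_stepS; congr (_ + _ * _).
rewrite indicE; congr (nat_of_bool _)%:R; apply/idP/idP; rewrite inE/= in_itv/= andbT//.
Qed.

Let integral_step r n N : 1 < r ->
  (\int[sigma]_(x in D1) (geometric_step r n N x)%:E =
   (mom 0 + \sum_(j < N) step_weight r n j * tail (r ^+ j))%:E)%E.
Proof.
move=> r1; have r0 : 0 <= r by rewrite ltW// (lt_trans ltr01).
elim: N => [|N IH].
  under eq_integral do rewrite /geometric_step big_ord0 addr0.
  rewrite integral_cst// mul1e quantile_measure_ge1.
 by rewrite big_ord0 addr0.
have E x : ((geometric_step r n N.+1 x)%:E = (geometric_step r n N x)%:E +
    (step_weight r n N)%:E * (\1_(`]r ^+ N, +oo[%classic : set (measurableTypeR R)) x)%:E)%E.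
  rewrite -EFinM -EFinD geometric_stepS; congr (_ + _ * _)%:E.
  rewrite indicE; congr (nat_of_bool _)%:R; apply/idP/idP; rewrite inE/= in_itv/= andbT//.
under eq_integral do rewrite E.
have w0 := step_weight_ge0 n r1 N.
rewrite ge0_integralD//; last first.
- apply: emeasurable_funM => //; apply/measurable_EFinP/measurable_funTS.
  exact: measurable_indic.
- by move=> x _; rewrite mule_ge0// lee_fin.
- by apply/measurable_EFinP/measurable_funTS; exact: measurable_step.
- move=> x _; rewrite lee_fin addr_ge0// sumr_ge0// => j _.
  by rewrite mulr_ge0// step_weight_ge0.
rewrite IH ge0_integralZl_EFin//; last first.
  by apply/measurable_EFinP/measurable_funTS; exact: measurable_indic.
rewrite integral_indic// setIidl; last first.
  move=> x /=; rewrite !in_itv/= !andbT => h; rewrite (le_trans _ (ltW h))//.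
  by rewrite exprn_ege1// ltW.
by rewrite tailE ?exprn_ge0// big_ord_recr/= addrA EFinD.
Qed.

Let Xmeas n : measurable_fun D1 (fun x : measurableTypeR R => (x ^+ n)%:E).
Proof. by apply/measurable_EFinP; exact: measurable_funTS. Qed.

Let D1_ge1 x : D1 x -> 1 <= x. Proof. by rewrite /= in_itv/= andbT. Qed.

Let X0 n x : D1 x -> (0 <= (x ^+ n)%:E)%E.
Proof. by move=> /D1_ge1 x1; rewrite lee_fin exprn_ge0// (le_trans ler01). Qed.

(* Tails of the measure lie below [H]; monotone convergence of the step
   functions, so that no finiteness is needed beforehand. *)
Let moment_le r n : 1 < r ->
  (\int[sigma]_(x in D1) (x ^+ n)%:E <= (r ^+ n * mom n)%:E)%E.
Proof.
move=> r1.
have step0 N x : (0 <= (geometric_step r n N x)%:E)%E.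
  rewrite lee_fin addr_ge0// sumr_ge0// => j _.
  by rewrite mulr_ge0// step_weight_ge0.
have mstep N : measurable_fun D1 (fun x => (geometric_step r n N x)%:E).
  by apply/measurable_EFinP/measurable_funTS; exact: measurable_step.
have nd x : D1 x -> nondecreasing_seq (fun N => (geometric_step r n N x)%:E).
  by move=> _ M N MN; rewrite lee_fin geometric_step_monotone.
have mD1 : measurable D1 by exact: measurable_itv.
apply: (@le_trans _ _ (\int[sigma]_(x in D1) limn (fun N => (geometric_step r n N x)%:E))%E).
  apply: ge0_le_integral => //.
  - by move=> x D1x; exact: X0.
  - apply: (@emeasurable_fun_cvg _ _ _ _ (fun N x => (geometric_step r n N x)%:E)) => // x D1x.
    exact/ereal_nondecreasing_is_cvgn/nd.
  - move=> x D1x; apply: lime_ge; first exact/ereal_nondecreasing_is_cvgn/nd.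
    have [M xM] : exists M, x <= r ^+ M.
      pose M := (Num.truncn (x / (r - 1))).+1; exists M.
      have r10 : 0 < r - 1 by rewrite subr_gt0.
      have bern k : 1 + k%:R * (r - 1) <= r ^+ k.
        elim: k => [|k IH]; first by rewrite mul0r addr0 expr0.
        have := ler_wpM2l (ltW (lt_trans ltr01 r1)) IH; rewrite -exprS => /(le_trans _); apply.
        rewrite -natr1 -subr_ge0 (_ : _ - _ = k%:R * (r - 1) ^+ 2); last by ring.
        by rewrite mulr_ge0// sqr_ge0.
      apply: le_trans (bern M); rewrite -lerBlDl lerBlDr.
      have := truncnS_gt (x / (r - 1)); rewrite ltr_pdivrMr// => /ltW /le_trans; apply.
      by rewrite lerDl.
    exists M => // N /= MN; rewrite lee_fin.
    apply: geometric_step_ge => //; first by rewrite (le_trans ler01)// D1_ge1.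
    by rewrite (le_trans xM)// ler_weXn2l// ltW.
rewrite monotone_convergence//.
apply: lime_le.
  apply: ereal_nondecreasing_is_cvgn => M N MN.
  apply: ge0_le_integral => // x D1x; exact: nd.
apply: nearW => N; rewrite integral_step// lee_fin.
case: HT => _ _ _ /(_ r n N r1) + _; apply: le_trans.
rewrite lerD2l; apply: ler_sum => j _; rewrite ler_wpM2l ?step_weight_ge0//.
have rj : 0 <= r ^+ j by rewrite exprn_ge0// ltW// (lt_trans ltr01).
by rewrite -lee_fin -tailE// quantile_measure_tail_le.
Qed.

(** Both the functional and the measure integrate the step functions, and differ
    there by at most one step of the grid, that is a factor [r ^ n].  The moment
    and [mom n] agree up to powers of [r], for every ratio [1 < r]. *)
Theorem quantile_measure_moment n :
  (\int[sigma]_(x in D1) (x ^+ n)%:E = (mom n)%:E)%E.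
Proof.
have mD1 : measurable D1 by exact: measurable_itv.
set I := (\int[sigma]_(x in D1) _)%E.
have I0 : (0 <= I)%E by apply: integral_ge0 => x; exact: X0.
have Ifin : I \is a fin_num.
  rewrite ge0_fin_numE//; apply: le_lt_trans (moment_le n (ltr1n R 2)) _.
  by rewrite ltry.
have up r : 1 < r -> fine I <= r ^+ n * mom n.
  by move=> r1; rewrite -lee_fin fineK// moment_le.
have low r : 1 < r -> mom n <= r ^+ (2 * n) * fine I.
  move=> r1; have r0 : 0 <= r by rewrite ltW// (lt_trans ltr01).
  have rn0 k : 0 <= r ^+ k by rewrite exprn_ge0.
  apply: (@le_of_geometric_error _ _ (mom n.+1 / r) r r1) => N.
  have [_ _ _ _ /(_ r n N.+1 r1)] := HT.
  rewrite exprS invfM mulrA => /le_trans; apply; rewrite lerD2r.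
  have S : mom 0 + \sum_(j < N) step_weight r n j * tail (r ^+ j) <= r ^+ n * fine I.
    rewrite -lee_fin -integral_step// EFinM fineK// /I -ge0_integralZl_EFin//.
    apply: ge0_le_integral => //.
    - move=> x _; rewrite lee_fin addr_ge0// sumr_ge0// => j _.
      by rewrite mulr_ge0// step_weight_ge0.
    - by apply/measurable_EFinP/measurable_funTS; exact: measurable_step.
    - by apply: emeasurable_funM.
    - move=> x /D1_ge1 x1; rewrite -EFinM lee_fin; exact: geometric_step_le.
    - exact: X0.
  rewrite mul2n -addnn exprD -mulrA; apply: le_trans (ler_wpM2l (rn0 n) S).
  rewrite big_ord_recl expr0 mulrDr addrA; apply: lerD.
    rewrite /step_weight mul1n mul0n expr0.
    have : (r ^+ n - 1) * H 1 <= (r ^+ n - 1) * mom 0.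
      rewrite ler_wpM2l ?subr_ge0 ?exprn_ege1 ?(ltW r1)//.
      have [Hn _ Hs _ _] := HT.
      by rewrite -(Hs 0 ltr01) Hn.
    lra.
  rewrite mulr_sumr; apply: ler_sum => j _; rewrite !lift0 step_weightS -mulrA.
  rewrite ler_wpM2l// ler_wpM2l ?step_weight_ge0//.
  rewrite -lee_fin -tailE//; apply: quantile_measure_tail_ge => //.
  by rewrite ltr_eXn2l.
apply/eqP; rewrite -(fineK Ifin) eqe; apply/eqP/le_anti/andP; split.
- have := @horner_ge0_right R ((mom n)%:P * 'X^n - (fine I)%:P) 1.
  rewrite !hornerE expr1n mulr1 subr_ge0; apply => x x1.
  by rewrite !hornerE subr_ge0 mulrC up.
- have := @horner_ge0_right R ((fine I)%:P * 'X^(2 * n) - (mom n)%:P) 1.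
  rewrite !hornerE expr1n mulr1 subr_ge0; apply => x x1.
  by rewrite !hornerE subr_ge0 mulrC low.
Qed.

End quantile_moments.

(** * The determinate cases *)

Lemma integral_density_on d (T : measurableType d) (R : realType)
    (m : {measure set T -> \bar R}) (f : T -> R) (mf : measurable_fun setT f)
    (f0 : forall x, 0 <= f x) (D : set T) (g : T -> \bar R) :
  measurable D -> measurable_fun D g -> (forall x, D x -> (0 <= g x)%E) ->
  (\int[density m mf f0]_(x in D) g x = \int[m]_(x in D) (g x * (f x)%:E))%E.
Proof.
move=> mD mg g0; rewrite [LHS]integral_mkcond [RHS]integral_mkcond integral_density.
- by apply: eq_integral => x _; rewrite /patch; case: ifP => // _; rewrite mul0e.
- exact/(measurable_restrictT _ _).1.
- by move=> x; rewrite /patch; case: ifPn => // /set_mem/g0.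
Qed.

Section determinate_cases.
Context (R : realType) (eta : option nat) (kappa : nat).
Variable mu : discrete_measure R eta kappa.
Local Notation borel := {measure set (measurableTypeR R) -> \bar R}.
Local Notation x0 := (circuit ord0 : digraph eta kappa).
Local Notation Rp := (`[0%R, +oo[%classic : set (measurableTypeR R)).
Variables (P : borel) (Q : J eta -> borel).
Hypothesis PS : S_representing (fun n => hphi mu n x0) P.
Hypothesis QS : forall i, S_representing (fun n => hphi mu n (branch i 0)) (Q i).
Local Notation nu := (branch_measure mu Q).

Let gam n : R := fine (hphi mu n x0).
Let gamE n : hphi mu n x0 = (gam n)%:E.
Proof. by rewrite fineK//; exact: (PS.2 n).1. Qed.

Let gam_step n : gam (n + kappa.+1) = gam n + gap mu n.
Proof. by rewrite /gap !gamE/= addrCA subrr addr0. Qed.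

Let mRp : measurable Rp. Proof. exact: measurable_itv. Qed.

Let Xmeas n (D : set (measurableTypeR R)) : measurable_fun D (fun t => (t ^+ n)%:E).
Proof. by apply/measurable_EFinP; exact: measurable_funTS. Qed.

Let X0 n t : Rp t -> (0 <= (t ^+ n)%:E)%E.
Proof. by rewrite /= in_itv/= andbT lee_fin => t0; exact: exprn_ge0. Qed.

Section no_mass_below_one.
Hypothesis P01 : P `[0%R, (1 : R)%R[%classic = 0%E.

(* Truncation makes the density nonnegative everywhere; it agrees with
   [t ^ (kappa + 1) - 1] on [1, +oo[, which carries [P]. *)
Let excess (t : R) : R := Num.max t 1 ^+ kappa.+1 - 1.
Let excess0 t : 0 <= excess t.
Proof. by rewrite subr_ge0 exprn_ege1// le_max lexx orbT. Qed.
Let m_excess : measurable_fun setT (excess : measurableTypeR R -> R).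
Proof. by apply: measurable_funB => //; apply: measurable_funX; exact: measurable_maxr. Qed.
Let excess_measure : borel := density P m_excess excess0.

Let split_power (A : set (measurableTypeR R)) n : measurable A -> A `<=` Rp ->
  (\int[P]_(t in A) (t ^+ (n + kappa.+1))%:E =
   \int[P]_(t in A) ((t ^+ n)%:E * (excess t)%:E) + \int[P]_(t in A) (t ^+ n)%:E)%E.
Proof.
move=> mA AR.
have mN : measurable (`[0%R, (1 : R)%R[%classic : set (measurableTypeR R)) by exact: measurable_itv.
have pos n' t : A t -> (0 <= (t ^+ n')%:E)%E by move=> /AR; exact: X0.
have mE : measurable_fun A (fun t => ((t ^+ n)%:E * (excess t)%:E)%E).
  by apply: emeasurable_funM => //; apply/measurable_EFinP/measurable_funTS.
have E0 t : A t -> (0 <= (t ^+ n)%:E * (excess t)%:E)%E.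
  by move=> At; rewrite mule_ge0 ?pos// lee_fin.
rewrite -ge0_integralD//; last exact: pos.
rewrite (ge0_negligible_integral mN mA (@Xmeas _ _) (pos _) P01).
rewrite [RHS](ge0_negligible_integral mN mA _ _ P01); last 2 first.
- exact: emeasurable_funD.
- by move=> t At; rewrite adde_ge0 ?E0 ?pos.
apply: eq_integral => t; rewrite inE => -[/AR].
rewrite /= !in_itv/= andbT => t0 /negP; rewrite t0/= -leNgt => t1.
rewrite /excess (max_idPl t1) -EFinM -EFinD exprD.
by congr EFin; ring.
Qed.

Lemma excess_represents :
  S_representing (fun n => hphi mu (n + kappa.+1) x0 - hphi mu n x0)%E excess_measure.
Proof.
split.
  rewrite /excess_measure /= /density null_set_integral//; last exact: PS.1.
  by apply/measurable_EFinP; exact: measurable_funTS.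
move=> n; rewrite (gapE PS); split => //.
rewrite integral_density_on//; last exact: X0.
have := split_power n mRp (@subset_refl _ _).
rewrite -!(PS.2 _).2 !gamE gam_step addrC EFinD.
by move: (\int[P]_(t in _) _)%E => [s| |]//= [] /addIr ->.
Qed.

(** [P] with the density [excess] and the branch measure represent the same
    determinate sequence. *)
Theorem balanced_of_no_mass_below_one :
  S_determinate (fun n => hphi mu (n + kappa.+1) x0 - hphi mu n x0)%E ->
  balanced mu P Q.
Proof.
move=> [_ uniq] A mA AR.
have := split_power 0 mA AR; rewrite add0n => ->.
have -> : (\int[P]_(t in A) ((t ^+ 0)%:E * (excess t)%:E) = excess_measure A)%E.
  by apply: eq_integral => t _; rewrite expr0 mul1e.
have -> : (\int[P]_(t in A) (t ^+ 0)%:E = P A)%E.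
  by under eq_integral do rewrite expr0; rewrite integral_cst// mul1e.
by rewrite (uniq _ _ excess_represents (branch_represents PS QS) A mA) addeC branch_measureE.
Qed.

End no_mass_below_one.

Let loop_power (t : R) : R := Num.max t 0 ^+ kappa.+1.
Let loop_power0 t : 0 <= loop_power t.
Proof. by rewrite exprn_ge0// le_max lexx orbT. Qed.
Let m_loop_power : measurable_fun setT (loop_power : measurableTypeR R -> measurableTypeR R).
Proof. by apply: measurable_funX; exact: measurable_maxr. Qed.

Let loop_power_moment (m : borel) (g : nat -> R) n :
  m `]-oo, 0%R[%classic = 0%E ->
  (forall n, \int[m]_(t in Rp) (t ^+ n)%:E = (g n)%:E)%E ->
  (\int[m]_t (loop_power t ^+ n)%:E = (g (n * kappa.+1))%:E)%E.
Proof.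
move=> m0 mg; rewrite integral_half_line//; last 2 first.
- by apply/measurable_EFinP; exact: measurable_funX.
- by move=> t; rewrite lee_fin exprn_ge0.
rewrite -mg; apply: eq_integral => t; rewrite inE/= in_itv/= andbT => t0.
by rewrite /loop_power (max_idPl t0) -exprM mulnC.
Qed.

Let poly_integral (m : borel) (g : nat -> R) :
  (forall n, \int[m]_t (loop_power t ^+ n)%:E = (g n)%:E)%E ->
  forall (q : {poly R}) N, (size q <= N)%N ->
  m.-integrable setT (EFin \o (fun t => q.[loop_power t])) /\
  \int[m]_t q.[loop_power t] = \sum_(i < N) q`_i * g i.
Proof.
move=> mg q N qN.
have XI n : m.-integrable setT (EFin \o (fun t => loop_power t ^+ n)).
  apply/integrableP; split; first by apply/measurable_EFinP; exact: measurable_funX.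
  rewrite (eq_integral (fun t : measurableTypeR R => (loop_power t ^+ n)%:E)); last first.
    by move=> t _; rewrite /= ger0_norm// exprn_ge0// loop_power0.
  by rewrite mg ltry.
have fI i : m.-integrable setT (EFin \o (fun t => q`_i * loop_power t ^+ i)).
  exact: (@integrableZl _ _ _ m _ measurableT q`_i _ (XI i)).
have [SI SE] := Rintegral_sumr N fI.
have E : (fun t => q.[loop_power t]) = fun t => \sum_(i < N) q`_i * loop_power t ^+ i.
  by apply/funext => t; rewrite (horner_coef_wide _ qN).
rewrite E; split => //; rewrite SE; apply: eq_bigr => i _.
by rewrite RintegralZl// /Rintegral mg.
Qed.

Let momP n : (\int[P]_t (loop_power t ^+ n)%:E = (gam (n * kappa.+1))%:E)%E.
Proof.
by apply: loop_power_moment => [|j]; [exact: PS.1|rewrite -(PS.2 j).2 gamE].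
Qed.

Let momN n : (\int[nu]_t (loop_power t ^+ n)%:E = (gap mu (n * kappa.+1))%:E)%E.
Proof.
apply: loop_power_moment => [|j]; last exact: branch_moment PS QS j.
exact: (branch_represents PS QS).1.
Qed.

Let functional (q : {poly R}) : R := \int[P]_t q.[loop_power t].

(* ['X - 1] turns moments of [P] into differences of moments, which are those of
   the branch measure. *)
Let functional_shift q : functional (('X - 1) * q) = \int[nu]_t q.[loop_power t].
Proof.
have sizeM : (size (('X - 1) * q)%R <= (size q).+1)%N.
  by rewrite (leq_trans (size_polyMleq _ _))// -[1]/(1%:P) size_XsubC.
rewrite /functional (poly_integral momP sizeM).2 (poly_integral momN (leqnn _)).2.
have coefM i : (('X - 1) * q)`_i = (if i is j.+1 then q`_j else 0) - q`_i.
  by rewrite mulrBl mul1r coefB coefXM; case: i.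
under eq_bigr do rewrite coefM mulrBl.
rewrite sumrB big_ord_recl mul0r add0r [X in _ - X]big_ord_recr/=.
rewrite (nth_default _ (leqnn _)) mul0r addr0 -sumrB; apply: eq_bigr => i _.
by rewrite /bump leq0n add0n add1n mulSn addnC gam_step; ring.
Qed.

(** Positivity on the half line [1, +oo[: on it a nonnegative polynomial is
    [A + ('X - 1) * B], where [A] is integrated against [P] and [B] against the
    branch measure. *)
Let functional_ge0 q : nonneg_from 1 q -> 0 <= functional q.
Proof.
move=> /shifted_cone_of_nonneg[A [B [A0 B0 ->]]].
have [AI _] := poly_integral momP (leqnn (size A)).
have [BI _] := poly_integral momP (leqnn (size (('X - 1) * B)%R)).
rewrite /functional; under eq_Rintegral do rewrite hornerD.
rewrite RintegralD// addr_ge0//.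
  by apply: Rintegral_ge0 => t _; apply: A0.
by rewrite [X in 0 <= X]functional_shift; apply: Rintegral_ge0 => t _; apply: B0.
Qed.

Let polynomials : set ((R -> R) * R) := [set z | exists q, z = (horner q, functional q)].

Let polynomials_positive : positive_graph [set x | 1 <= x] polynomials.
Proof.
split.
- exists 0; rewrite /functional; congr pair.
    by apply/funext => x; rewrite horner0.
  by under eq_Rintegral do rewrite horner0; rewrite /Rintegral integral0.
- move=> c _ _ [p ->] [q ->]; exists (c *: p + q); congr pair.
    by apply/funext => x; rewrite /= hornerD hornerZ.
  have [pI _] := poly_integral momP (leqnn (size p)).
  have [qI _] := poly_integral momP (leqnn (size q)).
  have cpI := @integrableZl _ _ _ P _ measurableT c _ pI.
  rewrite /= /functional; under [RHS]eq_Rintegral do rewrite hornerD hornerZ.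
  by rewrite (RintegralD measurableT cpI qI) RintegralZl.
- by move=> _ [q ->] /= q0; apply: functional_ge0 => x; exact: q0.
Qed.

(** Extend the functional on polynomials to the indicators of rays, which lie
    between the constants [0] and [1], and read off a measure from its values
    there. *)
Lemma represented_from_one : exists sigma : borel,
  S_representing (fun j => hphi mu (j * kappa.+1) x0) sigma /\
  sigma `]-oo, (1 : R)%R[%classic = 0%E.
Proof.
have [G [GP BG Gdom]] := riesz_extension polynomials_positive.
have GX n : G (fun x => x ^+ n, gam (n * kappa.+1)).
  apply: BG; exists 'X^n; congr pair; first by apply/funext => x; rewrite hornerXn.
  rewrite /functional; under eq_Rintegral do rewrite hornerXn.
  by rewrite /Rintegral momP.
have [|H HT] := tail_function_exists GP GX.
  move=> a; apply: Gdom; exists (horner 0, functional 0), (horner 1, functional 1).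
  split; [by exists 0|by exists 1|].
  by move=> x _ /=; rewrite horner0 hornerE; case: (_ < _)%R; rewrite ?lexx ?ler01.
exists (quantile_measure HT : borel); split; last exact: quantile_measure_lt1.
have lt1 := quantile_measure_lt1 HT.
split.
  apply/eqP; rewrite -measure_le0 -lt1; apply: le_measure; rewrite ?inE//.
  by move=> t /=; rewrite !in_itv/= => /lt_trans; apply.
move=> n; rewrite gamE; split => //.
rewrite -(quantile_measure_moment HT n).
have mN : measurable (`]-oo, 1%R[%classic : set (measurableTypeR R)) by exact: measurable_itv.
rewrite [RHS](ge0_negligible_integral mN mRp _ _ lt1)//; last exact: X0.
congr (integral _ _ _); apply/seteqP; split => t; rewrite /= !in_itv/= !andbT.
  by move=> t1; rewrite (le_trans ler01 t1); split => //; apply/negP; rewrite -leNgt.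
by move=> [_ /negP]; rewrite -leNgt.
Qed.

(** The image of [P] under [t |-> t ^ (kappa + 1)] and the measure of
    [represented_from_one] represent the same determinate sequence, and
    [t ^ (kappa + 1) < 1] amounts to [t < 1]. *)
Theorem no_mass_of_determinate :
  S_determinate (fun j => hphi mu (j * kappa.+1) x0) ->
  P `[0%R, (1 : R)%R[%classic = 0%E.
Proof.
move=> [_ uniq]; have [sigma [sigmaS sigma1]] := represented_from_one.
pose p : borel :=
  measure_function_pushforward__canonical__measure_function_Measure P m_loop_power.
have pS : S_representing (fun j => hphi mu (j * kappa.+1) x0) p.
  split.
    rewrite /p /= /pushforward (_ : _ @^-1` _ = set0) ?measure0//.
    by apply/seteqP; split => // t /=; rewrite in_itv/= ltNge loop_power0.
  move=> n; rewrite gamE; split => //.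
  have Rp0 : {in Rp, forall t : measurableTypeR R, (0 <= (t ^+ n)%:E)%E}.
    by move=> t /set_mem/X0.
  rewrite -momP.
  apply/esym/(etrans (ge0_integral_pushforward m_loop_power P mRp (@Xmeas n Rp) Rp0)).
  rewrite (_ : _ @^-1` _ = setT)//; apply/seteqP; split => // t _ /=.
  by rewrite in_itv/= andbT loop_power0.
have := uniq _ _ pS sigmaS `[0%R, (1 : R)%R[%classic (measurable_itv _).
have -> : sigma `[0%R, (1 : R)%R[%classic = 0%E.
  apply/eqP; rewrite -measure_le0 -sigma1; apply: le_measure; rewrite ?inE//.
  by move=> t /=; rewrite !in_itv/= => /andP[].
move=> p01; apply/eqP; rewrite -measure_le0 -[leRHS]p01 /p /= /pushforward.
apply: le_measure; rewrite ?inE//.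
  rewrite -[X in measurable X]setTI; exact: m_loop_power.
move=> t /=; rewrite !in_itv/= loop_power0/= /loop_power => /andP[t0 t1].
by rewrite (max_idPl t0) exprn_ilt1.
Qed.

End determinate_cases.

(** * Subnormality *)

Unset Implicit Arguments.
Local Open Scope ereal_scope.

Theorem theorem4p3p3 (R : realType) (eta : option nat) (kappa : nat)
    (mu : discrete_measure R eta kappa) :
  eta <> Some 0%N ->
  let x0 : digraph eta kappa := circuit ord0 in
  stieltjes (fun n => hphi mu n x0) ->
  (forall i : J eta, stieltjes (fun n => hphi mu n (branch i 0))) ->
  let delta := fun n => hphi mu (n + kappa.+1)%N x0 - hphi mu n x0 in
  let hstep := fun j => hphi mu (j * kappa.+1)%N x0 in
  stieltjes delta /\
  ((S_determinate delta /\
      exists P, S_representing (fun n => hphi mu n x0) P /\ P `[0%R, (1 : R)%R[%classic = 0)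
   \/ (S_determinate delta /\ S_determinate hstep)
   \/ carleman hstep
   \/ carleman (fun j => hstep j.+1 - hstep j) ->
   op_subnormal (comp_op mu)).
Proof.
move=> eta0 x0 [P PS] /choice[Q QS] delta hstep.
split; first by exists (branch_measure mu Q); exact: branch_represents PS QS.
move=> [[det [P' [P'S P'01]]]|[[det hdet]|[carl|carl]]].
- apply: (subnormal_of_balanced P'S QS).
  exact: balanced_of_no_mass_below_one P'S QS P'01 det.
- apply: (subnormal_of_balanced PS QS).
  exact: balanced_of_no_mass_below_one PS QS (no_mass_of_determinate PS QS hdet) det.
- apply: (subnormal_of_balanced PS QS).
  exact: balanced_of_carleman PS QS carl.
- apply: (subnormal_of_balanced PS QS).
  exact: balanced_of_carleman_gap PS QS eta0 carl.
Qed.
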